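(* Let $q$ be a prime power. The hyperplane-orbit distribution is a complete invariant for webs of conics in $\mathrm{PG}(2,q)$ up to projective equivalence, with the exception of the pair $\mathcal W_{15,1},\mathcal W_{16,1}$ for $q$ odd and the pair $\mathcal W_{15,1},\mathcal W_{16,3}$ for $q$ even. That is: if $\mathcal W$ and $\mathcal W'$ are webs of conics in $\mathrm{PG}(2,q)$ which contain the same number of double lines, the same number of pairs of real lines, the same number of pairs of conjugate imaginary lines and the same number of non-singular conics, then $\mathcal W$ and $\mathcal W'$ are projectively equivalent, unless ($q$ is odd and) one of them is projectively equivalent to $\mathcal W_{15,1}$ and the other to $\mathcal W_{16,1}$, or ($q$ is even and) one of them is projectively equivalent to $\mathcal W_{15,1}$ and the other to $\mathcal W_{16,3}$; in these exceptional cases the two webs are inequivalent and have the same hyperplane-orbit distribution.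
   Context: A conic of $\mathrm{PG}(2,q)$ is given by a nonzero quadratic form in $X_0,X_1,X_2$ over $\mathbb F_q$ up to nonzero scalar. It is a double line (scalar multiple of the square of a linear form over $\mathbb F_q$), a pair of real lines (product of two non-proportional linear forms over $\mathbb F_q$), a pair of conjugate imaginary lines (scalar multiple of a product of two non-proportional linear forms conjugate over $\mathbb F_{q^2}$), or a non-singular conic. A web of conics is a 3-dimensional projective subspace of the 5-dimensional projective space of quadratic forms; $(f_1,f_2,f_3,f_4)$ denotes the web spanned by linearly independent forms $f_1,\dots,f_4$. Webs are projectively equivalent if some element of $\mathrm{PGL}(3,q)$, acting by linear substitution of variables, maps one to the other. The webs correspond to lines of $\mathrm{PG}(5,q)$: a conic $\sum_{0\le i\le j\le2} a_{ij}X_iX_j$ corresponds to the hyperplane $a_{00}Y_0+a_{01}Y_1+a_{02}Y_2+a_{11}Y_3+a_{12}Y_4+a_{22}Y_5=0$, and a web corresponds to the line that is the intersection of the hyperplanes of its conics. The hyperplane-orbit distribution of the web (equivalently of its line) is the 4-tuple $[h_1,h_{2,r},h_{2,i},h_3]$ of the numbers of double lines, pairs of real lines, pairs of conjugate imaginary lines and non-singular conics in the web. The named webs are: $\mathcal W_{15,1}=(X_0X_2,\;X_1X_2,\;X_0X_1-X_2^2,\;v_1^{-1}X_0^2+uX_0X_1-X_1^2)$, where $u,v_1\in\mathbb F_q$, $v_1\neq0$, satisfy $v_1\lambda^2+uv_1\lambda-1\ne0$ for all $\lambda\in\mathbb F_q$ and, if $q$ is odd, $-v_1$ is a square in $\mathbb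 F_q$ (the equivalence class does not depend on the choice of such $u,v_1$); $\mathcal W_{16,1}=(X_0^2,\;X_0X_1,\;X_0X_2-X_1^2,\;X_2^2)$; $\mathcal W_{16,3}=(X_0^2,\;X_0X_1,\;X_0X_2+X_1^2,\;X_1X_2+X_2^2)$ ($q$ even).
   Formalization: For q=2 two inequivalent, non-exceptional webs both have hyperplane-orbit distribution [1,6,4,4], so the claim that equal distributions imply equivalence or an exceptional pair is stated with the case q=2, distribution [1,6,4,4] excluded. *)

(* Defs.v *)
From HB Require Import structures.
From mathcomp Require Import all_boot all_order all_algebra all_field.
From mathcomp Require Import mpoly.

Set Implicit Arguments.
Unset Strict Implicit.
Unset Printing Implicit Defensive.

Import GRing.Theory.
Local Open Scope ring_scope.

Definition i0 : 'I_3 := @Ordinal 3 0 isT.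
Definition i1 : 'I_3 := @Ordinal 3 1 isT.
Definition i2 : 'I_3 := @Ordinal 3 2 isT.

(* Linear and quadratic forms are given by their coefficient vectors; a
   quadratic form by (a00, a01, a02, a11, a12, a22), the order of the
   coordinates Y_0, ..., Y_5 of PG(5,q). *)

Definition qmonom : 6.-tuple 'X_{1..3} :=
  [tuple U_(i0) + U_(i0); U_(i0) + U_(i1); U_(i0) + U_(i2);
         U_(i1) + U_(i1); U_(i1) + U_(i2); U_(i2) + U_(i2)]%MM.

Section Forms.

Variable R : comNzRingType.

Definition lform (l : 'rV[R]_3) : {mpoly R[3]} := \sum_(i < 3) l 0 i *: 'X_i.

Definition qform (a : 'rV[R]_6) : {mpoly R[3]} :=
  \sum_(k < 6) a 0 k *: 'X_[tnth qmonom k].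

(* Inverse of qform on homogeneous polynomials of degree 2. *)
Definition qcoefs (p : {mpoly R[3]}) : 'rV[R]_6 :=
  \row_(k < 6) p@_(tnth qmonom k).

(* X_i |-> \sum_j A i j X_j *)
Definition lin_subst (A : 'M[R]_3) (p : {mpoly R[3]}) : {mpoly R[3]} :=
  p \mPo [tuple lform (row i A) | i < 3].

End Forms.

Section Conics.

(* iota embeds F = F_q in L, which is meant to be F_{q^2}. *)
Variables (F L : finFieldType) (iota : {rmorphism F -> L}).

Definition double_line (a : 'rV[F]_6) : bool :=
  [exists c : F, exists l : 'rV[F]_3,
    [&& c != 0, l != 0 & qform a == c *: lform l ^+ 2]].

(* [free [:: l; m]] says that l and m are nonzero and non-proportional. *)
Definition real_lines (a : 'rV[F]_6) : bool :=
  [exists l : 'rV[F]_3, exists m : 'rV[F]_3,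
    free [:: l; m] && (qform a == lform l * lform m)].

Definition conj_form (l : 'rV[L]_3) : 'rV[L]_3 :=
  map_mx (fun x : L => x ^+ #|F|) l.

Definition imaginary_lines (a : 'rV[F]_6) : bool :=
  [exists c : F, exists l : 'rV[L]_3,
    [&& c != 0, free [:: l; conj_form l] &
        map_mpoly iota (qform a) == iota c *: (lform l * lform (conj_form l))]].

(* A conic is of exactly one of four types, so non-singular means: a nonzero
   form that is of none of the other three types. *)
Definition nonsingular_conic (a : 'rV[F]_6) : bool :=
  [&& a != 0, ~~ double_line a, ~~ real_lines a & ~~ imaginary_lines a].

Definition conic (a : 'rV[F]_6) : {set 'rV[F]_6} :=
  [set c *: a | c : F & c != 0].

Definition nb_conics (W : {vspace 'rV[F]_6}) (P : pred 'rV[F]_6) : nat :=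
  #|[set conic a | a : 'rV[F]_6 & [&& a \in W, a != 0 & P a]]|.

Definition hyperplane_orbit_distribution (W : {vspace 'rV[F]_6}) :
    nat * nat * nat * nat :=
  (nb_conics W double_line, nb_conics W real_lines,
   nb_conics W imaginary_lines, nb_conics W nonsingular_conic).

End Conics.

Section Webs.

Variable F : finFieldType.

Definition web (W : {vspace 'rV[F]_6}) : Prop := \dim W = 4%N.

Definition proj_equiv (W W' : {vspace 'rV[F]_6}) : Prop :=
  exists2 A : 'M[F]_3, A \in unitmx &
    forall a' : 'rV[F]_6, a' \in W' <->
      exists2 a : 'rV[F]_6, a \in W & qform a' = lin_subst A (qform a).

Definition web_of (f1 f2 f3 f4 : {mpoly F[3]}) : {vspace 'rV[F]_6} :=
  <<[:: qcoefs f1; qcoefs f2; qcoefs f3; qcoefs f4]>>%VS.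

Local Notation X0 := ('X_i0 : {mpoly F[3]}).
Local Notation X1 := ('X_i1 : {mpoly F[3]}).
Local Notation X2 := ('X_i2 : {mpoly F[3]}).

Definition W15_1_params (u v1 : F) : Prop :=
  [/\ v1 != 0,
      forall x : F, v1 * x ^+ 2 + u * v1 * x - 1 != 0 &
      odd #|F| -> exists w : F, w ^+ 2 = - v1].

Definition W15_1 (u v1 : F) : {vspace 'rV[F]_6} :=
  web_of (X0 * X2) (X1 * X2) (X0 * X1 - X2 ^+ 2)
         (v1^-1 *: X0 ^+ 2 + u *: (X0 * X1) - X1 ^+ 2).

Definition W16_1 : {vspace 'rV[F]_6} :=
  web_of (X0 ^+ 2) (X0 * X1) (X0 * X2 - X1 ^+ 2) (X2 ^+ 2).

Definition W16_3 : {vspace 'rV[F]_6} :=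
  web_of (X0 ^+ 2) (X0 * X1) (X0 * X2 + X1 ^+ 2) (X1 * X2 + X2 ^+ 2).

Definition equiv_to_pair (V V' W W' : {vspace 'rV[F]_6}) : Prop :=
  (proj_equiv W V /\ proj_equiv W' V') \/ (proj_equiv W V' /\ proj_equiv W' V).

Definition exceptional_pair (u v1 : F) (W W' : {vspace 'rV[F]_6}) : Prop :=
  (odd #|F| /\ equiv_to_pair (W15_1 u v1) W16_1 W W') \/
  (~~ odd #|F| /\ equiv_to_pair (W15_1 u v1) W16_3 W W').

End Webs.

(* The parameters u, v1 and the field L = F_{q^2} exist for every F. *)

Lemma exists_irred_param (F : finFieldType) :
  exists t : F, forall x : F, x ^+ 2 + t * x + 1 != 0.
Proof.
pose g (x : F) : F := - (x + x^-1).
have lt_g : (#|[set g x | x in [set~ 0%R]]| < #|[set: F]|)%N.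
  apply: leq_ltn_trans (leq_imset_card _ _) _.
  by rewrite cardsC1 cardsT ltn_predL; apply/card_gt0P; exists (0 : F).
have /subsetPn[t _ tNg] : ~~ ([set: F] \subset [set g x | x in [set~ 0]]).
  by apply: contraL lt_g => /subset_leq_card; rewrite -leqNgt.
exists t => x; apply: contra tNg => /eqP xE.
have x0 : x != 0.
  by apply: contra_eq_neq xE => ->; rewrite expr0n mulr0 !add0r oner_eq0.
apply/imsetP; exists x; first by rewrite !inE.
apply: (mulIf x0); rewrite /g mulNr mulrDl mulVf // -expr2.
by apply/eqP; rewrite -addr_eq0 addrCA addrA xE.
Qed.

Lemma W15_1_params_exist (F : finFieldType) :
  exists u v1 : F, W15_1_params u v1.
Proof.
have [t tP] := exists_irred_param F.
exists t, (-1); split; first by rewrite oppr_eq0 oner_eq0.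
- move=> x; rewrite mulN1r mulrN1 mulNr -!opprD oppr_eq0; exact: tP.
- by move=> _; exists 1; rewrite opprK expr1n.
Qed.

Lemma quadratic_extension_exists (F : finFieldType) :
  exists (L : finFieldType) (iota : {rmorphism F -> L}),
    #|L| = (#|F| ^ 2)%N.
Proof.
have [t tP] := exists_irred_param F.
pose r : {poly F} := t *: 'X + 1%:P.
pose h : {poly F} := 'X^2 + r.
have szr : (size r < size ('X^2 : {poly F})%R)%N.
  rewrite size_polyXn; apply: leq_ltn_trans (size_polyD _ _) _.
  rewrite gtn_max (leq_ltn_trans (size_scale_leq _ _)) ?size_polyX //=.
  by rewrite size_polyC oner_eq0.
have szh : size h = 3 by rewrite size_polyDl // size_polyXn.
have mh : h \is monic by rewrite monicE lead_coefDl // lead_coefXn.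
have hI : monic_irreducible_poly h.
  split=> //; apply: cubic_irreducible; rewrite ?szh // => x.
  by rewrite rootE /h /r !hornerE; apply: tP.
exists {poly %/ h with hI}, (qpolyC h).
by rewrite card_qfpoly szh.
Qed.

(* Main.v *)
(** A web is the annihilator of a line of PG(5,q), that is, of a pencil of symmetric
3x3 matrices, and equivalence of webs becomes equivalence of pencils under congruence
and change of basis.  Pencils are brought to finitely many normal forms, according to
whether some member has rank one, and to the base points (isotropic vectors common to
all members) and their position with respect to the kernels of the members.

The double lines of the web are the base points of its pencil.  The pairs of real
lines are counted by the common zeros of the bilinear forms of the members, and the
pairs of imaginary lines by those of the Hermitian forms which the members define
over F_{q^2}.  Summing over the members, which form a vector space, expresses both
numbers of zeros through the number of members of each rank; so the hyperplane-orbit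
distribution and the triple (number of base points, number of members of rank at most
1, number of members of rank at most 2) determine each other, and it remains to
compare this triple for the normal forms. *)

Require Import Defs.
From mathcomp Require Import all_boot all_order all_algebra all_field.
From mathcomp Require Import mpoly ring zify.

Set Implicit Arguments.
Unset Strict Implicit.
Unset Printing Implicit Defensive.

Import GRing.Theory Num.Theory.
Local Open Scope ring_scope.

(** * Symmetric matrices and pencils *)

(** A base point killed by no member allows the first rows of the two matrices to be normalised.
    What remains is a binary cubic, the determinant of the general member up to sign, and
    substitutions of the cubic lift to equivalences of pencils. Over a finite field all irreducible
    cubics are equivalent, so the factorisation pattern suffices.

    The counts fail to separate three pairs of normal forms. [W15_1] has the tag [Gquad]; it shares
    its counts with [Gcube], the tag of [W16_1], for odd q, and with [B16], the tag of [W16_3], for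
    even q. The partner contains the square of a linear form whose coefficient vector is killed by a
    member of the pencil, and [W15_1] does not: this property separates them. Over F_2, where q^2 =
    3 q - 2, [O10] and [Gsplit] also coincide, whence the excluded distribution.

    Symmetric matrices and quadratic forms are kept apart throughout: in characteristic 2 they do
    not correspond, and only the incidence pairing links them. *)

Lemma ord3P (P : 'I_3 -> Prop) : P i0 -> P i1 -> P i2 -> forall i, P i.
Proof.
move=> P0 P1 P2 [[|[|[|//]]] Hi].
- by rewrite (_ : Ordinal Hi = i0) //; apply: val_inj.
- by rewrite (_ : Ordinal Hi = i1) //; apply: val_inj.
- by rewrite (_ : Ordinal Hi = i2) //; apply: val_inj.
Qed.

Lemma sum3E (V : nmodType) (E : 'I_3 -> V) : \sum_i E i = E i0 + E i1 + E i2.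
Proof.
rewrite !big_ord_recl big_ord0 addr0 addrA.
by congr (E _ + E _ + E _); apply: val_inj.
Qed.

Section Matrices3.

Variable R : comNzRingType.

Definition mk3 (a b c d e f g h i : R) : 'M[R]_3 :=
  \matrix_(x, y) nth 0 (nth [::] [:: [:: a; b; c]; [:: d; e; f]; [:: g; h; i]] x) y.

Definition sym3 (a b c d e f : R) : 'M[R]_3 := mk3 a b c b d e c e f.

Definition rv3 (x y z : R) : 'rV[R]_3 := \row_j nth 0 [:: x; y; z] j.

Definition bform (X : 'M[R]_3) (l m : 'rV[R]_3) : R := (l *m X *m m^T) 0 0.

(** The value of [bform] on [sym3] as an explicit polynomial, which turns every congruence below
    into an identity for [ring]. *)
Definition sbf (a b c d e f p q r p' q' r' : R) : R :=
  a * p * p' + b * (p * q' + q * p') + c * (p * r' + r * p')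
  + d * q * q' + e * (q * r' + r * q') + f * r * r'.

Lemma rv3E (l : 'rV[R]_3) : l = rv3 (l 0 i0) (l 0 i1) (l 0 i2).
Proof. by apply/rowP; elim/ord3P; rewrite !mxE. Qed.

Lemma rv3_eq0 x y z : (rv3 x y z == 0) = [&& x == 0, y == 0 & z == 0].
Proof.
apply/eqP/and3P => [E|[/eqP-> /eqP-> /eqP->]].
  by split; apply/eqP; [move/rowP/(_ i0): E|move/rowP/(_ i1): E|move/rowP/(_ i2): E];
     rewrite !mxE.
by apply/rowP; elim/ord3P; rewrite !mxE.
Qed.

Lemma bformE X l m : bform X l m = \sum_i \sum_j l 0 i * X i j * m 0 j.
Proof.
rewrite /bform !mxE exchange_big /=; apply: eq_bigr => j _.
by rewrite !mxE mulr_suml.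
Qed.

Lemma bform_sym3 a b c d e f p q r p' q' r' :
  bform (sym3 a b c d e f) (rv3 p q r) (rv3 p' q' r')
  = sbf a b c d e f p q r p' q' r'.
Proof. by rewrite bformE !sum3E !mxE /= /sbf; ring. Qed.

Lemma mul_rv3_sym3 a b c d e f p q r :
  rv3 p q r *m sym3 a b c d e f =
  rv3 (p * a + q * b + r * c) (p * b + q * d + r * e) (p * c + q * e + r * f).
Proof. by apply/rowP; elim/ord3P; rewrite !mxE !sum3E !mxE /=. Qed.

Lemma det_mk3 a b c d e f g h i :
  \det (mk3 a b c d e f g h i) =
  a * (e * i - f * h) - b * (d * i - f * g) + c * (d * h - e * g).
Proof.
rewrite (expand_det_row _ i0) sum3E /cofactor.
rewrite !(expand_det_row _ ord0) !big_ord_recl !big_ord0 /cofactor !det_mx11 !mxE /=.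
by rewrite !(expr0, expr1, expr2); ring.
Qed.

Lemma tr_sym3 a b c d e f : (sym3 a b c d e f)^T = sym3 a b c d e f.
Proof. by apply/matrixP; elim/ord3P; elim/ord3P; rewrite !mxE. Qed.

Lemma sym3P (X : 'M[R]_3) : X^T = X ->
  X = sym3 (X i0 i0) (X i0 i1) (X i0 i2) (X i1 i1) (X i1 i2) (X i2 i2).
Proof.
move=> /matrixP E; apply/matrixP; elim/ord3P; elim/ord3P; rewrite !mxE //=;
by rewrite -E mxE.
Qed.

Lemma congr_sym3 p0 p1 p2 p3 p4 p5 p6 p7 p8 a b c d e f :
  mk3 p0 p1 p2 p3 p4 p5 p6 p7 p8 *m sym3 a b c d e f
    *m (mk3 p0 p1 p2 p3 p4 p5 p6 p7 p8)^T =
  let g := sbf a b c d e f in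
  sym3 (g p0 p1 p2 p0 p1 p2) (g p0 p1 p2 p3 p4 p5) (g p0 p1 p2 p6 p7 p8)
       (g p3 p4 p5 p3 p4 p5) (g p3 p4 p5 p6 p7 p8) (g p6 p7 p8 p6 p7 p8).
Proof.
by apply/matrixP; elim/ord3P; elim/ord3P; rewrite !mxE !sum3E !mxE !sum3E !mxE /= /sbf; ring.
Qed.

Lemma sym3_lin s t a b c d e f a' b' c' d' e' f' :
  s *: sym3 a b c d e f + t *: sym3 a' b' c' d' e' f' =
  sym3 (s * a + t * a') (s * b + t * b') (s * c + t * c')
       (s * d + t * d') (s * e + t * e') (s * f + t * f').
Proof. by apply/matrixP; elim/ord3P; elim/ord3P; rewrite !mxE. Qed.

Lemma sym3_0 : sym3 0 0 0 0 0 0 = 0.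
Proof. by apply/matrixP; elim/ord3P; elim/ord3P; rewrite !mxE. Qed.

End Matrices3.

(** * Equivalence of pencils *)

Section Peq.

Variable F : fieldType.
Implicit Types (M N X A B : 'M[F]_3) (l m : 'rV[F]_3).

Lemma unit_mk3 (a b c d e f g h i : F) :
  a * (e * i - f * h) - b * (d * i - f * g) + c * (d * h - e * g) != 0 ->
  mk3 a b c d e f g h i \in unitmx.
Proof. by rewrite unitmxE det_mk3 unitfE. Qed.

Definition peq M N M' N' : Prop :=
  exists2 A, A \in unitmx &
  exists g : F * F * F * F, let: (a, b, c, d) := g in
  [/\ a * d - b * c != 0, A *m M *m A^T = a *: M' + b *: N'
    & A *m N *m A^T = c *: M' + d *: N'].

Lemma peq_refl M N : peq M N M N.
Proof.
exists 1%:M; first exact: unitmx1.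
exists (1, 0, 0, 1); rewrite trmx1 !mulmx1 !mul1mx !scale1r !scale0r addr0 add0r.
by rewrite mulr1 mulr0 subr0 oner_eq0.
Qed.

Lemma congr_comp A B X :
  (B *m A) *m X *m (B *m A)^T = B *m (A *m X *m A^T) *m B^T.
Proof. by rewrite trmx_mul !mulmxA. Qed.

Lemma congr_lin A s t M N :
  A *m (s *: M + t *: N) *m A^T = s *: (A *m M *m A^T) + t *: (A *m N *m A^T).
Proof. by rewrite mulmxDr mulmxDl -!scalemxAr -!scalemxAl. Qed.

Lemma peq_trans M1 N1 M N M2 N2 : peq M N M1 N1 -> peq M1 N1 M2 N2 -> peq M N M2 N2.
Proof.
case=> A Au [[[[a b] c] d] [D E1 E2]] [B Bu [[[[a' b'] c'] d'] [D' E1' E2']]].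
exists (B *m A); first by rewrite unitmx_mul Bu.
exists (a * a' + b * c', a * b' + b * d', c * a' + d * c', c * b' + d * d'); split.
- rewrite (_ : _ - _ = (a * d - b * c) * (a' * d' - b' * c')); last by ring.
  by rewrite mulf_neq0.
- by rewrite congr_comp E1 congr_lin E1' E2' !scalerDr !scalerA !scalerDl addrACA.
- by rewrite congr_comp E2 congr_lin E1' E2' !scalerDr !scalerA !scalerDl addrACA.
Qed.

Lemma peq_sym M N M' N' : peq M N M' N' -> peq M' N' M N.
Proof.
case=> A Au [[[[a b] c] d] [D E1 E2]].
exists (invmx A); first by rewrite unitmx_inv.
set D0 := a * d - b * c in D.
have K X : invmx A *m (A *m X *m A^T) *m (invmx A)^T = X.
  by rewrite !mulmxA mulVmx // mul1mx -mulmxA -trmx_mul mulVmx // trmx1 mulmx1.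
have E1' : M = a *: (invmx A *m M' *m (invmx A)^T) + b *: (invmx A *m N' *m (invmx A)^T).
  by rewrite -[LHS]K E1 mulmxDr mulmxDl -!scalemxAr -!scalemxAl.
have E2' : N = c *: (invmx A *m M' *m (invmx A)^T) + d *: (invmx A *m N' *m (invmx A)^T).
  by rewrite -[LHS]K E2 mulmxDr mulmxDl -!scalemxAr -!scalemxAl.
exists (d / D0, - b / D0, - c / D0, a / D0); split.
- rewrite (_ : _ - _ = D0^-1); first by rewrite invr_eq0.
  by rewrite /D0; field.
- rewrite E1' E2' !scalerDr !scalerA addrACA -!scalerDl.
  have -> : d / D0 * a + - b / D0 * c = 1 by rewrite /D0; field.
  have -> : d / D0 * b + - b / D0 * d = 0 by rewrite /D0; field.
  by rewrite scale1r scale0r addr0.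
- rewrite E1' E2' !scalerDr !scalerA addrACA -!scalerDl.
  have -> : - c / D0 * a + a / D0 * c = 0 by rewrite /D0; field.
  have -> : - c / D0 * b + a / D0 * d = 1 by rewrite /D0; field.
  by rewrite scale1r scale0r add0r.
Qed.

Lemma peq_congr A M N : A \in unitmx -> peq M N (A *m M *m A^T) (A *m N *m A^T).
Proof.
move=> Au; exists A => //; exists (1, 0, 0, 1).
by rewrite !scale1r !scale0r addr0 add0r mulr1 mulr0 subr0 oner_eq0.
Qed.

Lemma peq_basis a b c d M N : a * d - b * c != 0 ->
  peq M N (a *: M + b *: N) (c *: M + d *: N).
Proof.
move=> D; apply: peq_sym; exists 1%:M; first exact: unitmx1.
by exists (a, b, c, d); rewrite trmx1 !mulmx1 !mul1mx.
Qed.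

(** Turns an equivalence between explicit pencils into scalar identities. The arguments p0 to p8 are
    the rows of the congruence, that is the new basis vectors, and x, y, z, w the coordinates of the
    transformed matrices in the target pencil; most normalisations below consist of these thirteen
    values. *)
Lemma peq_sym3 p0 p1 p2 p3 p4 p5 p6 p7 p8 x y z w
    a b c d e f a' b' c' d' e' f' a1 b1 c1 d1 e1 f1 a1' b1' c1' d1' e1' f1' :
  p0 * (p4 * p8 - p5 * p7) - p1 * (p3 * p8 - p5 * p6) + p2 * (p3 * p7 - p4 * p6) != 0 ->
  x * w - y * z != 0 ->
  (let g := sbf a b c d e f in
   [/\ g p0 p1 p2 p0 p1 p2 = x * a1 + y * a1', g p0 p1 p2 p3 p4 p5 = x * b1 + y * b1'
     & g p0 p1 p2 p6 p7 p8 = x * c1 + y * c1'] /\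
   [/\ g p3 p4 p5 p3 p4 p5 = x * d1 + y * d1', g p3 p4 p5 p6 p7 p8 = x * e1 + y * e1'
     & g p6 p7 p8 p6 p7 p8 = x * f1 + y * f1']) ->
  (let g := sbf a' b' c' d' e' f' in
   [/\ g p0 p1 p2 p0 p1 p2 = z * a1 + w * a1', g p0 p1 p2 p3 p4 p5 = z * b1 + w * b1'
     & g p0 p1 p2 p6 p7 p8 = z * c1 + w * c1'] /\
   [/\ g p3 p4 p5 p3 p4 p5 = z * d1 + w * d1', g p3 p4 p5 p6 p7 p8 = z * e1 + w * e1'
     & g p6 p7 p8 p6 p7 p8 = z * f1 + w * f1']) ->
  peq (sym3 a b c d e f) (sym3 a' b' c' d' e' f')
      (sym3 a1 b1 c1 d1 e1 f1) (sym3 a1' b1' c1' d1' e1' f1').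
Proof.
move=> D D' [[h1 h2 h3] [h4 h5 h6]] [[k1 k2 k3] [k4 k5 k6]].
exists (mk3 p0 p1 p2 p3 p4 p5 p6 p7 p8); first exact: unit_mk3.
exists (x, y, z, w); split=> //; rewrite congr_sym3 /= sym3_lin; congr sym3 => //.
Qed.

End Peq.

(** * Squares and irreducible polynomials over a finite field *)

Section FiniteFields.

Variable F : finFieldType.

Lemma odd_cardF : odd #|F| = (2%:R != 0 :> F).
Proof.
have [p p_pr pF] := finPcharP F.
have En := card_pprimeChar pF; set n := logn p #|F| in En.
have n0 : (n > 0)%N by case: n En (finNzRing_gt1 F) => [->|].
rewrite En oddX -(dvdn_pcharf pF) /= (gtn_eqF n0) /=.
by case: (even_prime p_pr) => [->//|op]; rewrite op dvdn_prime2 //; case: eqP op => // ->.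
Qed.

Lemma card_ge2 : (1 < #|F|)%N.
Proof. exact: finNzRing_gt1. Qed.

Lemma card_odd_ge3 : 2%:R != 0 :> F -> (2 < #|F|)%N.
Proof. by rewrite -odd_cardF; have := card_ge2; case: #|F| => [|[|[|]]]. Qed.

(** Squaring is additive in characteristic 2, hence injective, hence onto since the field is
    finite. *)
Lemma sqrt_char2 (x : F) : 2%:R = 0 :> F -> exists y, x = y ^+ 2.
Proof.
move=> c2; have inj : injective (fun y : F => y ^+ 2).
  move=> y z /= E; apply/eqP; rewrite -subr_eq0 -sqrf_eq0.
  rewrite (_ : (y - z) ^+ 2 = y ^+ 2 - z ^+ 2 + 2%:R * (z ^+ 2 - y * z)); last by ring.
  by rewrite c2 mul0r addr0 E subrr.
have [g _ Kg] := injF_bij inj.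
by exists (g x); rewrite [RHS]Kg.
Qed.

Definition squares : {set F} := [set x ^+ 2 | x : F].

(** A square has at most two roots, so there are at least q / 2 squares; the inequality is strict
    because q is odd. *)
Lemma card_squares : 2%:R != 0 :> F -> (#|F| < 2 * #|squares|)%N.
Proof.
move=> c2; have o : odd #|F| by rewrite odd_cardF.
suff : (#|F| <= 2 * #|squares|)%N by rewrite leq_eqVlt => /orP[/eqP E|//]; rewrite E mul2n odd_double in o.
rewrite -cardsT -sum1_card (partition_big (fun x : F => x ^+ 2) (mem squares)) /=; last first.
  by move=> x _; apply: imset_f.
rewrite mulnC -sum_nat_const; apply: leq_sum => y /imsetP[z _ ->].
rewrite sum1dep_card; apply: leq_trans (_ : #|[set z; - z]| <= 2)%N; last by rewrite cards2; case: eqP.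
by apply: subset_leq_card; apply/subsetP => x; rewrite !inE /= eqf_sqr.
Qed.

(** The values a x^2 and the values c - b y^2 each fill more than half of the field, so the two sets
    meet. *)
Lemma sum_squares (a b c : F) : 2%:R != 0 :> F -> a != 0 -> b != 0 ->
  exists x y, a * x ^+ 2 + b * y ^+ 2 = c.
Proof.
move=> c2 a0 b0.
pose A := [set a * s | s in squares]; pose B := [set c - b * s | s in squares].
have cA : #|A| = #|squares| by apply: card_imset; apply: mulfI.
have cB : #|B| = #|squares|.
  by apply: card_imset => x y /addrI /oppr_inj /(mulfI b0).
have : (0 < #|A :&: B|)%N.
  have := max_card (mem (A :|: B)); have := cardsUI A B; have := card_squares c2.
  rewrite cA cB; move: #|_| #|_| #|_| #|_| => * ; lia.
case/card_gt0P => z /setIP[/imsetP[_ /imsetP[x _ ->] ->] /imsetP[_ /imsetP[y _ ->] E]].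
by exists x, y; rewrite E subrK.
Qed.

Definition nonsq (x : F) := forall w, w ^+ 2 != x.

(** The squares and x times the squares meet only in 0 and each fill more than half of the field, so
    together they cover it; a nonsquare y lies in the second set. *)
Lemma nonsq_ratio (x y : F) : 2%:R != 0 :> F -> nonsq x -> nonsq y ->
  exists2 w, w != 0 & y = x * w ^+ 2.
Proof.
move=> c2 nx ny.
have x0 : x != 0 by have := nx 0; rewrite expr0n /= eq_sym.
pose A := [set x * s | s in squares].
have cA : #|A| = #|squares| by apply: card_imset; apply: mulfI.
have AS : (#|A :&: squares| <= 1)%N.
  rewrite -(cards1 (0 : F)); apply/subset_leq_card/subsetP => z.
  case/setIP => /imsetP[_ /imsetP[u _ ->] ->] /imsetP[v _ E].
  have [->|u0] := eqVneq u 0; first by rewrite expr0n mulr0 inE.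
  case/eqP: (nx (v / u)); rewrite expr_div_n -E; by field.
have : A :|: squares = setT.
  apply/eqP; rewrite eqEcard subsetT cardsT.
  have := cardsUI A squares; have := card_squares c2; move: AS; rewrite cA.
  move: #|_| #|_| #|_| #|_| => *; lia.
move/setP/(_ y); rewrite in_setT => /setUP[/imsetP[_ /imsetP[w _ ->] E]|/imsetP[w _ E]]; last first.
  by have := ny w; rewrite E eqxx.
exists w => //; apply: contraTneq (ny 0) => w0.
by rewrite E w0 expr0n mulr0 eqxx.
Qed.

Lemma nonsqP (x : F) : (exists w, x = w ^+ 2) \/ nonsq x.
Proof.
have [/existsP[w /eqP E]|/existsPn nE] := boolP [exists w : F, w ^+ 2 == x].
  by left; exists w.
by right.
Qed.

(** With n the degree of h, the class of X in F[X]/h is fixed by the power map of exponent q^n. So h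
    divides X^(q^n) - X, which over L is the product of all X - x. *)
Lemma irr_root (L : finFieldType) (iota : {rmorphism F -> L}) (h : {poly F}) :
  h \is monic -> irreducible_poly h -> #|L| = (#|F| ^ (size h).-1)%N ->
  exists x, root (map_poly iota h) x.
Proof.
move=> hm hi cL.
have hI : monic_irreducible_poly h by split.
pose K : finFieldType := {poly %/ h with hI}.
have cK : #|K| = (#|F| ^ (size h).-1)%N by rewrite card_qfpoly.
have dv : h %| 'X^(#|F| ^ (size h).-1) - 'X.
  have E : in_qpoly h 'X ^+ #|K| = in_qpoly h 'X :> K by exact: expf_card.
  have : in_qpoly h ('X^#|K| - 'X) = 0 :> K.
    by rewrite rmorphB rmorphXn /= [X in X - _]E subrr.
  move/val_eqP; rewrite /= -Pdiv.IdomainMonic.modpE mk_monicE //.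
  by rewrite cK.
have : map_poly iota h %| \prod_(x : L) ('X - x%:P).
  rewrite -finField_genPoly cL.
  have -> : 'X^(#|F| ^ (size h).-1) - 'X = map_poly iota ('X^(#|F| ^ (size h).-1) - 'X).
    by rewrite rmorphB rmorphXn /= map_polyX.
  by rewrite dvdp_map.
case/dvdp_prod_XsubC => m Em; move: (eqp_size Em).
rewrite size_map_poly size_prod_XsubC; case: (mask _ _) Em => [|x s] Em szm.
  by have [] := hi; rewrite szm.
by exists x; rewrite (eqp_root Em) root_prod_XsubC inE eqxx.
Qed.

Lemma irr2_root (L : finFieldType) (iota : {rmorphism F -> L}) (b c : F) :
  #|L| = (#|F| ^ 2)%N -> (forall x, x ^+ 2 + b * x + c != 0) ->
  exists x, x ^+ 2 + iota b * x + iota c = 0.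
Proof.
move=> cL nr; pose h := Poly [:: c; b; 1].
have Eh : h = [:: c; b; 1] :> seq F by rewrite (@PolyK _ 0) //= oner_eq0.
have hr x : h.[x] = x ^+ 2 + b * x + c by rewrite horner_Poly /=; ring.
have [||| x] := @irr_root L iota h.
- by rewrite monicE /lead_coef Eh.
- by apply: cubic_irreducible => [|x]; rewrite ?Eh // rootE hr.
- by rewrite Eh.
rewrite rootE (_ : map_poly iota h = Poly [:: iota c; iota b; 1]).
  by rewrite horner_Poly /= => /eqP E; exists x; rewrite -[RHS]E; ring.
by rewrite map_Poly_id0 ?rmorph0 //= rmorph1.
Qed.

Lemma irr3_root (L : finFieldType) (iota : {rmorphism F -> L}) (b c d : F) :
  #|L| = (#|F| ^ 3)%N -> (forall x, x ^+ 3 + b * x ^+ 2 + c * x + d != 0) ->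
  exists x, x ^+ 3 + iota b * x ^+ 2 + iota c * x + iota d = 0.
Proof.
move=> cL nr; pose h := Poly [:: d; c; b; 1].
have Eh : h = [:: d; c; b; 1] :> seq F by rewrite (@PolyK _ 0) //= oner_eq0.
have hr x : h.[x] = x ^+ 3 + b * x ^+ 2 + c * x + d by rewrite horner_Poly /=; ring.
have [||| x] := @irr_root L iota h.
- by rewrite monicE /lead_coef Eh.
- by apply: cubic_irreducible => [|x]; rewrite ?Eh // rootE hr.
- by rewrite Eh.
rewrite rootE (_ : map_poly iota h = Poly [:: iota d; iota c; iota b; 1]).
  by rewrite horner_Poly /= => /eqP E; exists x; rewrite -[RHS]E; ring.
by rewrite map_Poly_id0 ?rmorph0 //= rmorph1.
Qed.

Lemma cubic_extension (b c d : F) :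
  (forall x, x ^+ 3 + b * x ^+ 2 + c * x + d != 0) ->
  exists (L : finFieldType) (iota : {rmorphism F -> L}), #|L| = (#|F| ^ 3)%N.
Proof.
move=> nr; pose h := Poly [:: d; c; b; 1].
have Eh : h = [:: d; c; b; 1] :> seq F by rewrite (@PolyK _ 0) //= oner_eq0.
have hr x : h.[x] = x ^+ 3 + b * x ^+ 2 + c * x + d by rewrite horner_Poly /=; ring.
have hI : monic_irreducible_poly h.
  split; last by rewrite monicE /lead_coef Eh.
  by apply: cubic_irreducible => [|x]; rewrite ?Eh // rootE hr.
exists {poly %/ h with hI}, (qpolyC h).
by rewrite card_qfpoly Eh.
Qed.

(** 1 and [th] are independent over F, so the map from F^2 to L is injective; both sides have q^2
    elements. *)
Lemma ext2_basis (L : finFieldType) (iota : {rmorphism F -> L}) (th : L) :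
  #|L| = (#|F| ^ 2)%N -> (forall x, iota x != th) ->
  forall z, exists x y, z = iota x + iota y * th.
Proof.
move=> cL nF z; pose f (p : F * F) := iota p.1 + iota p.2 * th.
have inj : injective f.
  move=> [x y] [x' y'] /= E.
  have E1 : iota (x - x') = iota (y' - y) * th.
    rewrite !rmorphB /=; apply/eqP; rewrite -subr_eq0; apply/eqP.
    transitivity ((iota x + iota y * th) - (iota x' + iota y' * th)); first by ring.
    by rewrite -[iota x + _]/(f (x, y)) E subrr.
  have [D|D] := eqVneq (y' - y) 0.
    move: E1; rewrite D rmorph0 mul0r -(rmorph0 iota) => /fmorph_inj /eqP.
    by rewrite subr_eq0 => /eqP ->; move/eqP: D; rewrite subr_eq0 => /eqP ->.
  case/eqP: (nF ((x - x') / (y' - y))).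
  by rewrite fmorph_div E1 mulrC mulKf // fmorph_eq0.
have [g _ K] := inj_card_bij inj (eq_leq (etrans cL (esym (etrans (card_prod _ _) (mulnn _))))).
by exists (g z).1, (g z).2; rewrite -[LHS]K.
Qed.

(** Both polynomials have roots x and y in the same quadratic extension. Writing x = be + al y gives
    the substitution al T + be, which takes the first polynomial to al^2 times the second. *)
Lemma irr2_equiv (b c b' c' : F) :
  (forall x, x ^+ 2 + b * x + c != 0) -> (forall x, x ^+ 2 + b' * x + c' != 0) ->
  exists al be, [/\ al != 0, 2%:R * be + b = al * b' & be ^+ 2 + b * be + c = al ^+ 2 * c'].
Proof.
move=> nr nr'; have [L [iota cL]] := quadratic_extension_exists F.
have [x Ex] := irr2_root iota cL nr; have [y Ey] := irr2_root iota cL nr'.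
have nx u : iota u != x.
  apply: contraNneq (nr u) => E; rewrite -(fmorph_eq0 iota) !rmorphD rmorphXn rmorphM /= E.
  by apply/eqP.
have ny u : iota u != y.
  apply: contraNneq (nr' u) => E; rewrite -(fmorph_eq0 iota) !rmorphD rmorphXn rmorphM /= E.
  by apply/eqP.
have [be [al E]] := ext2_basis cL ny x.
exists al, be.
have al0 : al != 0.
  by apply/eqP => al0; case/eqP: (nx be); rewrite E al0 rmorph0 mul0r addr0.
(* The equation of x minus al^2 times that of y is linear in y with coefficients in F, so both
   coefficients vanish. *)
have E2 : iota (be ^+ 2 + b * be + c - al ^+ 2 * c')
   + iota (al * (2%:R * be + b - al * b')) * y = 0.
  rewrite !(rmorphD, rmorphB, rmorphXn, rmorphM, rmorph_nat) /=.
  transitivity (x ^+ 2 + iota b * x + iota c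
     - iota al ^+ 2 * (y ^+ 2 + iota b' * y + iota c')); last by rewrite Ex Ey mulr0 subr0.
  by rewrite E; ring.
have D : al * (2%:R * be + b - al * b') = 0.
  apply/eqP/negPn/negP => D; move/eqP: E2; rewrite addrC addr_eq0 => /eqP E2.
  case/eqP: (ny (- (be ^+ 2 + b * be + c - al ^+ 2 * c') / (al * (2%:R * be + b - al * b')))).
  by rewrite fmorph_div rmorphN -E2 mulrC mulKf // fmorph_eq0.
split=> //.
  by move/eqP: D; rewrite mulf_eq0 (negPf al0) /= subr_eq0 => /eqP.
move/eqP: E2; rewrite D rmorph0 mul0r addr0 fmorph_eq0 subr_eq0 => /eqP ->; ring.
Qed.

End FiniteFields.

(** * Binary cubic forms *)

Section Cubics.

Definition cub (R : comNzRingType) (f0 f1 f2 f3 a b : R) : R :=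
  f0 * a ^+ 3 + f1 * a ^+ 2 * b + f2 * a * b ^+ 2 + f3 * b ^+ 3.

(* The coefficients of cub g0 g1 g2 g3 (x a + y b) (z a + w b). *)
Definition cub0 (R : comNzRingType) (g0 g1 g2 g3 x y z w : R) := cub g0 g1 g2 g3 x z.
Definition cub1 (R : comNzRingType) (g0 g1 g2 g3 x y z w : R) :=
  3%:R * g0 * x ^+ 2 * y + g1 * (2%:R * x * y * z + x ^+ 2 * w)
  + g2 * (y * z ^+ 2 + 2%:R * x * z * w) + 3%:R * g3 * z ^+ 2 * w.
Definition cub2 (R : comNzRingType) (g0 g1 g2 g3 x y z w : R) :=
  3%:R * g0 * x * y ^+ 2 + g1 * (y ^+ 2 * z + 2%:R * x * y * w)
  + g2 * (x * w ^+ 2 + 2%:R * y * z * w) + 3%:R * g3 * z * w ^+ 2.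
Definition cub3 (R : comNzRingType) (g0 g1 g2 g3 x y z w : R) := cub g0 g1 g2 g3 y w.

Variable F : finFieldType.

(** If th^2 = u th + v with u, v in F, the cubic has zero remainder modulo T^2 - u T - v, and the
    quotient T + b + u yields a root in F. *)
Lemma cubic_basis_free (L : fieldType) (iota : {rmorphism F -> L}) (b c d : F) (th : L) :
  (forall x, x ^+ 3 + b * x ^+ 2 + c * x + d != 0) ->
  th ^+ 3 + iota b * th ^+ 2 + iota c * th + iota d = 0 ->
  forall x y z, iota x + iota y * th + iota z * th ^+ 2 = 0 -> [/\ x = 0, y = 0 & z = 0].
Proof.
move=> nr Eth.
have nF u : iota u != th.
  apply: contraNneq (nr u) => E.
  rewrite -(fmorph_eq0 iota) !(rmorphD, rmorphXn, rmorphM) /= E; apply/eqP.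
  by rewrite -[RHS]Eth.
have lin x y : iota x + iota y * th = 0 -> x = 0 /\ y = 0.
  move=> E; have [y0|y0] := eqVneq y 0.
    by move/eqP: E; rewrite y0 rmorph0 mul0r addr0 fmorph_eq0 => /eqP.
  case/eqP: (nF (- x / y)); move/eqP: E; rewrite addr_eq0 => /eqP E.
  by rewrite fmorph_div rmorphN E opprK mulrC mulKf // fmorph_eq0.
move=> x y z E; have [z0|z0] := eqVneq z 0.
  by move: E; rewrite z0 rmorph0 mul0r addr0 => /lin[-> ->].
have z0' : iota z != 0 by rewrite fmorph_eq0.
have [u [v Eq]] : exists u v, th ^+ 2 = iota u * th + iota v.
  exists (- y / z), (- x / z); rewrite !fmorph_div !rmorphN; apply: (mulfI z0').
  apply/eqP; rewrite -subr_eq0; apply/eqP; rewrite -[RHS]E; by field.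
have [|E1 E2] := lin (u * v + b * v + d) (u ^+ 2 + v + b * u + c).
  rewrite !(rmorphD, rmorphXn, rmorphM) /=.
  transitivity (th ^+ 3 + iota b * th ^+ 2 + iota c * th + iota d
    - (th + iota b + iota u) * (th ^+ 2 - (iota u * th + iota v))); first by ring.
  by rewrite Eth Eq subrr mulr0 subrr.
case/eqP: (nr (- (b + u))); rewrite -[d](addrK (u * v + b * v)) [d + _]addrC E1.
rewrite -[c](addrK (u ^+ 2 + v + b * u)) [c + _]addrC E2; ring.
Qed.

Definition cub_anis (f0 f1 f2 f3 : F) :=
  forall a b, cub f0 f1 f2 f3 a b = 0 -> a = 0 /\ b = 0.

Lemma cub_anis_root (L : finFieldType) (iota : {rmorphism F -> L}) f0 f1 f2 f3 :
  #|L| = (#|F| ^ 3)%N -> cub_anis f0 f1 f2 f3 ->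
  exists th, cub (iota f0) (iota f1) (iota f2) (iota f3) th 1 = 0 /\
   forall x y z, iota x + iota y * th + iota z * th ^+ 2 = 0 -> [/\ x = 0, y = 0 & z = 0].
Proof.
move=> cL an.
have f00 : f0 != 0.
  apply/eqP => f00; have [|/eqP] := an 1 0; last by rewrite oner_eq0.
  by rewrite /cub f00; ring.
have nr x : x ^+ 3 + (f1 / f0) * x ^+ 2 + (f2 / f0) * x + f3 / f0 != 0.
  apply/eqP => E; have [|_ /eqP] := an x 1; last by rewrite oner_eq0.
  by rewrite -[RHS](mulr0 f0) -E /cub; field.
have [th Eth] := irr3_root iota cL nr.
exists th; split; last exact: cubic_basis_free nr Eth.
rewrite -[RHS](mulr0 (iota f0)) -Eth /cub !fmorph_div; field.
by rewrite fmorph_eq0.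
Qed.

(** The cubics have roots [th] and [et] in the same extension of degree 3, and a fractional linear
    map over F sends [th] to [et]. Substituted in the second cubic it gives a cubic with root [th],
    hence a multiple of the first. *)
Lemma cub_anis_equiv f0 f1 f2 f3 g0 g1 g2 g3 :
  cub_anis f0 f1 f2 f3 -> cub_anis g0 g1 g2 g3 ->
  exists x y z w k, [/\ x * w - y * z != 0, k != 0,
    f0 = k * cub0 g0 g1 g2 g3 x y z w,
    f1 = k * cub1 g0 g1 g2 g3 x y z w
    & f2 = k * cub2 g0 g1 g2 g3 x y z w /\ f3 = k * cub3 g0 g1 g2 g3 x y z w].
Proof.
move=> an an'.
have f00 : f0 != 0.
  apply/eqP => f00; have [|/eqP] := an 1 0; last by rewrite oner_eq0.
  by rewrite /cub f00; ring.
have [|L [iota cL]] := @cubic_extension F (f1 / f0) (f2 / f0) (f3 / f0).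
  move=> x; apply/eqP => E; have [|_ /eqP] := an x 1; last by rewrite oner_eq0.
  by rewrite -[RHS](mulr0 f0) -E /cub; field.
have [th [Eth Fth]] := cub_anis_root iota cL an.
have [et [Eet Fet]] := cub_anis_root iota cL an'.
have lin x y : iota x + iota y * th = 0 -> x = 0 /\ y = 0.
  by move=> E; have [|-> ->] := Fth x y 0; rewrite ?rmorph0 ?mul0r ?addr0.
have lin' x y : iota x + iota y * et = 0 -> x = 0 /\ y = 0.
  by move=> E; have [|-> ->] := Fet x y 0; rewrite ?rmorph0 ?mul0r ?addr0.
pose m (p : F * F * F * F) : L := let: (x, y, z, w) := p in
  iota x * th + iota y - et * (iota z * th + iota w).
(* The map [m] from F^4 to a field of q^3 elements is additive and cannot be injective. *)
have [x [y [z [w [nz E]]]]] : exists x y z w,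
    ~ [/\ x = 0, y = 0, z = 0 & w = 0] /\ iota x * th + iota y = et * (iota z * th + iota w).
  have : ~~ injectiveb m.
    apply/injectiveP => /leq_card; rewrite !card_prod cL.
    have := card_ge2 F; move: #|F| => q; nia.
  case/injectivePn => [[[[x y] z] w] [[[[x' y'] z'] w'] ne E]].
  exists (x - x'), (y - y'), (z - z'), (w - w'); split.
    case=> /eqP; rewrite subr_eq0 => /eqP hx /eqP; rewrite subr_eq0 => /eqP hy.
    move=> /eqP; rewrite subr_eq0 => /eqP hz /eqP; rewrite subr_eq0 => /eqP hw.
    by rewrite hx hy hz hw eqxx in ne.
  apply/eqP; rewrite -subr_eq0 !rmorphB /=; apply/eqP.
  transitivity (m (x, y, z, w) - m (x', y', z', w')); first by rewrite /m; ring.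
  by rewrite E subrr.
have zw0 : ~ (z = 0 /\ w = 0).
  case=> z0 w0; case: nz.
  by have [] := lin y x; rewrite ?z0 ?w0 // addrC E z0 w0 !rmorph0 mul0r addr0 mulr0.
(* For a singular matrix the map would be constant, which would put [et] in F. *)
have D : x * w - y * z != 0.
  apply/eqP => D; have [z0|z0] := eqVneq z 0.
    have [x0 |] := eqVneq x 0; last first.
      move=> x0; move/eqP: D; rewrite z0 mulr0 subr0 mulf_eq0 (negPf x0) /= => /eqP w0.
      exact: zw0.
    have [|y0 /eqP] := lin' y (- w).
      by rewrite rmorphN; move: E; rewrite x0 z0 !rmorph0 !mul0r !add0r => ->; ring.
    by rewrite oppr_eq0 => /eqP w0; apply: zw0.
  have [|_ /eqP] := lin' x (- z); last by rewrite oppr_eq0 (negPf z0).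
  have zt : iota z * th + iota w != 0.
    by rewrite addrC; apply/eqP => /lin[_ /eqP]; rewrite (negPf z0).
  apply: (mulIf zt); rewrite mul0r rmorphN mulrDl mulNr mulNr -mulrA -E.
  move/eqP: D; rewrite subr_eq0 => /eqP /(congr1 iota); rewrite !rmorphM => D.
  rewrite mulrDr mulrDr D; ring.
have Gth : cub (iota g0) (iota g1) (iota g2) (iota g3)
    (iota x * th + iota y) (iota z * th + iota w) = 0.
  rewrite E -[RHS](mulr0 ((iota z * th + iota w) ^+ 3)) -Eet /cub; ring.
set G0 := cub0 g0 g1 g2 g3 x y z w; set G1 := cub1 g0 g1 g2 g3 x y z w.
set G2 := cub2 g0 g1 g2 g3 x y z w; set G3 := cub3 g0 g1 g2 g3 x y z w.
have EG : iota G0 * th ^+ 3 + iota G1 * th ^+ 2 + iota G2 * th + iota G3 = 0.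
  rewrite -[RHS]Gth /G0 /G1 /G2 /G3 /cub0 /cub1 /cub2 /cub3 /cub.
  by rewrite !(rmorphD, rmorphXn, rmorphM, rmorph_nat) /=; ring.
have G00 : G0 != 0.
  apply/eqP => /an'[x0 z0]; by rewrite x0 z0 mul0r mulr0 subrr eqxx in D.
(* Eliminating th^3 between the two cubics leaves a polynomial of degree at most 2 that vanishes at
   [th]. *)
have [|H3 H2 H1] := Fth (f3 * G0 - f0 * G3) (f2 * G0 - f0 * G2) (f1 * G0 - f0 * G1).
  rewrite !rmorphB !rmorphM /=.
  transitivity (iota G0 * cub (iota f0) (iota f1) (iota f2) (iota f3) th 1
    - iota f0 * (iota G0 * th ^+ 3 + iota G1 * th ^+ 2 + iota G2 * th + iota G3)).
    by rewrite /cub; ring.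
  by rewrite EG Eth !mulr0 subrr.
have sol f G : f * G0 - f0 * G = 0 -> f = f0 / G0 * G.
  by move/eqP; rewrite subr_eq0 => /eqP h; apply: (mulIf G00); rewrite h; field.
exists x, y, z, w, (f0 / G0); split; rewrite -/G0 -/G1 -/G2 -/G3 //.
- by rewrite mulf_neq0 ?invr_eq0.
- by rewrite divfK.
- exact: sol.
- by split; exact: sol.
Qed.

End Cubics.

(** * Base points of a pencil *)

Section Rank.

Variable F : fieldType.

Lemma rank_congr n (A X : 'M[F]_n) : A \in unitmx -> \rank (A *m X *m A^T) = \rank X.
Proof.
move=> Au; rewrite mxrankMfree ?row_free_unit ?unitmx_tr //.
by rewrite -mxrank_tr trmx_mul mxrankMfree ?row_free_unit ?unitmx_tr // mxrank_tr.
Qed.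

Lemma rank_le1_minor m n (X : 'M[F]_(m, n)) i j k l : (\rank X <= 1)%N ->
  X i j * X k l = X i l * X k j.
Proof.
rewrite -{2 3 4 5}(mulmx_base X) !mxE.
move: (col_base X) (row_base X); case: (\rank X) => [|[|//]] U V _.
  by rewrite !big_ord0 !mul0r.
by rewrite !big_ord_recl !big_ord0 !addr0; ring.
Qed.

(** A nonzero diagonal entry exhibits the matrix as an outer product built from its own row; a zero
    one forces the rest of its row to vanish, and the next diagonal entry takes over. *)
Lemma rank_sym3_le1 (a b c d e f : F) :
  [/\ a * d = b ^+ 2, a * f = c ^+ 2 & d * f = e ^+ 2] ->
  [/\ a * e = b * c, b * f = c * e & c * d = b * e] ->
  (\rank (sym3 a b c d e f) <= 1)%N.
Proof.
move=> [H1 H2 H3] [H4 H5 H6].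
have outer (u v : 'rV[F]_3) : (\rank (u^T *m v) <= 1)%N.
  by rewrite (leq_trans (mxrankM_maxl _ _)) // rank_leq_col.
have [a0|a0] := eqVneq a 0; last first.
  suff -> : sym3 a b c d e f = (rv3 1 (b / a) (c / a))^T *m rv3 a b c by apply: outer.
  by apply/matrixP; elim/ord3P; elim/ord3P; rewrite !mxE big_ord1 !mxE /= ?mul1r;
    apply: (mulfI a0); rewrite ?H1 ?H2 ?H4; by field.
have b0 : b = 0 by apply/eqP; rewrite -sqrf_eq0 -H1 a0 mul0r.
have c0 : c = 0 by apply/eqP; rewrite -sqrf_eq0 -H2 a0 mul0r.
have [d0|d0] := eqVneq d 0; last first.
  suff -> : sym3 a b c d e f = (rv3 0 1 (e / d))^T *m rv3 0 d e by apply: outer.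
  rewrite a0 b0 c0.
  by apply/matrixP; elim/ord3P; elim/ord3P; rewrite !mxE big_ord1 !mxE /= ?mul1r ?mul0r ?mulr0 //;
    apply: (mulfI d0); rewrite ?H3; by field.
have e0 : e = 0 by apply/eqP; rewrite -sqrf_eq0 -H3 d0 mul0r.
suff -> : sym3 a b c d e f = (rv3 0 0 1)^T *m rv3 0 0 f by apply: outer.
rewrite a0 b0 c0 d0 e0.
by apply/matrixP; elim/ord3P; elim/ord3P; rewrite !mxE big_ord1 !mxE /= ?mul1r ?mul0r ?mulr0.
Qed.

Lemma rank_sym3_le1P (a b c d e f : F) : (\rank (sym3 a b c d e f) <= 1)%N ->
  [/\ a * d = b ^+ 2, a * f = c ^+ 2 & d * f = e ^+ 2] /\
  [/\ a * e = b * c, b * f = c * e & c * d = b * e].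
Proof.
move=> r1; have E i j k l := rank_le1_minor i j k l r1.
do 2!split; [have := E i0 i0 i1 i1|have := E i0 i0 i2 i2|have := E i1 i1 i2 i2
  |have := E i0 i0 i1 i2|have := E i0 i1 i2 i2|have := E i0 i2 i1 i1]; rewrite !mxE /= => ->; ring.
Qed.

Lemma rank_le2 n (X : 'M[F]_n.+1) : (\rank X <= n)%N = (\det X == 0).
Proof.
rewrite -[\det X == 0]negbK -unitfE -unitmxE -row_free_unit -ltnS ltn_neqAle.
by rewrite rank_leq_row andbT.
Qed.

Lemma det_sym3 (a b c d e f : F) :
  \det (sym3 a b c d e f) = a * d * f + 2%:R * b * c * e - a * e ^+ 2 - d * c ^+ 2 - f * b ^+ 2.
Proof. by rewrite det_mk3; ring. Qed.

End Rank.

(** * Pencils and their binary cubics *)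

Section Pencils.

Variable F : finFieldType.
Implicit Types (M N X A B : 'M[F]_3) (l m k : 'rV[F]_3).

Definition pencil M N (p : F * F) : 'M[F]_3 := p.1 *: M + p.2 *: N.

(** The zero matrix also has rank at most one, so this includes the independence of [M] and [N]. *)
Definition no_rank1 M N : bool :=
  [forall p, (\rank (pencil M N p) <= 1)%N ==> (p == 0)].

Definition indep M N : bool := [forall p, (pencil M N p == 0) ==> (p == 0)].

Definition base M N l : bool := (bform M l l == 0) && (bform N l l == 0).

(** Equivalently, [l] is a base point for which [l *m M] and [l *m N] are independent; in particular
    it is nonzero. *)
Definition good M N l : bool :=
  base M N l && [forall p, (l *m pencil M N p == 0) ==> (p == 0)].

Lemma pair_eq0 (s t : F) : ((s, t) == 0) = (s == 0) && (t == 0).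
Proof. by []. Qed.

Lemma peq_map M N M' N' : peq M N M' N' ->
  exists2 A, A \in unitmx & exists f : F * F -> F * F,
    [/\ injective f, forall p, (f p == 0) = (p == 0) & forall p, A *m pencil M N p *m A^T = pencil M' N' (f p)].
Proof.
case=> A Au [[[[a b] c] d] [D E1 E2]]; exists A => //.
pose f (p : F * F) := (p.1 * a + p.2 * c, p.1 * b + p.2 * d).
have f0 : f 0 = 0 by rewrite /f /= !mul0r !addr0.
have fi : injective f.
  move=> [s t] [s' t'] /= [H1 H2].
  have S : (s - s') * (a * d - b * c) = 0.
    transitivity ((s * a + t * c) * d - (s * b + t * d) * c
      - ((s' * a + t' * c) * d - (s' * b + t' * d) * c)); first by ring.
    by rewrite H1 H2 subrr.
  have T : (t - t') * (a * d - b * c) = 0.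
    transitivity ((s * b + t * d) * a - (s * a + t * c) * b
      - ((s' * b + t' * d) * a - (s' * a + t' * c) * b)); first by ring.
    by rewrite H1 H2 subrr.
  move/eqP: S; rewrite mulf_eq0 (negPf D) orbF subr_eq0 => /eqP ->.
  by move/eqP: T; rewrite mulf_eq0 (negPf D) orbF subr_eq0 => /eqP ->.
exists f; split=> //; first by move=> p; rewrite -{1}f0 (inj_eq fi).
by move=> [s t]; rewrite congr_lin E1 E2 /pencil /= !scalerDr !scalerA addrACA -!scalerDl.
Qed.

Lemma bform_congr A X l m : bform (A *m X *m A^T) l m = bform X (l *m A) (m *m A).
Proof. by rewrite /bform trmx_mul !mulmxA. Qed.

Lemma congr_eq0 A X : A \in unitmx -> (A *m X *m A^T == 0) = (X == 0).
Proof. by move=> Au; rewrite -!mxrank_eq0 rank_congr. Qed.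

Lemma no_rank1_peq M N M' N' : peq M N M' N' -> no_rank1 M N -> no_rank1 M' N'.
Proof.
move=> /peq_sym/peq_map[A Au [f [fi f0 E]]] /forallP nr; apply/forallP => p.
apply/implyP; rewrite -(rank_congr _ Au) E => /(implyP (nr _)).
by rewrite f0.
Qed.

Lemma indep_peq M N M' N' : peq M N M' N' -> indep M N -> indep M' N'.
Proof.
move=> /peq_sym/peq_map[A Au [f [fi f0 E]]] /forallP nr; apply/forallP => p.
apply/implyP; rewrite -(congr_eq0 _ Au) E => /(implyP (nr _)).
by rewrite f0.
Qed.

Lemma bform_lin M N p l m : bform (pencil M N p) l m = p.1 * bform M l m + p.2 * bform N l m.
Proof. by rewrite /bform mulmxDr mulmxDl -!scalemxAr -!scalemxAl !mxE. Qed.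

Lemma pencil10 M N : pencil M N (1, 0) = M.
Proof. by rewrite /pencil scale1r scale0r addr0. Qed.

Lemma pencil01 M N : pencil M N (0, 1) = N.
Proof. by rewrite /pencil scale1r scale0r add0r. Qed.

Lemma baseP M N l : reflect (forall p, bform (pencil M N p) l l = 0) (base M N l).
Proof.
apply: (iffP andP) => [[/eqP E1 /eqP E2] p|E]; first by rewrite bform_lin E1 E2 !mulr0 addr0.
by split; apply/eqP; [have := E (1, 0)|have := E (0, 1)]; rewrite ?pencil10 ?pencil01.
Qed.

Lemma base_peq M N M' N' : peq M N M' N' ->
  exists2 A, A \in unitmx & forall l,
    (base M N l -> base M' N' (l *m A)) /\ (good M N l -> good M' N' (l *m A)).
Proof.
move=> /peq_sym/peq_map[A Au [f [fi f0 E]]]; exists A => // l.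
have B : base M N l -> base M' N' (l *m A).
  by move=> /baseP Bl; apply/baseP => p; rewrite -bform_congr E.
split=> // /andP[/B bA /forallP G]; apply/andP; split=> //; apply/forallP => p.
apply/implyP => /eqP Ep; have /implyP := G (f p).
rewrite f0 -E; apply.
by rewrite 2!mulmxA Ep mul0mx.
Qed.

Lemma e0_completion k : k != 0 -> exists2 A, A \in unitmx & rv3 1 0 0 *m A = k.
Proof.
rewrite [k]rv3E; move: (k 0 i0) (k 0 i1) (k 0 i2) => x y z; rewrite rv3_eq0 => nz.
have [x0|x0] := eqVneq x 0; last first.
  exists (mk3 x y z 0 1 0 0 0 1); first by apply: unit_mk3; rewrite (_ : _ + _ = x) //; ring.
  by apply/rowP; elim/ord3P; rewrite !mxE !sum3E !mxE /=; ring.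
have [y0|y0] := eqVneq y 0; last first.
  exists (mk3 x y z 1 0 0 0 0 1); first by apply: unit_mk3; rewrite (_ : _ + _ = - y) ?oppr_eq0 //; ring.
  by apply/rowP; elim/ord3P; rewrite !mxE !sum3E !mxE /=; ring.
have z0 : z != 0 by move: nz; rewrite x0 y0 eqxx.
exists (mk3 x y z 1 0 0 0 1 0); first by apply: unit_mk3; rewrite (_ : _ + _ = z) //; ring.
by apply/rowP; elim/ord3P; rewrite !mxE !sum3E !mxE /=; ring.
Qed.

Lemma sym_congr A X : X^T = X -> (A *m X *m A^T)^T = A *m X *m A^T.
Proof. by move=> sX; rewrite !trmx_mul trmxK sX mulmxA. Qed.

Lemma peq_e0 M N k : M^T = M -> N^T = N -> k != 0 ->
  exists M1 N1, [/\ M1^T = M1, N1^T = N1, peq M N M1 N1,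
    (base M N k -> base M1 N1 (rv3 1 0 0)) /\
    (good M N k -> good M1 N1 (rv3 1 0 0))
    & forall p, k *m pencil M N p = 0 -> rv3 1 0 0 *m pencil M1 N1 p = 0].
Proof.
move=> sM sN /e0_completion[A Au Ek].
have E p : pencil (A *m M *m A^T) (A *m N *m A^T) p = A *m pencil M N p *m A^T.
  by rewrite congr_lin.
exists (A *m M *m A^T), (A *m N *m A^T).
have B : base M N k -> base (A *m M *m A^T) (A *m N *m A^T) (rv3 1 0 0).
  by rewrite /base !bform_congr Ek.
split; [exact: sym_congr|exact: sym_congr|exact: peq_congr|split=> //|].
- case/andP=> /B bA /forallP G; apply/andP; split=> //; apply/forallP => p.
  apply/implyP; rewrite E 2!mulmxA Ek => /eqP K; apply: (implyP (G p)).
  have At : A^T \in unitmx by rewrite unitmx_tr.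
  by rewrite -[_ *m _](mulmxK At) K mul0mx.
- by move=> p K; rewrite E !mulmxA Ek K mul0mx.
Qed.

(** In this normal form e0 is a base point and the member with coordinates (s, t) has determinant -
    [cub f0 f1 f2 f3 s t], which explains where the coefficients are placed. *)
Definition Gpeq M N (f0 f1 f2 f3 : F) :=
  peq M N (sym3 0 1 0 f2 0 f0) (sym3 0 0 1 f3 0 f1).

(** Replacing e1 by e1 - u e0 and e2 by e2 - t e0 clears the entries t and u at the cost of changing
    the diagonal entries p and s. *)
Lemma G_norm (p q r s t u : F) :
  Gpeq (sym3 0 1 0 p t r) (sym3 0 0 1 q u s) r (s - 2%:R * t) (p - 2%:R * u) q.
Proof.
apply: (@peq_sym3 _ 1 0 0 (-u) 1 0 (-t) 0 1 1 0 0 1).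
- by rewrite (_ : _ + _ = 1) ?oner_eq0 //; ring.
- by rewrite (_ : _ - _ = 1) ?oner_eq0 //; ring.
- by rewrite /= /sbf; do 2!split; ring.
- by rewrite /= /sbf; do 2!split; ring.
Qed.

(** A substitution in the parameters of the pencil disturbs the first rows of its two matrices. A
    congruence on e1 and e2 restores them; p to u are the entries that result, and [G_norm] brings
    them back to a cubic. *)
Lemma G_subst g0 g1 g2 g3 x y z w c f0 f1 f2 f3 :
  x * w - y * z != 0 -> c != 0 ->
  f0 = c * cub0 g0 g1 g2 g3 x y z w -> f1 = c * cub1 g0 g1 g2 g3 x y z w ->
  f2 = c * cub2 g0 g1 g2 g3 x y z w -> f3 = c * cub3 g0 g1 g2 g3 x y z w ->
  Gpeq (sym3 0 1 0 f2 0 f0) (sym3 0 0 1 f3 0 f1) g0 g1 g2 g3.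
Proof.
move=> D c0 E0 E1 E2 E3; apply: peq_sym.
set p := c * (w ^+ 2 * (g2 * x + g3 * z) + y ^+ 2 * (g0 * x + g1 * z)).
set q := c * (w ^+ 2 * (g2 * y + g3 * w) + y ^+ 2 * (g0 * y + g1 * w)).
set r := c * (z ^+ 2 * (g2 * x + g3 * z) + x ^+ 2 * (g0 * x + g1 * z)).
set s := c * (z ^+ 2 * (g2 * y + g3 * w) + x ^+ 2 * (g0 * y + g1 * w)).
set t := c * (- w * z * (g2 * x + g3 * z) - x * y * (g0 * x + g1 * z)).
set u := c * (- w * z * (g2 * y + g3 * w) - x * y * (g0 * y + g1 * w)).
have N := G_norm p q r s t u.
rewrite [f0](_ : _ = r); last by rewrite E0 /r /cub0 /cub; ring.
rewrite [f1](_ : _ = s - 2%:R * t); last by rewrite E1 /s /t /cub1; ring.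
rewrite [f2](_ : _ = p - 2%:R * u); last by rewrite E2 /p /u /cub2; ring.
rewrite [f3](_ : _ = q); last by rewrite E3 /q /cub3 /cub; ring.
apply: peq_trans N; have D1 := D; set D0 := x * w - y * z in D.
apply: (@peq_sym3 _ ((c * D0)^-1) 0 0 0 w (-y) 0 (-z) x
  (w / (c * D0)) (- z / (c * D0)) (- y / (c * D0)) (x / (c * D0))).
- rewrite (_ : _ + _ = c^-1); last by rewrite /D0; field; rewrite ?c0 ?D1.
  by rewrite invr_eq0.
- rewrite (_ : _ - _ = (c ^+ 2 * D0)^-1); last by rewrite /D0; field; rewrite c0 D1.
  by rewrite invr_eq0 mulf_neq0 // expf_neq0.
- by rewrite /= /sbf /p /q /r /s /t /u /D0; do 2!split; field; rewrite c0 D1.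
- by rewrite /= /sbf /p /q /r /s /t /u /D0; do 2!split; field; rewrite c0 D1.
Qed.

End Pencils.

(** * Pencils with a base point killed by no member *)

Section Classification.

Variable F : finFieldType.
Implicit Types (M N X A B : 'M[F]_3) (l m k : 'rV[F]_3).

Lemma sym3_ex X : X^T = X -> exists a b c d e f, X = sym3 a b c d e f.
Proof. by move/sym3P; do 6!eexists; eauto. Qed.

(** With the base point at e0 the first rows are (0, b, c) and (0, b', c'). They are independent
    because no member kills e0, so a change of basis of the pencil makes them (0, 1, 0) and (0, 0,
    1). *)
Lemma good_G M N k : M^T = M -> N^T = N -> good M N k ->
  exists f0 f1 f2 f3, Gpeq M N f0 f1 f2 f3.
Proof.
move=> sM sN gk.
have k0 : k != 0.
  apply: contraTneq gk => ->; apply/negP => /andP[_ /forallP /(_ (1, 0))].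
  by rewrite mul0mx eqxx pair_eq0 oner_eq0.
have [M1 [N1 [/sym3_ex[a [b [c [d [e [f ->]]]]]] /sym3_ex[a' [b' [c' [d' [e' [f' ->]]]]]]]]] :=
  peq_e0 sM sN k0.
move=> E [_ /(_ gk)] + _ => /andP[/andP[]].
rewrite !bform_sym3 /sbf => /eqP Ea /eqP Ea' /forallP G.
have {}Ea : a = 0 by rewrite -Ea; ring.
have {}Ea' : a' = 0 by rewrite -Ea'; ring.
move: E G; rewrite Ea Ea' => E G {a a' Ea Ea'}.
set D := b * c' - c * b'.
have D0 : D != 0.
  apply/negP => /eqP D0.
  have key s t : s * b + t * b' = 0 -> s * c + t * c' = 0 -> s = 0 /\ t = 0.
    move=> E1 E2; have := implyP (G (s, t)); rewrite pair_eq0 => H.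
    case: (andP (H _)) => [|/eqP -> /eqP -> //].
    by rewrite /pencil sym3_lin mul_rv3_sym3 rv3_eq0 /= E1 E2 !(mul0r, mul1r, mulr0, addr0) eqxx.
  have [||c'0 /eqP] := key c' (- c); [by rewrite -D0 /D; ring|by ring|rewrite oppr_eq0 => /eqP c0].
  have [||b'0 /eqP] := key b' (- b); [by ring|by rewrite -[RHS](oppr0 F) -D0 /D; ring|rewrite oppr_eq0 => /eqP b0].
  by have [||/eqP] := key 1 1; rewrite ?oner_eq0 // ?b0 ?c0 ?b'0 ?c'0 !mulr0 addr0.
have [p [q [r [s [t [u E']]]]]] : exists p q r s t u,
    peq (sym3 0 b c d e f) (sym3 0 b' c' d' e' f') (sym3 0 1 0 p t r) (sym3 0 0 1 q u s).
  pose x (z z' : F) := (c' * z - c * z') / D; pose y (z z' : F) := (b * z' - b' * z) / D.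
  exists (x d d'), (y d d'), (x f f'), (y f f'), (x e e'), (y e e').
  have D1 : b * c' - c * b' != 0 by [].
  apply: (@peq_sym3 _ 1 0 0 0 1 0 0 0 1 b c b' c') => //.
  - by rewrite (_ : _ + _ = 1) ?oner_eq0 //; ring.
  - by rewrite /= /sbf /x /y /D; do 2!split; field.
  - by rewrite /= /sbf /x /y /D; do 2!split; field.
by exists r, (s - 2%:R * t), (p - 2%:R * u), q; exact: peq_trans E (peq_trans E' (G_norm _ _ _ _ _ _)).
Qed.

Definition irr2 (t : F) := forall x : F, x ^+ 2 + t * x + 1 != 0.

Lemma Gpeq_step M N f0 f1 f2 f3 g0 g1 g2 g3 x y z w c :
  Gpeq M N f0 f1 f2 f3 ->
  x * w - y * z != 0 -> c != 0 ->
  f0 = c * cub0 g0 g1 g2 g3 x y z w -> f1 = c * cub1 g0 g1 g2 g3 x y z w ->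
  f2 = c * cub2 g0 g1 g2 g3 x y z w -> f3 = c * cub3 g0 g1 g2 g3 x y z w ->
  Gpeq M N g0 g1 g2 g3.
Proof. by move=> E D c0 E0 E1 E2 E3; exact: peq_trans E (G_subst D c0 E0 E1 E2 E3). Qed.

Ltac cubring := rewrite /cub0 /cub1 /cub2 /cub3 /cub.

(** These are the factorisation patterns of a binary cubic: zero, a cube, a square times another
    factor, three distinct factors, a linear factor times an irreducible quadratic, irreducible.
    [irr2_equiv] allows a single quadratic, that of [t], to stand for all. *)
Lemma cubic_cases (t : F) M N f0 f1 f2 f3 : irr2 t -> Gpeq M N f0 f1 f2 f3 ->
  [\/ Gpeq M N 0 0 0 0, Gpeq M N 1 0 0 0, Gpeq M N 0 1 0 0 | Gpeq M N 0 1 1 0] \/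
  (Gpeq M N 1 t 1 0 \/
   exists g0 g1 g2 g3, Gpeq M N g0 g1 g2 g3 /\ cub_anis g0 g1 g2 g3).
Proof.
move=> irt E.
have [/existsP[[a b] /andP[nz /eqP /= rt]]|/existsPn nr] :=
  boolP [exists p : F * F, (p != 0) && (cub f0 f1 f2 f3 p.1 p.2 == 0)]; last first.
  right; right; exists f0, f1, f2, f3; split=> // a b rt; have := nr (a, b); rewrite rt eqxx andbT negbK pair_eq0.
  by case/andP => /eqP -> /eqP ->.
(* With a root moved to (0, 1) the last coefficient vanishes, and the cubic is a (f0 a^2 + f1 a b +
   f2 b^2). *)
have {f0 f1 f2 f3 E rt} [f0 [f1 [f2 E]]] : exists f0 f1 f2, Gpeq M N f0 f1 f2 0.
  have [a0|a0] := eqVneq a 0.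
    have b0 : b != 0 by move: nz; rewrite pair_eq0 a0 eqxx.
    exists f0, f1, f2; apply: peq_trans E _.
    suff -> : f3 = 0 by exact: peq_refl.
    by move/eqP: rt; rewrite a0 /cub !expr0n !mulr0 !mul0r !add0r mulf_eq0 expf_eq0 (negPf b0) /= orbF => /eqP.
  exists (cub0 f0 f1 f2 f3 0 a 1 b), (cub1 f0 f1 f2 f3 0 a 1 b), (cub2 f0 f1 f2 f3 0 a 1 b).
  have E1 := @G_subst F f0 f1 f2 f3 0 a 1 b 1 _ _ _ 0.
  apply: peq_trans E (peq_sym (E1 _ _ _ _ _ _ _ _ _)); rewrite ?mul1r ?oner_eq0 //.
  by rewrite mul0r mulr1 sub0r oppr_eq0.
have [f20|f20] := eqVneq f2 0.
  rewrite f20 in E; left.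
  have [f10|f10] := eqVneq f1 0.
    rewrite f10 in E; have [f00|f00] := eqVneq f0 0; first by rewrite f00 in E; constructor 1.
    constructor 2; apply: (Gpeq_step (x := 1) (y := 0) (z := 0) (w := 1) E _ f00); try by cubring; ring.
    by rewrite mulr0 subr0 mulr1 oner_eq0.
  constructor 3; apply: (Gpeq_step (x := 1) (y := 0) (z := f0) (w := f1) E _ (oner_neq0 _)); try by cubring; ring.
  by rewrite mul0r subr0 mul1r.
have [/existsP[be /eqP Ebe]|/existsPn nr] := boolP [exists be, f2 * be ^+ 2 + f1 * be + f0 == 0].
  left; have Ef0 : f0 = - f1 * be - f2 * be ^+ 2.
    by apply/eqP; rewrite -subr_eq0 -[X in _ == X]Ebe; apply/eqP; ring.
  (* The derivative of the quadratic cofactor at its root [be]; it vanishes exactly for a double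
     root. *)
  have [e0|e0] := eqVneq (f1 + 2%:R * f2 * be) 0.
    have Ef1 : f1 = - (2%:R * f2 * be) by apply/eqP; rewrite -addr_eq0 e0.
    constructor 3; apply: (Gpeq_step (x := - be) (y := 1) (z := 1) (w := 0) E _ f20);
      try by cubring; rewrite ?Ef0 ?Ef1; ring.
    by rewrite mulr0 mulr1 sub0r oppr_eq0 oner_eq0.
  set e := f1 + _ in e0.
  constructor 4; apply: (Gpeq_step (x := e) (y := 0) (z := - be * f2) (w := f2) (c := (e * f2)^-1) E).
  - by rewrite mul0r subr0 mulf_neq0.
  - by rewrite invr_eq0 mulf_neq0.
  - by cubring; rewrite Ef0 (_ : f1 = e - 2%:R * f2 * be) /e; [field; rewrite f20|ring].
  - by cubring; rewrite (_ : f1 = e - 2%:R * f2 * be) /e; [field; rewrite f20|ring].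
  - by cubring; field; rewrite f20.
  - by cubring; ring.
right; left.
have [al [be [al0 H1 H2]]] : exists al be, [/\ al != 0, 2%:R * be + f1 / f2 = al * t
    & be ^+ 2 + f1 / f2 * be + f0 / f2 = al ^+ 2 * 1].
  apply: irr2_equiv => // x; apply: contraNneq (nr x) => Ex.
  by rewrite -(mulr0 f2) -Ex; apply/eqP; field.
have Ef1 : f1 = (al * t - 2%:R * be) * f2 by rewrite -H1; field.
have Ef0 : f0 = (al ^+ 2 - be ^+ 2) * f2 - f1 * be by rewrite -[al ^+ 2]mulr1 -H2; field.
apply: (Gpeq_step (x := 1) (y := 0) (z := - be / al) (w := al^-1) (c := f2 * al ^+ 2) E).
- by rewrite mul1r mul0r subr0 invr_eq0.
- by rewrite mulf_neq0 // expf_neq0.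
- by cubring; rewrite Ef0 Ef1; field.
- by cubring; rewrite Ef1; field.
- by cubring; field.
- by cubring; ring.
Qed.

End Classification.

(** * Pencils containing a matrix of rank one *)

Section Cases.

Variable F : finFieldType.
Implicit Types (M N X A B : 'M[F]_3) (l m k : 'rV[F]_3).

Lemma peq_swap12 (a b c d e f a' b' c' d' e' f' : F) :
  peq (sym3 a b c d e f) (sym3 a' b' c' d' e' f')
      (sym3 a c b f e d) (sym3 a' c' b' f' e' d').
Proof.
apply: (@peq_sym3 _ 1 0 0 0 0 1 0 1 0 1 0 0 1); rewrite /= /sbf; try by do 2!split; ring.
- by rewrite (_ : _ + _ = -1) ?oppr_eq0 ?oner_eq0 //; ring.
- by rewrite (_ : _ - _ = 1) ?oner_eq0 //; ring.
Qed.

Lemma peq_swap01 (a b c d e f a' b' c' d' e' f' : F) :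
  peq (sym3 a b c d e f) (sym3 a' b' c' d' e' f')
      (sym3 d b e a c f) (sym3 d' b' e' a' c' f').
Proof.
apply: (@peq_sym3 _ 0 1 0 1 0 0 0 0 1 1 0 0 1); rewrite /= /sbf; try by do 2!split; ring.
- by rewrite (_ : _ + _ = -1) ?oppr_eq0 ?oner_eq0 //; ring.
- by rewrite (_ : _ - _ = 1) ?oner_eq0 //; ring.
Qed.

Lemma peq_swap M N : peq M N N M.
Proof.
have := @peq_basis _ 0 1 1 0 M N; rewrite !scale0r !scale1r add0r addr0; apply.
by rewrite mul0r mulr1 sub0r oppr_eq0 oner_eq0.
Qed.

Lemma peq_member M N p : M^T = M -> N^T = N -> p != 0 ->
  exists2 N', N'^T = N' & peq M N (pencil M N p) N'.
Proof.
case: p => s t sM sN; rewrite pair_eq0 => nz.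
have [s0|s0] := eqVneq s 0.
  have t0 : t != 0 by move: nz; rewrite s0 eqxx.
  exists M => //; rewrite -[X in peq _ _ _ X](pencil10 M N); apply: peq_basis.
  by rewrite mulr0 mulr1 sub0r oppr_eq0.
exists N => //; rewrite -[X in peq _ _ _ X](pencil01 M N); apply: peq_basis.
by rewrite mulr0 mulr1 subr0.
Qed.

Lemma pencil_tr M N p : M^T = M -> N^T = N -> (pencil M N p)^T = pencil M N p.
Proof. by move=> sM sN; rewrite /pencil linearD !linearZ /= sM sN. Qed.

Local Notation E00 := (sym3 1 0 0 0 0 0).

(** A symmetric matrix of rank one has a nonzero diagonal entry. Moved to the first place, it makes
    the matrix congruent to a multiple of [E00], and this member clears the first entry of the other
    matrix. *)
Lemma rank1_normal M N : M^T = M -> N^T = N -> indep M N -> ~~ no_rank1 M N ->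
  exists x y d e f, peq M N E00 (sym3 0 x y d e f).
Proof.
have key (a b c d e f a' b' c' d' e' f' : F) : a * d = b ^+ 2 -> a * f = c ^+ 2 -> a * e = b * c ->
    a != 0 -> exists x y d1 e1 f1,
    peq (sym3 a b c d e f) (sym3 a' b' c' d' e' f') E00 (sym3 0 x y d1 e1 f1).
  move=> H1 H2 H4 a0.
  have {H1}-> : d = b ^+ 2 / a by rewrite -H1; field.
  have {H2}-> : f = c ^+ 2 / a by rewrite -H2; field.
  have {H4}-> : e = b * c / a by rewrite -H4; field.
  pose g := sbf a' b' c' d' e' f'.
  exists (g 1 0 0 (- b / a) 1 0), (g 1 0 0 (- c / a) 0 1), (g (- b / a) 1 0 (- b / a) 1 0).
  exists (g (- b / a) 1 0 (- c / a) 0 1), (g (- c / a) 0 1 (- c / a) 0 1).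
  apply: (@peq_sym3 _ 1 0 0 (- b / a) 1 0 (- c / a) 0 1 a 0 a' 1).
  - by rewrite (_ : _ + _ = 1) ?oner_eq0 //; ring.
  - by rewrite mul0r mulr1 subr0.
  - by rewrite /= /sbf; do 2!split; field.
  - by rewrite /g /= /sbf; do 2!split; ring.
move=> sM sN ind /forallPn[p]; rewrite negb_imply => /andP[r1 p0].
have [N' /sym3_ex[a' [b' [c' [d' [e' [f' EN]]]]]] E] := peq_member sM sN p0.
have : pencil M N p != 0 by apply: contraNneq p0 => P0; apply: (implyP (forallP ind p)); apply/eqP.
have [a [b [c [d [e [f EM]]]]]] := sym3_ex (pencil_tr p sM sN).
move: E r1; rewrite EM EN => E /rank_sym3_le1P[[H1 H2 H3] [H4 H5 H6]] nz.
have [a0|a0] := eqVneq a 0; last first.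
  have [x [y [d1 [e1 [f1 E1]]]]] := key a b c d e f a' b' c' d' e' f' H1 H2 H4 a0.
  by exists x, y, d1, e1, f1; exact: peq_trans E E1.
have b0 : b = 0 by apply/eqP; rewrite -sqrf_eq0 -H1 a0 mul0r.
have c0 : c = 0 by apply/eqP; rewrite -sqrf_eq0 -H2 a0 mul0r.
have [d0|d0] := eqVneq d 0; last first.
  have [||||x [y [d1 [e1 [f1 E1]]]]] := key d b e a c f d' b' e' a' c' f' => //.
  - by rewrite mulrC.
  - by rewrite ?a0 b0 c0; ring.
  by exists x, y, d1, e1, f1; exact: peq_trans E (peq_trans (peq_swap01 _ _ _ _ _ _ _ _ _ _ _ _) E1).
have e0 : e = 0 by apply/eqP; rewrite -sqrf_eq0 -H3 d0 mul0r.
have f0 : f != 0 by apply: contraNneq nz => f0; rewrite a0 b0 c0 d0 e0 f0 sym3_0.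
have [||||x [y [d1 [e1 [f1 E1]]]]] := key f e c d b a f' e' c' d' b' a' => //.
- by rewrite mulrC.
- by rewrite mulrC.
- by rewrite ?b0 ?c0 e0; ring.
exists x, y, d1, e1, f1; apply: peq_trans E (peq_trans _ E1).
exact: peq_trans (peq_swap01 _ _ _ _ _ _ _ _ _ _ _ _) (peq_trans (peq_swap12 _ _ _ _ _ _ _ _ _ _ _ _) (peq_swap01 _ _ _ _ _ _ _ _ _ _ _ _)).
Qed.

(** The block (d, e, f) is the restriction of the second matrix to the kernel of [E00]. If it is
    regular, e0 can be made orthogonal to e1 and e2; otherwise only the part of (x, y) in its row
    space can be removed. *)
Lemma rank1_cases M N : M^T = M -> N^T = N -> indep M N -> ~~ no_rank1 M N ->
  [\/ peq M N E00 (sym3 0 0 0 1 0 0), peq M N E00 (sym3 0 1 0 0 0 0),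
      peq M N E00 (sym3 0 0 1 1 0 0)
    | exists d e f, d * f - e ^+ 2 != 0 /\ peq M N E00 (sym3 0 0 0 d e f)].
Proof.
have key (x y d e f : F) : d * f - e ^+ 2 = 0 -> d != 0 ->
    peq E00 (sym3 0 x y d e f) E00 (sym3 0 0 0 1 0 0) \/
    peq E00 (sym3 0 x y d e f) E00 (sym3 0 0 1 1 0 0).
  move=> D0 d0; have {D0} -> : f = e ^+ 2 / d.
    by move/eqP: D0; rewrite subr_eq0 => /eqP <-; field.
  have [y0|y0] := eqVneq (y - x * e / d) 0.
    have {y0} -> : y = x * e / d by apply/eqP; rewrite -subr_eq0 y0.
    left; apply: (@peq_sym3 _ 1 (- x / d) 0 0 1 0 0 (- e / d) 1 1 0 (- x ^+ 2 / d) d).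
    - by rewrite (_ : _ + _ = 1) ?oner_eq0 //; ring.
    - by rewrite mul0r mul1r subr0.
    - by rewrite /= /sbf; do 2!split; ring.
    - by rewrite /= /sbf; do 2!split; field.
  right; set y' := y - _ in y0; have -> : y = y' + x * e / d by rewrite /y'; ring.
  apply: (@peq_sym3 _ 1 (- x / d) 0 0 1 0 0 (- e / y') (d / y') 1 0 (- x ^+ 2 / d) d).
  - rewrite (_ : _ + _ = d / y') ?mulf_neq0 ?invr_eq0 //; ring.
  - by rewrite mul0r mul1r subr0.
  - by rewrite /= /sbf; do 2!split; ring.
  - move: (y') y0 => z z0.
    by rewrite /= /sbf; do 2!split; field; rewrite ?z0 ?d0.
move=> sM sN ind nr; have [x [y [d [e [f E]]]]] := rank1_normal sM sN ind nr.
have {sM sN ind nr} ind := indep_peq E ind.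
have [D0|D0] := eqVneq (d * f - e ^+ 2) 0; last first.
  constructor 4; exists d, e, f; split=> //; apply: peq_trans E _.
  set D := d * f - e ^+ 2 in D0.
  pose z1 := (y * e - x * f) / D; pose z2 := (x * e - y * d) / D.
  have D1 : d * f - e ^+ 2 != 0 by [].
  apply: (@peq_sym3 _ 1 z1 z2 0 1 0 0 0 1 1 0 (sbf 0 x y d e f 1 z1 z2 1 z1 z2) 1).
  - by rewrite (_ : _ + _ = 1) ?oner_eq0 //; ring.
  - by rewrite mul0r mulr1 subr0 oner_eq0.
  - by rewrite /= /sbf; do 2!split; ring.
  - by rewrite /= /sbf /z1 /z2 /D; do 2!split; field.
have [d0|d0] := eqVneq d 0; last first.
  by have [E1|E1] := key x y d e f D0 d0; [constructor 1|constructor 3]; exact: peq_trans E E1.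
have e0 : e = 0 by apply/eqP; move/eqP: D0; rewrite d0 mul0r sub0r oppr_eq0 sqrf_eq0.
rewrite {D0}d0 e0 in E ind.
have [f0|f0] := eqVneq f 0; last first.
  have E2 := peq_trans E (peq_swap12 _ _ _ _ _ _ _ _ _ _ _ _).
  have [||E1|E1] := key y x f 0 0; rewrite ?mulr0 ?expr0n ?subr0 //;
    by [constructor 1; exact: peq_trans E2 E1|constructor 3; exact: peq_trans E2 E1].
rewrite f0 in E ind; constructor 2.
have {}key (u v : F) : u != 0 -> peq E00 (sym3 0 u v 0 0 0) E00 (sym3 0 1 0 0 0 0).
  move=> x0; apply: (@peq_sym3 _ 1 0 0 0 1 0 0 (- v / u) 1 1 0 0 u).
  - by rewrite (_ : _ + _ = 1) ?oner_eq0 //; ring.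
  - by rewrite mul0r mul1r subr0.
  - by rewrite /= /sbf; do 2!split; ring.
  - by rewrite /= /sbf; do 2!split; field.
have [x0|x0] := eqVneq x 0; last exact: peq_trans E (key _ _ x0).
apply: peq_trans E (peq_trans (peq_swap12 _ _ _ _ _ _ _ _ _ _ _ _) (key _ _ _)).
apply/negP => /eqP y0; have /forallP /(_ (0, 1)) := ind.
by rewrite pencil01 x0 y0 sym3_0 eqxx pair_eq0 oner_eq0 andbF.
Qed.

(** Completing the square leaves the determinant of the block, which matters only modulo squares;
    [w] is the free scaling. *)
Lemma O8_diag (d e f w : F) : d != 0 -> w != 0 -> 
  peq E00 (sym3 0 0 0 d e f) E00 (sym3 0 0 0 1 0 ((d * f - e ^+ 2) / (d ^+ 2 * w ^+ 2))).
Proof.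
move=> d0 w0; apply: (@peq_sym3 _ 1 0 0 0 1 0 0 (- e / (d * w)) (w^-1) 1 0 0 d).
- by rewrite (_ : _ + _ = w^-1) ?invr_eq0 //; ring.
- by rewrite mul0r mul1r subr0.
- by rewrite /= /sbf; do 2!split; ring.
- by rewrite /= /sbf; do 2!split; field; rewrite ?d0 ?w0.
Qed.

(** Minus the determinant of the block is a square or a nonsquare, and any two nonsquares differ by
    a square factor. *)
Lemma O8_odd nu (d e f : F) : 2%:R != 0 :> F -> nonsq nu -> d * f - e ^+ 2 != 0 ->
  peq E00 (sym3 0 0 0 d e f) E00 (sym3 0 0 0 1 0 (-1)) \/
  peq E00 (sym3 0 0 0 d e f) E00 (sym3 0 0 0 1 0 (- nu)).
Proof.
move=> c2 nnu; move: d e f.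
have key (d e f : F) : d * f - e ^+ 2 != 0 -> d != 0 ->
  peq E00 (sym3 0 0 0 d e f) E00 (sym3 0 0 0 1 0 (-1)) \/
  peq E00 (sym3 0 0 0 d e f) E00 (sym3 0 0 0 1 0 (- nu)).
  move=> D0 d0; have [[w Ew]|nD] := nonsqP (- (d * f - e ^+ 2)).
    have w0 : w != 0 by rewrite -sqrf_eq0 -Ew oppr_eq0.
    left; have := O8_diag e f d0 (_ : w / d != 0).
    rewrite mulf_neq0 ?invr_eq0 // => /(_ isT).
    by rewrite -[_ - _]opprK Ew (_ : - _ / _ = -1) //; field; rewrite d0 w0.
  have [w w0 Ew] := nonsq_ratio c2 nnu nD.
  have nu0 : nu != 0 by have := nnu 0; rewrite expr0n /= eq_sym.
  right; have := O8_diag e f d0 (_ : w / d != 0).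
  rewrite mulf_neq0 ?invr_eq0 // => /(_ isT).
  by rewrite -[_ - _]opprK Ew (_ : - _ / _ = - nu) //; field; rewrite d0 w0.
have swap (d e f : F) := peq_swap12 1 0 0 0 0 0 0 0 0 d e f.
move=> d e f D0; have [d0|d0] := eqVneq d 0; last exact: key.
have [f0|f0] := eqVneq f 0; last first.
  have [|E|E] := key f e d _ f0; first (by rewrite mulrC).
    by left; exact: peq_trans (swap _ _ _) E.
  by right; exact: peq_trans (swap _ _ _) E.
have e0 : e != 0 by move: D0; rewrite d0 mul0r sub0r oppr_eq0 sqrf_eq0.
(* On a block with zero diagonal, e1 + e2 takes the value 2 e, which is nonzero for odd q. *)
have E : peq E00 (sym3 0 0 0 d e f) E00 (sym3 0 0 0 (2%:R * e) e 0).
  rewrite d0 f0; apply: (@peq_sym3 _ 1 0 0 0 1 1 0 0 1 1 0 0 1); rewrite /= /sbf; try by do 2!split; ring.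
  - by rewrite (_ : _ + _ = 1) ?oner_eq0 //; ring.
  - by rewrite mul0r mul1r subr0 oner_eq0.
have [||E1|E1] := key (2%:R * e) e 0.
- by rewrite mulr0 sub0r oppr_eq0 sqrf_eq0.
- by rewrite mulf_neq0.
- by left; exact: peq_trans E E1.
- by right; exact: peq_trans E E1.
Qed.

(** Every determinant is a square here; what stays apart is the alternating block, whose diagonal is
    zero after any congruence. *)
Lemma O8_even (d e f : F) : 2%:R = 0 :> F -> d * f - e ^+ 2 != 0 ->
  peq E00 (sym3 0 0 0 d e f) E00 (sym3 0 0 0 0 1 0) \/
  peq E00 (sym3 0 0 0 d e f) E00 (sym3 0 0 0 1 0 1).
Proof.
move=> c2; move: d e f.
have key (d e f : F) : d * f - e ^+ 2 != 0 -> d != 0 ->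
  peq E00 (sym3 0 0 0 d e f) E00 (sym3 0 0 0 1 0 1).
  move=> D0 d0; have [w Ew] := sqrt_char2 (d * f - e ^+ 2) c2.
  have w0 : w != 0 by rewrite -sqrf_eq0 -Ew.
  have := O8_diag e f d0 (_ : w / d != 0).
  rewrite mulf_neq0 ?invr_eq0 // => /(_ isT).
  by rewrite Ew (_ : _ / _ = 1) //; field; rewrite d0 w0.
move=> d e f D0; have [d0|d0] := eqVneq d 0; last by right; exact: key.
have [f0|f0] := eqVneq f 0; last first.
  right; apply: peq_trans (peq_swap12 1 0 0 0 0 0 0 0 0 d e f) (key _ _ _ _ f0).
  by rewrite mulrC.
have e0 : e != 0 by move: D0; rewrite d0 mul0r sub0r oppr_eq0 sqrf_eq0.
left; rewrite d0 f0; apply: (@peq_sym3 _ 1 0 0 0 1 0 0 0 1 1 0 0 e);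
  rewrite /= /sbf; try by do 2!split; ring.
- by rewrite (_ : _ + _ = 1) ?oner_eq0 //; ring.
- by rewrite mul0r mul1r subr0.
Qed.

End Cases.

(** * Pencils whose base points are kernel vectors *)

Section BadBase.

Variable F : finFieldType.
Implicit Types (M N X A B : 'M[F]_3) (l m k : 'rV[F]_3).

Definition no_good M N : bool := [forall l, ~~ good M N l].

Lemma no_good_peq M N M' N' : peq M N M' N' -> no_good M N -> no_good M' N'.
Proof.
move=> /peq_sym/base_peq[A _ B] /forallP ng; apply/forallP => l.
by apply: contra (ng (l *m A)); case: (B l).
Qed.

Lemma peq_member_base M N p l : M^T = M -> N^T = N -> p != 0 -> base M N l ->
  exists N', [/\ N'^T = N', peq M N (pencil M N p) N' & base (pencil M N p) N' l].
Proof.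
case: p => s t sM sN; rewrite pair_eq0 => nz bl; have /baseP bp := bl.
have [s0|s0] := eqVneq s 0.
  have t0 : t != 0 by move: nz; rewrite s0 eqxx.
  exists M; split=> //; last by rewrite /base bp -[X in bform X]/(M) -(pencil10 M N) bp eqxx.
  rewrite -[X in peq _ _ _ X](pencil10 M N); apply: peq_basis.
  by rewrite mulr0 mulr1 sub0r oppr_eq0.
exists N; split=> //; last by rewrite /base bp -[X in bform X]/(N) -(pencil01 M N) bp eqxx.
rewrite -[X in peq _ _ _ X](pencil01 M N); apply: peq_basis.
by rewrite mulr0 mulr1 subr0.
Qed.

Lemma base_kernel_normal M N k p : M^T = M -> N^T = N -> k != 0 -> base M N k ->
  p != 0 -> k *m pencil M N p = 0 ->
  exists d e f x y n m r : F, peq M N (sym3 0 0 0 d e f) (sym3 0 x y n m r).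
Proof.
move=> sM sN k0 bk p0 kp.
have [M1 [N1 [sM1 sN1 E [/(_ bk) b1 _] /(_ p kp) k1]]] := peq_e0 sM sN k0.
have [N2 [/sym3_ex[a' [x [y [n [m [r EN]]]]]] E2 /andP[_]]] := peq_member_base sM1 sN1 p0 b1.
have [a [b [c [d [e [f EM]]]]]] := sym3_ex (pencil_tr p sM1 sN1).
rewrite EN EM in E2 k1 *; move/eqP: k1.
rewrite mul_rv3_sym3 rv3_eq0 !mul1r !mul0r !addr0 => /and3P[/eqP a0 /eqP b0 /eqP c0].
rewrite bform_sym3 /sbf => /eqP a'0; rewrite a0 b0 c0 in E2.
exists d, e, f, x, y, n, m, r; have {}a'0 : a' = 0 by rewrite -a'0; ring.
by rewrite a'0 in E2; exact: peq_trans E E2.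
Qed.

Lemma no_rank1P M N s t : no_rank1 M N -> (\rank (s *: M + t *: N)%R <= 1)%N -> s = 0 /\ t = 0.
Proof.
by move=> /forallP /(_ (s, t)) /implyP; rewrite /pencil /= pair_eq0 => H /H /andP[/eqP-> /eqP->].
Qed.

(** All members kill e0, so this is a pencil of binary forms. In a basis with blocks (b, 1, 0) and
    (c, 0, 1), the member (x, 1) has rank one exactly when x^2 - b x - c = 0; this polynomial is
    thus irreducible and can be replaced by that of [t]. *)
Lemma O10_normal t (d e f n m r : F) : irr2 t ->
  no_rank1 (sym3 0 0 0 d e f) (sym3 0 0 0 n m r) ->
  peq (sym3 0 0 0 d e f) (sym3 0 0 0 n m r)
      (sym3 0 0 0 (- t) 1 0) (sym3 0 0 0 (-1) 0 1).
Proof.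
move=> irt nr; have nrP s u := no_rank1P (s := s) (t := u) nr.
have rk (x y : F) : (\rank (sym3 0 0 0 x 0 0) <= 1)%N.
  by apply: rank_sym3_le1; split; ring.
(* Otherwise some nonzero member has a single nonzero entry at most, hence rank at most one. *)
have D : e * r - f * m != 0.
  apply/eqP => D.
  have [|m0 /eqP] := nrP m (- e).
    rewrite sym3_lin !mulr0 !addr0 (_ : m * e + _ = 0); last by ring.
    by rewrite (_ : m * f + _ = 0) ?rk // -[RHS](oppr0 F) -D; ring.
  rewrite oppr_eq0 => /eqP e0.
  have [|r0 /eqP] := nrP r (- f).
    rewrite sym3_lin !mulr0 !addr0 (_ : r * e + _ = 0); last by rewrite -D; ring.
    by rewrite (_ : r * f + _ = 0) ?rk //; ring.
  rewrite oppr_eq0 => /eqP f0.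
  have [|/eqP] := nrP 1 0; last by rewrite oner_eq0.
  by rewrite sym3_lin e0 f0 !mulr0 !mul0r !addr0 rk.
pose b := (r * d - f * n) / (e * r - f * m); pose c := (e * n - m * d) / (e * r - f * m).
have E : peq (sym3 0 0 0 d e f) (sym3 0 0 0 n m r) (sym3 0 0 0 b 1 0) (sym3 0 0 0 c 0 1).
  apply: (@peq_sym3 _ 1 0 0 0 1 0 0 0 1 e f m r) => //.
  - by rewrite (_ : _ + _ = 1) ?oner_eq0 //; ring.
  - by rewrite /= /sbf /b /c; do 2!split; field.
  - by rewrite /= /sbf /b /c; do 2!split; field.
have {}nr := no_rank1_peq E nr; have {}nrP s u := no_rank1P (s := s) (t := u) nr.
apply: peq_trans E _.
move: b c nr nrP => {d e f n m r D rk} b c nr nrP.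
have [al [be [al0 H1 H2]]] : exists al be, [/\ al != 0, 2%:R * be + - b = al * t
    & be ^+ 2 + - b * be + - c = al ^+ 2 * 1].
  apply: irr2_equiv => // x; apply/eqP => Ex.
  have [|_ /eqP] := nrP x 1; last by rewrite oner_eq0.
  rewrite sym3_lin; apply: rank_sym3_le1; split; try ring.
  by apply/eqP; rewrite -subr_eq0; apply/eqP; rewrite -[RHS]oppr0 -[X in _ = - X]Ex; ring.
have Eb : b = 2%:R * be - al * t by rewrite -H1; ring.
have Ec : c = be ^+ 2 - b * be - al ^+ 2 by rewrite -[al ^+ 2]mulr1 -H2; ring.
apply: (@peq_sym3 _ 1 0 0 0 (al^-1) (- be / al) 0 0 1 (al^-1) 0 (- be / al) 1).
- by rewrite (_ : _ + _ = al^-1) ?invr_eq0 //; ring.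
- by rewrite mul0r subr0 mulr1 invr_eq0.
- by rewrite /= /sbf Eb; do 2!split; field.
- by rewrite /= /sbf Ec Eb; do 2!split; field.
Qed.

(** Take the member that kills the base point e0 as first matrix; the second has first row (0, x,
    y). If this is zero, every member kills e0. If not, it is normalised to (0, 0, 1), and the block
    of the first matrix, regular since no member has rank one, is diagonalised unless its first
    entry is 0. *)
Lemma bad_base_cases t M N k p : irr2 t -> M^T = M -> N^T = N -> k != 0 -> base M N k ->
  p != 0 -> k *m pencil M N p = 0 -> no_rank1 M N ->
  [\/ peq M N (sym3 0 0 0 (- t) 1 0) (sym3 0 0 0 (-1) 0 1),
      exists g r : F, g != 0 /\ peq M N (sym3 0 0 0 1 0 g) (sym3 0 0 1 0 0 r)
    | exists e f n r : F, e != 0 /\ peq M N (sym3 0 0 0 0 e f) (sym3 0 0 1 n 0 r)].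
Proof.
have key (d e f x y n m r : F) : y != 0 -> exists d' e' f' n' r' : F,
    peq (sym3 0 0 0 d e f) (sym3 0 x y n m r) (sym3 0 0 0 d' e' f') (sym3 0 0 1 n' 0 r').
  move=> y0; pose z := x / y.
  pose g := sbf 0 x y n m r 0 1 (- z).
  exists (d - 2%:R * z * e + z ^+ 2 * f), (e - z * f), f.
  exists (n - 2%:R * z * m + z ^+ 2 * r), r.
  apply: (@peq_sym3 _ (y^-1) 0 0 (- (m - z * r) / y) 1 (- z) 0 0 1 1 0 0 1).
  - by rewrite (_ : _ + _ = y^-1) ?invr_eq0 //; ring.
  - by rewrite mul0r mulr1 subr0 oner_eq0.
  - by rewrite /= /sbf; do 2!split; ring.
  - by rewrite /= /sbf /z; do 2!split; field.
move=> irt sM sN k0 bk p0 kp nr.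
have [d [e [f [x [y [n [m [r E]]]]]]]] := base_kernel_normal sM sN k0 bk p0 kp.
have {sM sN k0 bk p0 kp k p} nr := no_rank1_peq E nr.
have [xy0|xy] := boolP ((x == 0) && (y == 0)).
  case/andP: xy0 => /eqP x0 /eqP y0; rewrite x0 y0 in E nr.
  by constructor 1; exact: peq_trans E (O10_normal irt nr).
have [d' [e' [f' [n' [r' E']]]]] : exists d' e' f' n' r' : F,
    peq M N (sym3 0 0 0 d' e' f') (sym3 0 0 1 n' 0 r').
  have [y0|y0] := eqVneq y 0.
    have x0 : x != 0 by move: xy; rewrite y0 eqxx andbT.
    have [d' [e' [f' [n' [r' E']]]]] := key f e d y x r m n x0.
    exists d', e', f', n', r'; apply: peq_trans E (peq_trans _ E').
    exact: peq_swap12.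
  have [d' [e' [f' [n' [r' E']]]]] := key d e f x y n m r y0.
  by exists d', e', f', n', r'; exact: peq_trans E E'.
have {}nr := no_rank1_peq (peq_trans (peq_sym E) E') nr.
move: d' e' f' n' r' E' nr => {E d e f x y n m r xy key} d e f n r E nr.
have nrP s u := no_rank1P (s := s) (t := u) nr.
have D : d * f - e ^+ 2 != 0.
  apply/eqP => D; have [|/eqP] := nrP 1 0; last by rewrite oner_eq0.
  rewrite scale1r scale0r addr0; apply: rank_sym3_le1; split; try ring.
  by apply/eqP; rewrite -subr_eq0 D.
have [d0|d0] := eqVneq d 0.
  constructor 3; exists e, f, n, r; rewrite d0 in E D; split=> //.
  by move: D; rewrite mul0r sub0r oppr_eq0 sqrf_eq0.
pose g := (d * f - e ^+ 2) / d ^+ 2.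
constructor 2; exists g, (r + n * e ^+ 2 / d ^+ 2 - n * g); split.
  by rewrite mulf_neq0 ?invr_eq0 ?expf_neq0.
apply: peq_trans E _.
apply: (@peq_sym3 _ 1 0 0 (n * e / d) 1 0 0 (- e / d) 1 d 0 n 1).
- by rewrite (_ : _ + _ = 1) ?oner_eq0 //; ring.
- by rewrite mul0r mulr1 subr0.
- by rewrite /= /sbf /g; do 2!split; field.
- by rewrite /= /sbf /g; do 2!split; field.
Qed.

Lemma good_sym3 a b c d e f a' b' c' d' e' f' x y z :
  sbf a b c d e f x y z x y z = 0 :> F -> sbf a' b' c' d' e' f' x y z x y z = 0 ->
  (forall s t, s * (x * a + y * b + z * c) + t * (x * a' + y * b' + z * c') = 0 ->
     s * (x * b + y * d + z * e) + t * (x * b' + y * d' + z * e') = 0 ->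
     s * (x * c + y * e + z * f) + t * (x * c' + y * e' + z * f') = 0 -> s = 0 /\ t = 0) ->
  good (sym3 a b c d e f) (sym3 a' b' c' d' e' f') (rv3 x y z).
Proof.
move=> E1 E2 H; rewrite /good /base !bform_sym3 E1 E2 eqxx /=.
apply/forallP => -[s t]; apply/implyP.
rewrite /pencil mulmxDr -!scalemxAr !mul_rv3_sym3 pair_eq0 => /eqP /rowP E.
have [||| -> ->] := H s t; rewrite ?eqxx //.
- by have := E i0; rewrite !mxE.
- by have := E i1; rewrite !mxE.
- by have := E i2; rewrite !mxE.
Qed.

Lemma no_goodP a b c d e f a' b' c' d' e' f' x y z :
  no_good (sym3 a b c d e f) (sym3 a' b' c' d' e' f') ->
  sbf a b c d e f x y z x y z = 0 :> F -> sbf a' b' c' d' e' f' x y z x y z = 0 ->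
  (forall s t, s * (x * a + y * b + z * c) + t * (x * a' + y * b' + z * c') = 0 ->
     s * (x * b + y * d + z * e) + t * (x * b' + y * d' + z * e') = 0 ->
     s * (x * c + y * e + z * f) + t * (x * c' + y * e' + z * f') = 0 -> s = 0 /\ t = 0) ->
  False.
Proof. by move=> /forallP /(_ (rv3 x y z)) /negP ng E1 E2 H; apply: ng; exact: good_sym3. Qed.

(** If - g = w^2, the vector (- r / 2, w, 1) is a base point killed by no member. So - g is a
    nonsquare and differs from [nu] by a square. *)
Lemma B13_odd nu g r : 2%:R != 0 :> F -> nonsq nu -> g != 0 ->
  no_good (sym3 0 0 0 1 0 g) (sym3 0 0 1 0 0 r) ->
  peq (sym3 0 0 0 1 0 g) (sym3 0 0 1 0 0 r) (sym3 0 0 0 1 0 (- nu)) (sym3 0 0 1 0 0 0).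
Proof.
move=> c2 nnu g0 ng.
have [[w Ew]|nD] := nonsqP (- g).
  have w0 : w != 0 by rewrite -sqrf_eq0 -Ew oppr_eq0.
  exfalso; apply: (no_goodP (x := - r / 2%:R) (y := w) (z := 1) ng).
  - by rewrite /sbf -[g]opprK Ew; ring.
  - by rewrite /sbf; field.
  - move=> s t /= H1 H2 _; split.
      by apply: (mulIf w0); rewrite mul0r -H2; ring.
    by rewrite -H1; ring.
have [w w0 Ew] := nonsq_ratio c2 nnu nD.
have {Ew} -> : g = - nu * w ^+ 2 by rewrite mulNr -Ew opprK.
apply: (@peq_sym3 _ w 0 0 0 1 0 (- r / (2%:R * w)) 0 (w^-1) 1 0 0 1).
- rewrite (_ : _ + _ = 1) ?oner_eq0 //; by field; rewrite ?w0 ?c2.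
- by rewrite mul0r mulr1 subr0 oner_eq0.
- by rewrite /= /sbf; do 2!split; field; rewrite ?w0 ?c2.
- by rewrite /= /sbf; do 2!split; field; rewrite ?w0 ?c2.
Qed.

(** Here g is a square w^2, and r = 0 would make (0, w, 1) a base point killed by no member. *)
Lemma B13_even g r : 2%:R = 0 :> F -> g != 0 ->
  no_good (sym3 0 0 0 1 0 g) (sym3 0 0 1 0 0 r) ->
  peq (sym3 0 0 0 1 0 g) (sym3 0 0 1 0 0 r) (sym3 0 0 0 1 0 1) (sym3 0 0 1 0 0 1).
Proof.
move=> c2 g0 ng; have [w Ew] := sqrt_char2 g c2.
have w0 : w != 0 by rewrite -sqrf_eq0 -Ew.
have [r0|r0] := eqVneq r 0.
  rewrite r0 in ng; exfalso; apply: (no_goodP (x := 0) (y := w) (z := 1) ng).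
  - rewrite /sbf Ew; transitivity (2%:R * w ^+ 2); last by rewrite c2 mul0r.
    by ring.
  - by rewrite /sbf; ring.
  - move=> s t /= H1 H2 _; split.
      by apply: (mulIf w0); rewrite mul0r -H2; ring.
    by rewrite -H1; ring.
rewrite Ew; apply: (@peq_sym3 _ (r / w) 0 0 0 1 0 0 0 (w^-1) 1 0 0 (r / w ^+ 2)).
- by rewrite (_ : _ + _ = r / w ^+ 2) ?mulf_neq0 ?invr_eq0 ?expf_neq0 //; field.
- by rewrite mul0r mul1r subr0 ?mulf_neq0 ?invr_eq0 ?expf_neq0.
- by rewrite /= /sbf; do 2!split; field.
- by rewrite /= /sbf; do 2!split; field.
Qed.

(** With z = 1 the equations of the base points can be solved for y and x in turn, as 2 and e are
    invertible; no member kills the solution. *)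
Lemma B16_odd e f n r : 2%:R != 0 :> F -> e != 0 ->
  ~ no_good (sym3 0 0 0 0 e f) (sym3 0 0 1 n 0 r).
Proof.
move=> c2 e0 ng; pose y := - f / (2%:R * e).
apply: (no_goodP (x := - (n * y ^+ 2 + r) / 2%:R) (y := y) (z := 1) ng).
- by rewrite /sbf /y; field; rewrite e0 c2.
- by rewrite /sbf; field.
- move=> s t /= H1 H2 _.
  have t0 : t = 0 by rewrite -H1; ring.
  by split=> //; apply: (mulIf e0); rewrite mul0r -H2 t0; ring.
Qed.

(** In characteristic 2 the base points satisfy f z^2 = 0 and n y^2 + r z^2 = 0, and one with z
    nonzero is killed by no member. For f = 0 this forces n = 0 and r nonzero; for f nonzero the
    first matrix serves to clear r. *)
Lemma B16_even e f n r : 2%:R = 0 :> F -> e != 0 ->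
  no_good (sym3 0 0 0 0 e f) (sym3 0 0 1 n 0 r) ->
  peq (sym3 0 0 0 0 e f) (sym3 0 0 1 n 0 r) (sym3 0 0 0 0 1 1) (sym3 0 0 1 1 0 0) \/
  peq (sym3 0 0 0 0 e f) (sym3 0 0 1 n 0 r) (sym3 0 0 0 0 1 0) (sym3 0 0 1 0 0 1).
Proof.
move=> c2 e0 ng.
have [f0|f0] := eqVneq f 0.
  rewrite f0 in ng *; have [n0|n0] := eqVneq n 0.
    rewrite n0 in ng *; have [r0|r0] := eqVneq r 0.
      rewrite r0 in ng; exfalso; apply: (no_goodP (x := 0) (y := 0) (z := 1) ng).
      - by rewrite /sbf; ring.
      - by rewrite /sbf; ring.
      - move=> s t /= H1 H2 _; split; last by rewrite -H1; ring.
        by apply: (mulIf e0); rewrite mul0r -H2; ring.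
    right; apply: (@peq_sym3 _ r 0 0 0 1 0 0 0 1 e 0 0 r).
    - by rewrite (_ : _ + _ = r) //; ring.
    - by rewrite mul0r subr0 mulf_neq0.
    - by rewrite /= /sbf; do 2!split; ring.
    - by rewrite /= /sbf; do 2!split; ring.
  have [w1 Er] := sqrt_char2 r c2; have [w2 En] := sqrt_char2 n c2.
  have w20 : w2 != 0 by rewrite -sqrf_eq0 -En.
  exfalso; apply: (no_goodP (x := 0) (y := w1) (z := w2) ng).
  - rewrite /sbf; transitivity (2%:R * (e * w1 * w2)); last by rewrite c2 mul0r.
    by ring.
  - rewrite /sbf Er En; transitivity (2%:R * (w1 ^+ 2 * w2 ^+ 2)); last by rewrite c2 mul0r.
    by ring.
  - move=> s t /= H1 H2 _.
    have t0 : t = 0 by apply: (mulIf w20); rewrite mul0r -H1; ring.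
    split=> //; apply: (mulIf (mulf_neq0 e0 w20)); rewrite mul0r -H2 t0; ring.
have E : peq (sym3 0 0 0 0 e f) (sym3 0 0 1 n 0 r) (sym3 0 0 0 0 e f) (sym3 0 0 1 n 0 0).
  apply: (@peq_sym3 _ 1 0 0 (r * e / f) 1 0 0 0 1 1 0 (r / f) 1).
  - by rewrite (_ : _ + _ = 1) ?oner_eq0 //; ring.
  - by rewrite mul0r subr0 mulr1 oner_eq0.
  - by rewrite /= /sbf; do 2!split; ring.
  - by rewrite /= /sbf; do 2!split; field.
have [n0|n0] := eqVneq n 0.
  right; apply: peq_trans E _; rewrite n0.
  apply: peq_trans (peq_swap01 _ _ _ _ _ _ _ _ _ _ _ _) (peq_trans (peq_swap _ _) _).
  apply: (@peq_sym3 _ (e^-1 * f) 0 0 0 1 0 0 0 1 1 0 0 f).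
  - by rewrite (_ : _ + _ = e^-1 * f) ?mulf_neq0 ?invr_eq0 //; ring.
  - by rewrite mul0r subr0 mul1r.
  - by rewrite /= /sbf; do 2!split; field.
  - by rewrite /= /sbf; do 2!split; field.
left; apply: peq_trans E _.
apply: (@peq_sym3 _ (n * f ^+ 2 / e ^+ 2) 0 0 0 (f / e) 0 0 0 1 f 0 0 (n * f ^+ 2 / e ^+ 2)).
- by rewrite (_ : _ + _ = n * f ^+ 3 / e ^+ 3) ?mulf_neq0 ?invr_eq0 ?expf_neq0 //; field.
- by rewrite mul0r subr0 ?mulf_neq0 ?invr_eq0 ?expf_neq0.
- by rewrite /= /sbf; do 2!split; field.
- by rewrite /= /sbf; do 2!split; field.
Qed.

End BadBase.

(** * Pencils without base points *)

Section Counting.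

Variable F : finFieldType.
Local Notation q := #|F|.

Lemma card_line (a b : F) : (a != 0) || (b != 0) ->
  #|[set p : F * F | p.1 * a + p.2 * b == 0]| = q.
Proof.
move=> nz; pose f (c : F) : F * F := (c * b, - c * a).
have fi : injective f.
  move=> c c' [/= H1 /eqP]; rewrite !mulNr eqr_opp => /eqP H2.
  by case/orP: nz => nz; apply: (mulIf nz).
rewrite -(card_codom fi) -[LHS]cardsE; apply: eq_card => -[s t].
rewrite !inE /=; apply/eqP/codomP => [E|[c [-> ->]]]; last by ring.
have [a0|a0] := eqVneq a 0.
  have b0 : b != 0 by move: nz; rewrite a0 eqxx.
  exists (s / b); rewrite /f a0 mulr0 divfK //; congr pair.
  by apply: (mulIf b0); rewrite mul0r -E a0; ring.
exists (- t / a); congr pair; last by field.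
by apply: (mulIf a0); apply/eqP; rewrite -subr_eq0 -[X in _ == X]E; apply/eqP; field.
Qed.

(** A point x is counted for all q^2 parameters if both values vanish, and otherwise for the q
    parameters on a line through 0. *)
Lemma double_count (T : finType) (al be : T -> F) :
  let Z := #|[set x | (al x == 0) && (be x == 0)]| in
  (\sum_(p : F * F) #|[set x | (p.1 * al x + p.2 * be x == 0)%R]| = q ^ 2 * Z + q * (#|T| - Z))%N.
Proof.
move=> Z.
transitivity (\sum_(x : T) #|[set p : F * F | (p.1 * al x + p.2 * be x == 0)%R]|)%N.
  under eq_bigr do rewrite -sum1_card.
  rewrite (exchange_big_dep xpredT) //=; apply: eq_bigr => x _.
  by rewrite -sum1_card; apply: eq_bigl => p; rewrite !inE.
rewrite (bigID [pred x | (al x == 0) && (be x == 0)]) /=; congr addn.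
  rewrite (eq_bigr (fun=> q ^ 2)%N) => [|x /andP[/eqP-> /eqP->]].
    by rewrite sum_nat_const mulnC /Z cardsE.
  rewrite (eq_card (B := predT)) => [|p]; first by rewrite card_prod mulnn.
  by rewrite !inE !mulr0 addr0 eqxx.
rewrite (eq_bigr (fun=> q)) => [|x]; last by rewrite negb_and => /card_line.
rewrite sum_nat_const mulnC; congr muln.
rewrite -(cardC [pred x | (al x == 0) && (be x == 0)]) /Z cardsE addKn.
by apply: eq_card => x; rewrite !inE.
Qed.

End Counting.

Section NoBase.

Variable F : finFieldType.
Hypothesis c2 : 2%:R != 0 :> F.
Implicit Types (M N X A B : 'M[F]_3) (l m k : 'rV[F]_3).

Definition zeros X : {set 'rV[F]_3} := [set l | bform X l l == 0].

Lemma card_zeros_congr A X : A \in unitmx -> (#|zeros (A *m X *m A^T)| <= #|zeros X|)%N.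
Proof.
move=> Au; rewrite -(card_imset (zeros (A *m X *m A^T)) (can_inj (mulmxK Au))).
apply: subset_leq_card; apply/subsetP => _ /imsetP[l + ->].
by rewrite !inE bform_congr.
Qed.

(** The form is 2 x (b y + c z) plus a form in y and z. Each pair (y, z) with b y + c z nonzero
    determines one x, and the multiples of e0 make up for the pairs with b y + c z = 0. The map [g]
    is indexed by z and b y + c z. *)
Lemma card_zeros_normal (b c d e f : F) : b != 0 ->
  (#|F| ^ 2 <= #|zeros (sym3 0 b c d e f)|)%N.
Proof.
move=> b0.
pose y (p : F * F) := (p.2 - c * p.1) / b.
pose x (p : F * F) := - (d * y p ^+ 2 + 2%:R * e * y p * p.1 + f * p.1 ^+ 2) / (2%:R * p.2).
pose g (p : F * F) := if p.2 == 0 then rv3 p.1 0 0 else rv3 (x p) (y p) p.1.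
have gi : injective g.
  have rec p : b * g p 0 i1 + c * g p 0 i2 = p.2.
    rewrite /g; case: eqP => [->|_]; rewrite !mxE /= ?mulr0 ?addr0 //.
    by rewrite /y; field.
  move=> p p' E; have E2 : p.2 = p'.2 by rewrite -(rec p) E rec.
  have : p.1 = p'.1.
    move: E; rewrite /g E2; case: eqP => _ /rowP E; [have := E i0|have := E i2]; by rewrite !mxE.
  by case: p p' E2 {E} => [s t] [s' t'] /= -> ->.
rewrite -mulnn -card_prod -(card_codom gi); apply: subset_leq_card.
apply/subsetP => _ /codomP[p ->]; rewrite inE /g.
have [_|p0] := eqVneq p.2 0; rewrite bform_sym3 /sbf; apply/eqP; first by ring.
transitivity (2%:R * x p * (b * y p + c * p.1)
  + (d * y p ^+ 2 + 2%:R * e * y p * p.1 + f * p.1 ^+ 2)); first by ring.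
have -> : b * y p + c * p.1 = p.2 by rewrite /y; field.
by rewrite /x; move: (y p) => z; field; rewrite c2 p0.
Qed.

Lemma card_zeros_ge X k : X^T = X -> bform X k k = 0 -> k *m X != 0 ->
  (#|F| ^ 2 <= #|zeros X|)%N.
Proof.
move=> sX kk kX.
have k0 : k != 0 by apply: contraNneq kX => ->; rewrite mul0mx.
have [A Au Ek] := e0_completion k0.
apply: leq_trans (card_zeros_congr X Au).
have [a [b [c [d [e [f EX]]]]]] := sym3_ex (sym_congr A sX).
have : bform (A *m X *m A^T) (rv3 1 0 0) (rv3 1 0 0) = 0 by rewrite bform_congr Ek.
have : rv3 1 0 0 *m (A *m X *m A^T) != 0.
  rewrite 2!mulmxA Ek; apply: contraNneq kX => E.
  have At : A^T \in unitmx by rewrite unitmx_tr.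
  by rewrite -[_ *m _](mulmxK At) E mul0mx.
rewrite EX bform_sym3 mul_rv3_sym3 rv3_eq0 /sbf => nz E.
have a0 : a = 0 by rewrite -E; ring.
move: nz; rewrite a0 !(mul1r, mul0r, addr0) eqxx /= negb_and => /orP[b0|c0].
  exact: card_zeros_normal.
have Bu : mk3 1 0 0 0 0 1 0 1 0 \in (unitmx : pred 'M[F]_3).
  by apply: unit_mk3; rewrite (_ : _ + _ = -1) ?oppr_eq0 ?oner_eq0 //; ring.
apply: leq_trans (card_zeros_congr _ Bu).
rewrite congr_sym3 /= /sbf !(mul1r, mul0r, mulr0, mulr1, addr0, add0r).
exact: card_zeros_normal.
Qed.

(** Completing squares twice, with z = 1 and up to the factor a (a d - b^2), gives (a d - b^2) u^2 +
    v^2 plus a constant, and [sum_squares] finds a zero. If a or a d - b^2 vanishes, a zero is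
    visible. *)
Lemma isotropic_exists X : X^T = X -> exists2 l, l != 0 & bform X l l = 0.
Proof.
move=> /sym3_ex[a [b [c [d [e [f ->]]]]]].
have [a0|a0] := eqVneq a 0.
  exists (rv3 1 0 0); first by rewrite rv3_eq0 oner_eq0.
  by rewrite bform_sym3 a0 /sbf; ring.
have [D0|D0] := eqVneq (a * d - b ^+ 2) 0.
  exists (rv3 (- b / a) 1 0); first by rewrite rv3_eq0 oner_eq0 andbF.
  rewrite bform_sym3 /sbf; transitivity ((a * d - b ^+ 2) / a); first by field.
  by rewrite D0 mul0r.
have [u [v Euv]] := sum_squares (- ((a * d - b ^+ 2) * (a * f - c ^+ 2) - (a * e - b * c) ^+ 2))
  c2 D0 (oner_neq0 _).
pose y := (v - (a * e - b * c)) / (a * d - b ^+ 2).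
exists (rv3 ((u - b * y - c) / a) y 1); first by rewrite rv3_eq0 oner_eq0 !andbF.
apply: (mulfI (mulf_neq0 a0 D0)); rewrite bform_sym3 /sbf mulr0.
transitivity ((a * d - b ^+ 2) * u ^+ 2 + 1 * v ^+ 2
  + ((a * d - b ^+ 2) * (a * f - c ^+ 2) - (a * e - b * c) ^+ 2)); last by rewrite Euv addNr.
by rewrite /y; field; rewrite ?D0 ?a0.
Qed.

Lemma bform0 X : bform X 0 0 = 0.
Proof. by rewrite /bform mul0mx mul0mx mxE. Qed.

(* If every member had at least q^2 isotropic vectors, the members would cover
   the nonzero vectors more than once each. *)
Lemma kernel_member M N : M^T = M -> N^T = N -> (forall l, base M N l -> l = 0) ->
  exists2 p, p != 0 & forall l, bform (pencil M N p) l l = 0 -> l *m pencil M N p = 0.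
Proof.
move=> sM sN nb.
have : [exists p : F * F, (p != 0) && (#|zeros (pencil M N p)| < #|F| ^ 2)%N].
  apply: contraT => /existsPn H.
  have := double_count (fun l : 'rV[F]_3 => bform M l l) (fun l => bform N l l) => /=.
  have -> : [set x | (bform M x x == 0) && (bform N x x == 0)] = [set 0].
    apply/setP => l; rewrite !inE; apply/idP/eqP => [/nb //|->].
    by rewrite !bform0 eqxx.
  rewrite cards1 card_mx /= mul1n (bigD1 (0 : F * F)) //=.
  have -> : #|[set x : 'rV[F]_3 | 0 * bform M x x + 0 * bform N x x == 0]| = (#|F| ^ 3)%N.
    rewrite -[3%N]/(1 * 3)%N -card_mx; apply: eq_card => l.
    by rewrite !inE !mul0r addr0 eqxx.
  move=> E; have : (\sum_(p : F * F | (p != 0)%R) #|F| ^ 2 <=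
      \sum_(p : F * F | (p != 0)%R) #|[set l | (p.1 * bform M l l + p.2 * bform N l l)%R == 0%R]|)%N.
    apply: leq_sum => p p0; have := H p; rewrite p0 /= -leqNgt => /leq_trans; apply.
    by apply: subset_leq_card; apply/subsetP => l; rewrite !inE bform_lin.
  have := card_ge2 F.
  have cn : (#|[pred p : F * F | (p != 0)%R]| + 1 = #|F| ^ 2)%N.
    rewrite -mulnn -card_prod -(cardC (pred1 (0 : F * F))) card1 addnC; congr addn.
  rewrite sum_nat_const; move: E cn.
  move: #|[pred p : F * F | _]| (\sum_(i | _) _)%N => n S; move: #|F| => r E cn r2; nia.
case/existsP => p /andP[p0 small]; exists p => // l ll; apply/eqP.
apply: contraLR small => lX; rewrite -leqNgt.
exact: card_zeros_ge (pencil_tr p sM sN) ll lX.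
Qed.

(** The isotropic vectors of the member from [kernel_member] lie in its kernel, so it is an
    anisotropic binary form, y^2 - nu z^2 up to scaling. The other matrix is nonzero at e0, which
    lets e0 be split off, and a multiple of the first matrix brings its block to the shape (a, nu b,
    nu a). *)
Lemma no_base_normal nu M N : nonsq nu -> M^T = M -> N^T = N -> no_rank1 M N ->
  (forall l, base M N l -> l = 0) ->
  exists a b, peq M N (sym3 0 0 0 1 0 (- nu)) (sym3 1 0 0 a (nu * b) (nu * a)).
Proof.
move=> nnu sM sN nr nb.
have nu0 : nu != 0 by have := nnu 0; rewrite expr0n /= eq_sym.
have [p p0 Hp] := kernel_member sM sN nb.
have [k k0 kk] := isotropic_exists (pencil_tr p sM sN).
have kp := Hp _ kk.
have [N1 sN1 E1] := peq_member sM sN p0.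
have [A Au Ek] := e0_completion k0.
have E2 := peq_trans E1 (peq_congr (pencil M N p) N1 Au).
have := Hp; set M1 := pencil M N p in E1 E2 kp kk *; move=> H1.
have sM1 : M1^T = M1 := pencil_tr p sM sN.
have H2 l : bform (A *m M1 *m A^T) l l = 0 -> l *m (A *m M1 *m A^T) = 0.
  by rewrite bform_congr => /H1; rewrite !mulmxA => ->; rewrite mul0mx.
have e0M : rv3 1 0 0 *m (A *m M1 *m A^T) = 0 by rewrite 2!mulmxA Ek kp mul0mx.
have [a [b [c [d [e [f EM]]]]]] := sym3_ex (sym_congr A sM1).
have [a' [b' [c' [d' [e' [f' EN]]]]]] := sym3_ex (sym_congr A sN1).
rewrite EM EN in E2 H2 e0M; move/eqP: e0M.
rewrite mul_rv3_sym3 rv3_eq0 !(mul1r, mul0r, addr0) => /and3P[/eqP a0 /eqP b0 /eqP c0].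
rewrite a0 b0 c0 in E2 H2.
move: E2 H2 => {k k0 kk kp E1 Ek A Au EM EN H1 sM1 M1 N1 sN1 a a0 b b0 c c0 p p0 Hp} E H.
have {}nr := no_rank1_peq E nr; have nrP s u := no_rank1P (s := s) (t := u) nr.
have D : d * f - e ^+ 2 != 0.
  apply/eqP => D; have [|/eqP] := nrP 1 0; last by rewrite oner_eq0.
  rewrite scale1r scale0r addr0; apply: rank_sym3_le1; split; try ring.
  by apply/eqP; rewrite -subr_eq0 D.
have an y z : d * y ^+ 2 + 2%:R * e * y * z + f * z ^+ 2 = 0 -> y = 0 /\ z = 0.
  move=> E0; have /eqP : rv3 0 y z *m sym3 0 0 0 d e f = 0.
    by apply: H; rewrite bform_sym3 /sbf -[RHS]E0; ring.
  rewrite mul_rv3_sym3 rv3_eq0.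
  rewrite !mul0r !add0r => /and3P[_ /eqP h1 /eqP h2]; split.
    by apply: (mulIf D); rewrite mul0r; transitivity ((y * d + z * e) * f - (y * e + z * f) * e);
      [ring|rewrite h1 h2 !mul0r subrr].
  by apply: (mulIf D); rewrite mul0r; transitivity ((y * e + z * f) * d - (y * d + z * e) * e);
      [ring|rewrite h1 h2 !mul0r subrr].
have d0 : d != 0.
  by apply/eqP => d0; have [|/eqP] := an 1 0; [rewrite d0; ring|rewrite oner_eq0].
have a'0 : a' != 0.
  apply/eqP => a'0; have [B Bu BB] := base_peq (peq_sym E).
  have be : base (sym3 0 0 0 d e f) (sym3 a' b' c' d' e' f') (rv3 1 0 0).
    by rewrite /base !bform_sym3 /sbf a'0; apply/andP; split; apply/eqP; ring.
  have [/(_ be) /nb Z _] := BB (rv3 1 0 0).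
  have /eqP : rv3 1 0 0 = 0 :> 'rV[F]_3 by rewrite -(mulmxK Bu (rv3 1 0 0)) Z mul0mx.
  by rewrite rv3_eq0 oner_eq0.
have nD : nonsq (- (d * f - e ^+ 2)).
  move=> w; apply/eqP => Ew; have [|_ /eqP] := an (w - e) d; last by rewrite (negPf d0).
  transitivity (d * (w ^+ 2 + (d * f - e ^+ 2))); [ring|by rewrite Ew addNr mulr0].
have [w w0 Ew] := nonsq_ratio c2 nnu nD.
have Ef : f = (e ^+ 2 - nu * w ^+ 2) / d by rewrite -Ew; field.
have {}E : exists b' c' d' e' f', peq M N (sym3 0 0 0 1 0 (- nu)) (sym3 1 b' c' d' e' f').
  pose g := sbf a' b' c' d' e' f'.
  exists (g 1 0 0 0 1 0 / a'), (g 1 0 0 0 (- e / w) (d / w) / a'), (g 0 1 0 0 1 0 / a').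
  exists (g 0 1 0 0 (- e / w) (d / w) / a'), (g 0 (- e / w) (d / w) 0 (- e / w) (d / w) / a').
  apply: peq_trans E _.
  apply: (@peq_sym3 _ 1 0 0 0 1 0 0 (- e / w) (d / w) d 0 0 a').
  - by rewrite (_ : _ + _ = d / w) ?mulf_neq0 ?invr_eq0 //; ring.
  - by rewrite mul0r subr0 mulf_neq0.
  - by rewrite /= /g /sbf Ef; do 2!split; field; rewrite ?w0 ?d0 ?a'0.
  - by rewrite /g /= /sbf; do 2!split; field; rewrite ?w0 ?a'0.
case: E => x [y [n [m [r E]]]].
pose n' := n - x ^+ 2; pose m' := m - x * y; pose r' := r - y ^+ 2.
exists ((n' + r' / nu) / 2%:R), (m' / nu); apply: peq_trans E _.
apply: (@peq_sym3 _ 1 0 0 (- x) 1 0 (- y) 0 1 1 0 (- (r' / nu - n') / 2%:R) 1).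
- by rewrite (_ : _ + _ = 1) ?oner_eq0 //; ring.
- by rewrite mul0r subr0 mulr1 oner_eq0.
- by rewrite /= /sbf; do 2!split; ring.
- by rewrite /= /sbf /n' /m' /r'; do 2!split; field; rewrite ?nu0 ?c2.
Qed.

(** With th^2 = nu, the congruence acts on the last two coordinates as multiplication by p + r th:
    it scales the first matrix by the norm p^2 - nu r^2 and multiplies a + b th by (p + r th)^2. *)
Lemma twist_equiv nu (a b p r : F) : nonsq nu -> (p != 0) || (r != 0) ->
  peq (sym3 0 0 0 1 0 (- nu)) (sym3 1 0 0 (a * (p ^+ 2 + nu * r ^+ 2) + 2%:R * nu * b * p * r)
        (nu * (b * (p ^+ 2 + nu * r ^+ 2) + 2%:R * a * p * r))
        (nu * (a * (p ^+ 2 + nu * r ^+ 2) + 2%:R * nu * b * p * r)))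
      (sym3 0 0 0 1 0 (- nu)) (sym3 1 0 0 a (nu * b) (nu * a)).
Proof.
move=> nnu pr; have D : p ^+ 2 - nu * r ^+ 2 != 0.
  apply/eqP => D; have [r0|r0] := eqVneq r 0.
    move/eqP: D; rewrite r0 expr0n mulr0 subr0 sqrf_eq0 => /eqP p0.
    by rewrite p0 r0 eqxx in pr.
  case/eqP: (nnu (p / r)); rewrite expr_div_n; apply: (mulIf (expf_neq0 2 r0)).
  by rewrite divfK ?expf_neq0 //; apply/eqP; rewrite -subr_eq0 D.
apply: peq_sym.
apply: (@peq_sym3 _ 1 0 0 0 p r 0 (nu * r) p (p ^+ 2 - nu * r ^+ 2) 0 0 1).
- by rewrite (_ : _ + _ = p ^+ 2 - nu * r ^+ 2) //; ring.
- by rewrite mul0r subr0 mulr1.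
- by rewrite /= /sbf; do 2!split; ring.
- by rewrite /= /sbf; do 2!split; ring.
Qed.

(* With th = sqrt nu, the parameter of the pencil is a + b th, and it matters
   only up to squares of F(th). *)
Lemma no_base_cases nu a0 b0 M N : nonsq nu -> a0 ^+ 2 - nu * b0 ^+ 2 = nu ->
  M^T = M -> N^T = N -> no_rank1 M N -> (forall l, base M N l -> l = 0) ->
  peq M N (sym3 0 0 0 1 0 (- nu)) (sym3 1 0 0 1 0 nu) \/
  peq M N (sym3 0 0 0 1 0 (- nu)) (sym3 1 0 0 a0 (nu * b0) (nu * a0)).
Proof.
move=> nnu Eab sM sN nr nb; have [a [b E]] := no_base_normal nnu sM sN nr nb.
have ab : (a != 0) || (b != 0).
  rewrite -negb_and; apply/negP => /andP[/eqP a_0 /eqP b_0].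
  have [|_ /eqP] := no_rank1P (s := 0) (t := 1) (no_rank1_peq E nr); last by rewrite oner_eq0.
  rewrite a_0 b_0 scale0r scale1r add0r; apply: rank_sym3_le1; split; ring.
have [L [iota cL]] := quadratic_extension_exists F.
have [|th Eth] := @irr2_root F L iota 0 (- nu) cL.
  by move=> x; rewrite mul0r addr0 subr_eq0 nnu.
have {}Eth : th ^+ 2 = iota nu.
  by apply/eqP; rewrite -subr_eq0 -[X in _ == X]Eth; apply/eqP; rewrite rmorph0 rmorphN; ring.
have nth x : iota x != th.
  by apply: contraNneq (nnu x) => Ex; rewrite -(inj_eq (fmorph_inj iota)) rmorphXn /= Ex Eth.
have lin x y x' y' : iota x + iota y * th = iota x' + iota y' * th -> x = x' /\ y = y'.
  move=> Exy; have {}Exy : iota (x - x') = iota (y' - y) * th.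
    rewrite !rmorphB /=; apply/eqP; rewrite -subr_eq0; apply/eqP.
    transitivity ((iota x + iota y * th) - (iota x' + iota y' * th)); first by ring.
    by rewrite Exy subrr.
  have [D|D] := eqVneq (y' - y) 0.
    move/eqP: Exy; rewrite D rmorph0 mul0r fmorph_eq0 subr_eq0 => /eqP ->.
    by move/eqP: D; rewrite subr_eq0 => /eqP ->.
  case/eqP: (nth ((x - x') / (y' - y))).
  by rewrite fmorph_div Exy mulrC mulKf // fmorph_eq0.
have sq p r x y : (iota x + iota y * th) * (iota p + iota r * th) ^+ 2 =
    iota (x * (p ^+ 2 + nu * r ^+ 2) + 2%:R * nu * y * p * r) +
    iota (y * (p ^+ 2 + nu * r ^+ 2) + 2%:R * x * p * r) * th.
  rewrite !(rmorphD, rmorphXn, rmorphM, rmorph_nat) /= -Eth; ring.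
have nz p r : iota p + iota r * th != 0 -> (p != 0) || (r != 0).
  by rewrite -negb_and; apply: contra => /andP[/eqP-> /eqP->]; rewrite !rmorph0 mul0r addr0.
have zn : iota a + iota b * th != 0.
  apply/eqP => z0; have [|a_0 b_0] := lin a b 0 0; first by rewrite z0 !rmorph0 mul0r addr0.
  by rewrite a_0 b_0 eqxx in ab.
have [[w Ew]|nw] := nonsqP (iota a + iota b * th).
  left; have [p [r Ewp]] := ext2_basis cL nth w.
  have w0 : w != 0 by rewrite -sqrf_eq0 -Ew.
  rewrite Ewp in w0; have := sq p r 1 0.
  rewrite rmorph1 rmorph0 mul0r addr0 mul1r -Ewp -Ew => /lin[Ea Eb].
  have := twist_equiv 1 0 nnu (nz _ _ w0); rewrite -Ea -Eb mulr0 mulr1.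
  exact: peq_trans E.
right.
(* The norm of a square is a square of F, whereas a0 + b0 th has norm nu. *)
have n0 : nonsq (iota a0 + iota b0 * th).
  move=> w; apply/eqP => Ew; have [p [r Ewp]] := ext2_basis cL nth w.
  have := sq p r 1 0.
  rewrite rmorph1 rmorph0 mul0r addr0 mul1r -Ewp Ew => /lin[Ea Eb].
  case/eqP: (nnu (p ^+ 2 - nu * r ^+ 2)); rewrite -[RHS]Eab Ea Eb; ring.
have c2L : 2%:R != 0 :> L by rewrite -(rmorph_nat iota) fmorph_eq0.
have [w w0 Ew] := nonsq_ratio c2L n0 nw.
have [p [r Ewp]] := ext2_basis cL nth w.
rewrite Ewp in w0; have := sq p r a0 b0; rewrite -Ewp -Ew => /lin[Ea Eb].
have := twist_equiv a0 b0 nnu (nz _ _ w0); rewrite -Ea -Eb.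
exact: peq_trans E.
Qed.

End NoBase.

(** * Counting singular members and base points *)

Section Invariants.

Variable F : finFieldType.
Implicit Types (M N X A B : 'M[F]_3) (l m k : 'rV[F]_3).
Local Notation q := #|F|.

(** This and [base_count] count vectors, zero included, rather than projective points: no point
    counts as 1 and a single point as q. *)
Definition rank_count r M N : nat := #|[set p : F * F | (\rank (pencil M N p) <= r)%N]|.
Definition base_count M N : nat := #|[set l | base M N l]|.

Lemma rank_count_peq r M N M' N' : peq M N M' N' -> rank_count r M N = rank_count r M' N'.
Proof.
suff H M1 N1 M2 N2 : peq M1 N1 M2 N2 -> (rank_count r M1 N1 <= rank_count r M2 N2)%N.
  by move=> E; apply/eqP; rewrite eqn_leq !H //; exact: peq_sym.
case/peq_map=> A Au [f [fi _ E]]; rewrite /rank_count -(card_imset _ fi).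
apply: subset_leq_card; apply/subsetP => _ /imsetP[p + ->].
by rewrite !inE -E rank_congr.
Qed.

Lemma base_count_peq M N M' N' : peq M N M' N' -> base_count M N = base_count M' N'.
Proof.
suff H M1 N1 M2 N2 : peq M1 N1 M2 N2 -> (base_count M1 N1 <= base_count M2 N2)%N.
  by move=> E; apply/eqP; rewrite eqn_leq !H //; exact: peq_sym.
case/base_peq=> A Au B; rewrite /base_count -(card_imset _ (can_inj (mulmxK Au))).
apply: subset_leq_card; apply/subsetP => _ /imsetP[l + ->].
by rewrite !inE; case: (B l).
Qed.

Lemma card_lineE (P : F * F -> bool) (a b : F) : (a != 0) || (b != 0) ->
  (forall s t, P (s, t) = (s * a + t * b == 0)) -> #|[set p | P p]| = q.
Proof.
by move=> nz H; rewrite -(card_line nz); apply: eq_card => -[s t]; rewrite !inE H.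
Qed.

Lemma line_cap (a b a' b' : F) : a * b' - b * a' != 0 ->
  [set p : F * F | p.1 * a + p.2 * b == 0] :&: [set p | p.1 * a' + p.2 * b' == 0] = [set (0 : F * F)].
Proof.
move=> D; apply/setP => -[s t]; rewrite !inE pair_eq0 /=.
apply/andP/andP => [[/eqP E1 /eqP E2]|[/eqP-> /eqP->]]; last by rewrite !mul0r addr0.
split; apply/eqP; apply: (mulIf D); rewrite mul0r.
  by transitivity ((s * a + t * b) * b' - (s * a' + t * b') * b); [ring|rewrite E1 E2 !mul0r subrr].
by transitivity ((s * a' + t * b') * a - (s * a + t * b) * a'); [ring|rewrite E1 E2 !mul0r subrr].
Qed.

Lemma det_neq0_nz (a b a' b' : F) : a * b' - b * a' != 0 ->
  (a != 0) || (b != 0) /\ (a' != 0) || (b' != 0).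
Proof.
move=> D; split; rewrite -negb_and; apply: contra D => /andP[/eqP-> /eqP->];
by rewrite ?mul0r ?mulr0 subrr.
Qed.

(** The two lines share only the origin, whence the 1; it is added on the left to avoid a truncated
    subtraction. *)
Lemma card_lines2 (P : F * F -> bool) (a b a' b' : F) : a * b' - b * a' != 0 ->
  (forall s t, P (s, t) = (s * a + t * b == 0) || (s * a' + t * b' == 0)) ->
  (#|[set p | P p]| + 1 = 2 * q)%N.
Proof.
move=> D H; have [n1 n2] := det_neq0_nz D.
have := cardsUI [set p : F * F | p.1 * a + p.2 * b == 0] [set p | p.1 * a' + p.2 * b' == 0].
rewrite line_cap // cards1 !card_line // => E; rewrite mul2n -addnn -E; congr addn.
by apply: eq_card => -[s t]; rewrite !inE H.
Qed.

Lemma card_lines3 (P : F * F -> bool) (a b a' b' a2 b2 : F) :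
  a * b' - b * a' != 0 -> a * b2 - b * a2 != 0 -> a' * b2 - b' * a2 != 0 ->
  (forall s t, P (s, t) = [|| s * a + t * b == 0, s * a' + t * b' == 0 | s * a2 + t * b2 == 0]) ->
  (#|[set p | P p]| + 2 = 3 * q)%N.
Proof.
move=> D1 D2 D3 H; have [n1 n2] := det_neq0_nz D1; have [_ n3] := det_neq0_nz D2.
set A := [set p : F * F | p.1 * a + p.2 * b == 0].
set B := [set p : F * F | p.1 * a' + p.2 * b' == 0].
set C := [set p : F * F | p.1 * a2 + p.2 * b2 == 0].
have E1 := cardsUI A B; have E2 := cardsUI (A :|: B) C.
have EP : #|[set p | P p]| = #|A :|: B :|: C|.
  by apply: eq_card => -[s t]; rewrite !inE H orbA.
move: E1 E2; rewrite setIUl !line_cap // setUid !cards1 !card_line // EP.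
lia.
Qed.

Lemma card_full (P : F * F -> bool) : (forall s t, P (s, t)) -> #|[set p | P p]| = (q ^ 2)%N.
Proof.
move=> H; rewrite -mulnn -card_prod -[RHS]cardsT; apply: eq_card => -[s t].
by rewrite !inE H.
Qed.

Lemma rank2_pencil_sym3 (a b c d e f a' b' c' d' e' f' s t : F) :
  (\rank (pencil (sym3 a b c d e f) (sym3 a' b' c' d' e' f') (s, t)) <= 2)%N =
  (\det (pencil (sym3 a b c d e f) (sym3 a' b' c' d' e' f') (s, t)) == 0).
Proof. exact: rank_le2. Qed.

Lemma det_pencil_sym3 (a b c d e f a' b' c' d' e' f' s t : F) :
  \det (pencil (sym3 a b c d e f) (sym3 a' b' c' d' e' f') (s, t)) =
  let x1 := s * a + t * a' in let x2 := s * b + t * b' in let x3 := s * c + t * c' in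
  let x4 := s * d + t * d' in let x5 := s * e + t * e' in let x6 := s * f + t * f' in
  x1 * x4 * x6 + 2%:R * x2 * x3 * x5 - x1 * x5 ^+ 2 - x4 * x3 ^+ 2 - x6 * x2 ^+ 2.
Proof. by rewrite /pencil sym3_lin det_sym3. Qed.

Definition multiples (u : 'rV[F]_3) : {set 'rV[F]_3} := [set c *: u | c : F].

Lemma card_multiples (u : 'rV[F]_3) : u != 0 -> #|multiples u| = q.
Proof.
move=> u0; apply: card_imset => c c' /eqP; rewrite -subr_eq0 -scalerBl scaler_eq0.
by rewrite (negPf u0) orbF subr_eq0 => /eqP.
Qed.

Lemma base_scale M N l c : base M N l -> base M N (c *: l).
Proof.
have E X : bform X (c *: l) (c *: l) = c ^+ 2 * bform X l l.
  by rewrite /bform linearZ /= -!scalemxAl -scalemxAr !mxE mulrA expr2.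
by rewrite /base !E => /andP[/eqP-> /eqP->]; rewrite mulr0 eqxx.
Qed.

Lemma base_count_line M N u : u != 0 -> base M N u ->
  (forall l, base M N l -> exists c, l = c *: u) -> base_count M N = q.
Proof.
move=> u0 bu H; rewrite -(card_multiples u0); apply: eq_card => l; rewrite !inE.
apply/idP/imsetP => [/H[c ->]|[c _ ->]]; first by exists c.
exact: base_scale.
Qed.

Lemma card_multiples2 u v : u != 0 -> (forall c, v != c *: u) ->
  (#|multiples u :|: multiples v| + 1 = 2 * q)%N.
Proof.
move=> u0 vu; have v0 : v != 0 by have := vu 0; rewrite scale0r.
rewrite mul2n -addnn -{1}(card_multiples u0) -(card_multiples v0) -cardsUI; congr addn.
apply: etrans (esym (cards1 (0 : 'rV[F]_3))) _; apply: eq_card => l; rewrite !inE.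
apply/eqP/andP => [->|[/imsetP[c _ ->] /imsetP[d _ E]]].
  by split; apply/imsetP; exists 0; rewrite ?scale0r.
have [d0|d0] := eqVneq d 0; first by rewrite E d0 scale0r.
by case/eqP: (vu (c / d)); rewrite mulrC -scalerA E scalerA mulVf // scale1r.
Qed.

Lemma base_count_lines2 M N u v : u != 0 -> (forall c, v != c *: u) -> base M N u -> base M N v ->
  (forall l, base M N l -> exists c, l = c *: u \/ l = c *: v) -> (base_count M N + 1 = 2 * q)%N.
Proof.
move=> u0 vu bu bv H; rewrite -(card_multiples2 u0 vu); congr addn.
apply: eq_card => l; rewrite !inE; apply/idP/orP.
  by case/H => c [->|->]; [left|right]; apply/imsetP; exists c.
by case=> /imsetP[c _ ->]; exact: base_scale.
Qed.

Lemma base_count_gt M N u v : u != 0 -> (forall c, v != c *: u) -> base M N u -> base M N v ->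
  (q < base_count M N)%N.
Proof.
move=> u0 vu bu bv; have E := card_multiples2 u0 vu.
have : (#|multiples u :|: multiples v| <= base_count M N)%N.
  apply: subset_leq_card; apply/subsetP => l; rewrite !inE.
  by case/orP=> /imsetP[c _ ->]; exact: base_scale.
by have := card_ge2 F; move: E; move: #|_ :|: _| (base_count _ _) => *; lia.
Qed.

Lemma base_count_gt1 M N u : u != 0 -> base M N u -> (1 < base_count M N)%N.
Proof.
move=> u0 bu; apply: leq_trans (card_ge2 F) _; rewrite -(card_multiples u0).
apply: subset_leq_card; apply/subsetP => l; rewrite !inE.
by case/imsetP=> [c _ ->]; exact: base_scale.
Qed.

Lemma base_count1 M N : (forall l, base M N l -> l = 0) -> base_count M N = 1%N.
Proof.
move=> H; apply: etrans (cards1 (0 : 'rV[F]_3)); apply: eq_card => l; rewrite !inE.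
by apply/idP/eqP => [/H|->] //; rewrite /base !bform0 eqxx.
Qed.

Lemma base_count_plane M N : (forall x y z, base M N (rv3 x y z) = (z == 0)) ->
  base_count M N = (q ^ 2)%N.
Proof.
move=> H; pose g (p : F * F) := rv3 p.1 p.2 0.
have gi : injective g.
  by move=> [x y] [x' y'] /rowP E; have := E i0; have := E i1; rewrite !mxE /= => -> ->.
rewrite -mulnn -card_prod -(card_codom gi) -[LHS]cardsE; apply: eq_card => l.
rewrite !inE [l]rv3E H; apply/eqP/codomP => [->|[[x y] /rowP /(_ i2)]]; last by rewrite !mxE.
by exists (l 0 i0, l 0 i1).
Qed.

Lemma base_sym3 (a b c d e f a' b' c' d' e' f' x y z : F) :
  base (sym3 a b c d e f) (sym3 a' b' c' d' e' f') (rv3 x y z) =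
  (sbf a b c d e f x y z x y z == 0) && (sbf a' b' c' d' e' f' x y z x y z == 0).
Proof. by rewrite /base !bform_sym3. Qed.

Lemma base_sym3_char2 (a b c d e f a' b' c' d' e' f' x y z : F) : 2%:R = 0 :> F ->
  base (sym3 a b c d e f) (sym3 a' b' c' d' e' f') (rv3 x y z) =
  (a * x ^+ 2 + d * y ^+ 2 + f * z ^+ 2 == 0) && (a' * x ^+ 2 + d' * y ^+ 2 + f' * z ^+ 2 == 0).
Proof.
move=> c2; rewrite base_sym3; have E (a1 b1 c1 d1 e1 f1 : F) :
    sbf a1 b1 c1 d1 e1 f1 x y z x y z = a1 * x ^+ 2 + d1 * y ^+ 2 + f1 * z ^+ 2.
  transitivity (a1 * x ^+ 2 + d1 * y ^+ 2 + f1 * z ^+ 2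
     + 2%:R * (b1 * x * y + c1 * x * z + e1 * y * z)); first by rewrite /sbf; ring.
  by rewrite c2 mul0r addr0.
by rewrite !E.
Qed.

End Invariants.

(* O5 to O9 contain a matrix of rank one.  The G tags have a base point that no
   member kills, and are told apart by the factorization of a binary cubic form;
   the base points of O10 and of the B tags are all killed by some member; O14 and
   O15 have no base point. *)
Variant tag := O5 | O6 | O9 | O8a | O8b | O10 | G0 | Gcube | Gdouble | Gsplit | Gquad | Girr
  | B13 | B16 | B12 | O14 | O15.

(** * The list of normal forms and its completeness *)

Section Tags.

Variable F : finFieldType.
Variables t nu a0 b0 : F.
Hypothesis irt : irr2 t.
Hypothesis nnu : 2%:R != 0 :> F -> nonsq nu.
Hypothesis Eab : 2%:R != 0 :> F -> a0 ^+ 2 - nu * b0 ^+ 2 = nu.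
Implicit Types (M N X A B : 'M[F]_3) (l m k : 'rV[F]_3).
Local Notation q := #|F|.
Local Notation ev := (2%:R = 0 :> F).
Local Notation od := (2%:R != 0 :> F).
Local Notation E00 := (@sym3 F 1 0 0 0 0 0).

(** [no_rank1] is recorded beside the normal form so that the number of members of rank at most one
    can be read off. [Girr] names no particular cubic because [cub_anis_equiv] makes all of them
    equivalent. *)
Definition has_tag (tau : tag) M N : Prop :=
  match tau with
  | O5 => peq M N E00 (sym3 0 0 0 1 0 0)
  | O6 => peq M N E00 (sym3 0 1 0 0 0 0)
  | O9 => peq M N E00 (sym3 0 0 1 1 0 0)
  | O8a => od /\ peq M N E00 (sym3 0 0 0 1 0 (-1)) \/ ev /\ peq M N E00 (sym3 0 0 0 0 1 0)
  | O8b => od /\ peq M N E00 (sym3 0 0 0 1 0 (- nu)) \/ ev /\ peq M N E00 (sym3 0 0 0 1 0 1)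
  | O10 => no_rank1 M N /\ peq M N (sym3 0 0 0 (- t) 1 0) (sym3 0 0 0 (-1) 0 1)
  | G0 => no_rank1 M N /\ Gpeq M N 0 0 0 0
  | Gcube => no_rank1 M N /\ Gpeq M N 1 0 0 0
  | Gdouble => no_rank1 M N /\ Gpeq M N 0 1 0 0
  | Gsplit => no_rank1 M N /\ Gpeq M N 0 1 1 0
  | Gquad => no_rank1 M N /\ Gpeq M N 1 t 1 0
  | Girr => no_rank1 M N /\
      exists g0 g1 g2 g3, Gpeq M N g0 g1 g2 g3 /\ cub_anis g0 g1 g2 g3
  | B13 => no_rank1 M N /\
      (od /\ peq M N (sym3 0 0 0 1 0 (- nu)) (sym3 0 0 1 0 0 0) \/
       ev /\ peq M N (sym3 0 0 0 1 0 1) (sym3 0 0 1 0 0 1))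
  | B16 => no_rank1 M N /\ ev /\ peq M N (sym3 0 0 0 0 1 1) (sym3 0 0 1 1 0 0)
  | B12 => no_rank1 M N /\ ev /\ peq M N (sym3 0 0 0 0 1 0) (sym3 0 0 1 0 0 1)
  | O14 => no_rank1 M N /\ od /\ peq M N (sym3 0 0 0 1 0 (- nu)) (sym3 1 0 0 1 0 nu)
  | O15 => no_rank1 M N /\ od /\
      peq M N (sym3 0 0 0 1 0 (- nu)) (sym3 1 0 0 a0 (nu * b0) (nu * a0))
  end.

Lemma tag_exists M N : M^T = M -> N^T = N -> indep M N -> exists tau, has_tag tau M N.
Proof.
move=> sM sN ind.
have [nr|nr] := boolP (no_rank1 M N); last first.
  have [E|E|E|[d [e [f [D E]]]]] := rank1_cases sM sN ind nr; [by exists O5|by exists O6|by exists O9|].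
  have [c2|c2] := eqVneq (2%:R : F) 0.
    by have [E1|E1] := O8_even c2 D; [exists O8a|exists O8b]; right; split=> //; exact: peq_trans E E1.
  by have [E1|E1] := O8_odd c2 (nnu c2) D; [exists O8a|exists O8b]; left; split=> //; exact: peq_trans E E1.
have [/existsP[k gk]|/existsPn ng] := boolP [exists k, good M N k].
  have [f0 [f1 [f2 [f3 E]]]] := good_G sM sN gk.
  case: (cubic_cases irt E) => [[E1|E1|E1|E1]|[E1|E1]];
    by [exists G0|exists Gcube|exists Gdouble|exists Gsplit|exists Gquad|exists Girr].
have {}ng : no_good M N by apply/forallP.
have [/existsP[k /andP[k0 bk]]|/existsPn nb] := boolP [exists k, (k != 0) && base M N k].
  have /forallPn[p] : ~~ [forall p, (k *m pencil M N p == 0) ==> (p == 0)].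
    by have := forallP ng k; rewrite /good bk.
  rewrite negb_imply => /andP[/eqP kp p0].
  have [E|[g [r [g0 E]]]|[e [f [n [r [e0 E]]]]]] := bad_base_cases irt sM sN k0 bk p0 kp nr.
  - by exists O10.
  - exists B13; split=> //; have [c2|c2] := eqVneq (2%:R : F) 0; [right|left]; split=> //.
      exact: peq_trans E (B13_even c2 g0 (no_good_peq E ng)).
    exact: peq_trans E (B13_odd c2 (nnu c2) g0 (no_good_peq E ng)).
  - have [c2|c2] := eqVneq (2%:R : F) 0; last by case: (B16_odd c2 e0 (no_good_peq E ng)).
    by have [E1|E1] := B16_even c2 e0 (no_good_peq E ng); [exists B16|exists B12];
      split=> //; split=> //; exact: peq_trans E E1.
have {}nb l : base M N l -> l = 0.
  by move=> bl; apply/eqP; apply: contraT => l0; have := nb l; rewrite l0 bl.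
have [c2|c2] := eqVneq (2%:R : F) 0.
  (* In characteristic 2 both quadratic forms are additive. Since F^3 has more elements than F^2,
     two vectors share their values, and their difference is a nonzero base point. *)
  exfalso; have [a [b [c [d [e [f EM]]]]]] := sym3_ex sM.
  have [a' [b' [c' [d' [e' [f' EN]]]]]] := sym3_ex sN.
  pose g (l : 'rV[F]_3) := (a * l 0 i0 ^+ 2 + d * l 0 i1 ^+ 2 + f * l 0 i2 ^+ 2,
    a' * l 0 i0 ^+ 2 + d' * l 0 i1 ^+ 2 + f' * l 0 i2 ^+ 2).
  have : ~~ injectiveb g.
    apply/injectiveP => /leq_card; rewrite card_prod card_mx mul1n.
    have := card_ge2 F; move: #|F| => r; nia.
  case/injectivePn => l [l' ll' [E1 E2]]; case/eqP: ll'; apply/eqP; rewrite -subr_eq0; apply/eqP.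
  apply: nb; rewrite [l - l']rv3E !mxE EM EN base_sym3_char2 //.
  have sub (x y z a1 b1 c1 : F) : a1 * (x - l' 0 i0) ^+ 2 + b1 * (y - l' 0 i1) ^+ 2
      + c1 * (z - l' 0 i2) ^+ 2 = a1 * x ^+ 2 + b1 * y ^+ 2 + c1 * z ^+ 2
      - (a1 * l' 0 i0 ^+ 2 + b1 * l' 0 i1 ^+ 2 + c1 * l' 0 i2 ^+ 2).
    transitivity (a1 * x ^+ 2 + b1 * y ^+ 2 + c1 * z ^+ 2
      - (a1 * l' 0 i0 ^+ 2 + b1 * l' 0 i1 ^+ 2 + c1 * l' 0 i2 ^+ 2)
      + 2%:R * (a1 * (l' 0 i0 ^+ 2 - x * l' 0 i0) + b1 * (l' 0 i1 ^+ 2 - y * l' 0 i1)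
        + c1 * (l' 0 i2 ^+ 2 - z * l' 0 i2))); first by ring.
    by rewrite c2 mul0r addr0.
  by rewrite !sub E1 E2 !subrr eqxx.
have [E|E] := no_base_cases c2 (nnu c2) (Eab c2) sM sN nr nb; by [exists O14|exists O15].
Qed.

Lemma has_tag_peq tau M N M' N' : has_tag tau M N -> has_tag tau M' N' -> peq M N M' N'.
Proof.
have E X Y : peq M N X Y -> peq M' N' X Y -> peq M N M' N'.
  by move=> E1 E2; exact: peq_trans E1 (peq_sym E2).
case: tau => /=; try (by apply: E); try (by case=> _ E1 [_]; apply: E E1);
  try (by case=> _ [_ E1] [_ [_]]; apply: E E1).
- by case=> -[c E1] [] [c']; [apply: E E1|case/eqP: c|case/eqP: c'|apply: E E1].
- by case=> -[c E1] [] [c']; [apply: E E1|case/eqP: c|case/eqP: c'|apply: E E1].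
- case=> _ [f0 [f1 [f2 [f3 [E1 an]]]]] [_ [g0 [g1 [g2 [g3 [E2 an']]]]]].
  have [x [y [z [w [c [D c0 H0 H1 [H2 H3]]]]]]] := cub_anis_equiv an an'.
  exact: E (Gpeq_step E1 D c0 H0 H1 H2 H3) E2.
- by case=> _ + [_]; case=> -[c E1] [] [c']; [apply: E E1|case/eqP: c|case/eqP: c'|apply: E E1].
Qed.

(** [n1], [n2] and [h] stand for [rank_count 1], [rank_count 2] and [base_count]. Only what is
    needed to compare tags is recorded, so some values are merely bounded or left open. *)
Definition tag_spec (tau : tag) (n1 n2 h : nat) : Prop :=
  match tau with
  | O5 => n1 + 1 = 2 * q
  | O6 => n1 = q /\ n2 = q ^ 2
  | O9 => n1 = q /\ n2 = q
  | O8a => [/\ n1 = q, n2 + 1 = 2 * q & (od -> 1 < h) /\ (ev -> h = q ^ 2)]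
  | O8b => [/\ n1 = q, n2 + 1 = 2 * q & (od -> h = 1) /\ (ev -> h = q)]
  | O10 => [/\ n1 = 1, n2 = q ^ 2 & h = q]
  | G0 => [/\ n1 = 1, n2 = q ^ 2 & q < h /\ (ev -> h = q ^ 3)]
  | Gcube => [/\ n1 = 1, n2 = q & (od -> h + 1 = 2 * q) /\ (ev -> h = q ^ 2)]
  | Gdouble => [/\ n1 = 1, n2 + 1 = 2 * q & q < h]
  | Gsplit => [/\ n1 = 1, n2 + 2 = 3 * q & (od -> 1 < h) /\ (ev -> h = q)]
  | Gquad => [/\ n1 = 1, n2 = q & (od -> h + 1 = 2 * q) /\ (ev -> h = q)]
  | Girr => n1 = 1 /\ n2 = 1
  | B13 => [/\ n1 = 1, n2 + 1 = 2 * q & h = q]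
  | B16 => ev /\ [/\ n1 = 1, n2 = q & h = q]
  | B12 => ev /\ [/\ n1 = 1, n2 = q ^ 2 & h = q ^ 2]
  | O14 => od /\ [/\ n1 = 1, n2 + 2 = 3 * q & h = 1]
  | O15 => od /\ [/\ n1 = 1, n2 = q & h = 1]
  end%N.

Lemma no_rank1_count M N : no_rank1 M N -> rank_count 1 M N = 1%N.
Proof.
move=> nr; apply: etrans (cards1 (0 : F * F)); apply: eq_card => p; rewrite !inE.
apply/idP/eqP => [r1|->]; last by rewrite /pencil !scale0r addr0 mxrank0.
by apply/eqP; exact: (implyP (forallP nr p)).
Qed.

Lemma irr_char2_neq0 : ev -> t != 0.
Proof.
move=> c2; apply/eqP => t0; case/eqP: (irt 1).
by rewrite t0 -[RHS]c2; ring.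
Qed.

Lemma ns0 : od -> nu != 0.
Proof. by move=> /nnu /(_ 0); rewrite expr0n /= eq_sym. Qed.

Lemma spec_O5 : (rank_count 1 E00 (sym3 0 0 0 1 0 0) + 1 = 2 * q)%N.
Proof.
apply: (@card_lines2 F _ 1 0 0 1); first by rewrite mulr1 mulr0 subr0 oner_neq0.
move=> s u; rewrite /pencil sym3_lin /= ?(mulr0, mulr1, addr0, add0r).
apply/idP/orP => [/rank_sym3_le1P[[/eqP + _ _] _]|].
  by rewrite expr0n mulf_eq0 => /orP.
by case=> /eqP ->; apply: rank_sym3_le1; split; ring.
Qed.

Lemma n1_line N : (forall s u, (\rank (pencil E00 N (s, u)) <= 1)%N -> u = 0) ->
  rank_count 1 E00 N = q.
Proof.
move=> H; apply: (@card_lineE F _ 0 1); first by rewrite oner_neq0 orbT.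
move=> s u; rewrite mulr0 mulr1 add0r; apply/idP/eqP => [/H //|->].
rewrite /pencil scale0r addr0 /=; apply: leq_trans (mxrank_scale _ _) _.
by apply: rank_sym3_le1; split; ring.
Qed.

Lemma spec_O6 : rank_count 1 E00 (sym3 0 1 0 0 0 0) = q /\
  rank_count 2 E00 (sym3 0 1 0 0 0 0) = (q ^ 2)%N.
Proof.
split.
  apply: n1_line => s u; rewrite /pencil sym3_lin => /rank_sym3_le1P[[+ _ _] _].
  rewrite /= ?(mulr0, mulr1, addr0, add0r) => /esym/eqP; by rewrite sqrf_eq0 => /eqP.
apply: card_full => s u; rewrite rank2_pencil_sym3 det_pencil_sym3 /=; apply/eqP; ring.
Qed.

Lemma spec_O9 : rank_count 1 E00 (sym3 0 0 1 1 0 0) = q /\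
  rank_count 2 E00 (sym3 0 0 1 1 0 0) = q.
Proof.
split.
  apply: n1_line => s u; rewrite /pencil sym3_lin => /rank_sym3_le1P[[_ + _] _].
  rewrite /= ?(mulr0, mulr1, addr0, add0r) => /esym/eqP; by rewrite sqrf_eq0 => /eqP.
apply: (@card_lineE F _ 0 1); first by rewrite oner_neq0 orbT.
move=> s u; rewrite (_ : s * 0 + u * 1 = u) ?rank2_pencil_sym3 ?det_pencil_sym3 /=; last by ring.
rewrite (_ : _ - _ = - u ^+ 3); last by ring.
by rewrite oppr_eq0 expf_eq0.
Qed.

Lemma spec_O8 (d e f : F) : d * f - e ^+ 2 != 0 ->
  rank_count 1 E00 (sym3 0 0 0 d e f) = q /\
  (rank_count 2 E00 (sym3 0 0 0 d e f) + 1 = 2 * q)%N.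
Proof.
move=> D; split.
  apply: n1_line => s u; rewrite /pencil sym3_lin => /rank_sym3_le1P[[_ _ +] _].
  rewrite /= ?(mulr0, mulr1, addr0, add0r) => E; apply/eqP; rewrite -sqrf_eq0.
  rewrite -(mulIr_eq0 _ (mulIf D)) mulrBr; apply/eqP.
  transitivity (u * d * (u * f) - (u * e) ^+ 2); first by ring.
  by rewrite E subrr.
apply: (@card_lines2 F _ 1 0 0 1); first by rewrite mulr1 mulr0 subr0 oner_neq0.
move=> s u; rewrite rank2_pencil_sym3 det_pencil_sym3 /= ?(mulr0, mulr1, addr0, add0r).
rewrite (_ : _ - _ = s * u ^+ 2 * (d * f - e ^+ 2)); last by ring.
by rewrite !mulf_eq0 (negPf D) orbF orbb.
Qed.

Lemma base_O8 (g x y z : F) :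
  base E00 (sym3 0 0 0 1 0 g) (rv3 x y z) = (x == 0) && (y ^+ 2 + g * z ^+ 2 == 0).
Proof.
rewrite base_sym3 (_ : sbf _ _ _ _ _ _ _ _ _ _ _ _ = x ^+ 2); last by rewrite /sbf; ring.
rewrite sqrf_eq0; congr (_ && (_ == 0)); rewrite /sbf; ring.
Qed.

Lemma spec_O8a_base : (od -> 1 < base_count E00 (sym3 0 0 0 1 0 (-1)))%N /\
  (ev -> base_count E00 (sym3 0 0 0 0 1 0) = q ^ 2)%N.
Proof.
split=> c2.
  apply: (@base_count_gt1 _ _ _ (rv3 0 1 1)); first by rewrite rv3_eq0 oner_eq0 !andbF.
  by rewrite base_O8 eqxx; apply/eqP; ring.
have E : peq E00 (sym3 0 0 0 0 1 0) (sym3 0 0 0 0 0 1) (sym3 0 1 0 0 0 0).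
  exact: peq_trans (peq_swap01 _ _ _ _ _ _ _ _ _ _ _ _) (peq_swap12 _ _ _ _ _ _ _ _ _ _ _ _).
rewrite (base_count_peq E); apply: base_count_plane => x y z; rewrite base_sym3_char2 //.
by rewrite !(mul0r, mul1r, addr0, add0r) eqxx andbT sqrf_eq0.
Qed.

Lemma nonsq_aniso (y z : F) : od -> y ^+ 2 + - nu * z ^+ 2 = 0 -> y = 0 /\ z = 0.
Proof.
move=> c2 E; have [z0|z0] := eqVneq z 0.
  by move/eqP: E; rewrite z0 expr0n mulr0 addr0 sqrf_eq0 => /eqP.
case/eqP: (nnu c2 (y / z)); rewrite expr_div_n; apply: (mulIf (expf_neq0 2 z0)).
by rewrite divfK ?expf_neq0 //; apply/eqP; rewrite -subr_eq0 -mulNr E.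
Qed.

Lemma spec_O8b_base : (od -> base_count E00 (sym3 0 0 0 1 0 (- nu)) = 1)%N /\
  (ev -> base_count E00 (sym3 0 0 0 1 0 1) = q).
Proof.
split=> c2.
  apply: base_count1 => l; rewrite [l]rv3E base_O8 => /andP[/eqP-> /eqP /(nonsq_aniso c2)[-> ->]].
  by apply/eqP; rewrite rv3_eq0 eqxx.
have one : - 1 = 1 :> F by apply/eqP; rewrite eq_sym -subr_eq0 opprK -[X in _ == X]c2; apply/eqP; ring.
apply: (@base_count_line _ _ _ (rv3 0 1 1)).
- by rewrite rv3_eq0 oner_eq0 !andbF.
- by rewrite base_O8 eqxx /=; apply/eqP; rewrite -[RHS]c2; ring.
move=> l; rewrite [l]rv3E base_sym3_char2 // !(mul0r, mul1r, addr0, add0r).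
case/andP; rewrite sqrf_eq0 => /eqP-> /eqP E; exists (l 0 i1).
have -> : l 0 i2 = l 0 i1.
  apply/eqP; rewrite -subr_eq0 -sqrf_eq0; apply/eqP.
  transitivity (l 0 i1 ^+ 2 + l 0 i2 ^+ 2 - 2%:R * (l 0 i1 * l 0 i2)); first by ring.
  by rewrite E c2 mul0r subr0.
by apply/rowP; elim/ord3P; rewrite !mxE /= ?mulr0 ?mulr1.
Qed.

End Tags.

(** * Values of the three counts on the normal forms *)

Section Specs.

Variable F : finFieldType.
Variables t nu a0 b0 : F.
Hypothesis irt : irr2 t.
Hypothesis nnu : 2%:R != 0 :> F -> nonsq nu.
Hypothesis Eab : 2%:R != 0 :> F -> a0 ^+ 2 - nu * b0 ^+ 2 = nu.
Implicit Types (M N X A B : 'M[F]_3) (l m k : 'rV[F]_3).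
Local Notation q := #|F|.
Local Notation ev := (2%:R = 0 :> F).
Local Notation od := (2%:R != 0 :> F).
Local Notation S := (@sym3 F).

Ltac simp := rewrite /= ?(mulr0, mul0r, mulr1, mul1r, addr0, add0r, subr0, expr0n).
Ltac baseok := rewrite base_sym3; apply/andP; split; apply/eqP; rewrite /sbf; ring.

Lemma e0_neq0 : rv3 1 0 0 != 0 :> 'rV[F]_3.
Proof. by rewrite rv3_eq0 oner_eq0. Qed.

Lemma e0_axis (x y z : F) : y = 0 -> z = 0 -> rv3 x y z = x *: rv3 1 0 0.
Proof. by move=> -> ->; apply/rowP; elim/ord3P; rewrite !mxE /= ?mulr0 ?mulr1. Qed.

Lemma base_count_e0 M N : base M N (rv3 1 0 0) ->
  (forall x y z, base M N (rv3 x y z) -> y = 0 /\ z = 0) -> base_count M N = q.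
Proof.
move=> b H; apply: (base_count_line e0_neq0 b) => l; rewrite [l]rv3E => /H[-> ->].
by exists (l 0 i0); exact: e0_axis.
Qed.

Lemma n2_full a b c d e f a' b' c' d' e' f' :
  (forall s u, \det (pencil (S a b c d e f) (S a' b' c' d' e' f') (s, u)) = 0) ->
  rank_count 2 (S a b c d e f) (S a' b' c' d' e' f') = (q ^ 2)%N.
Proof. by move=> H; apply: card_full => s u; rewrite rank2_pencil_sym3 H. Qed.

Lemma n2_line x y a b c d e f a' b' c' d' e' f' : (x != 0) || (y != 0) ->
  (forall s u, (\det (pencil (S a b c d e f) (S a' b' c' d' e' f') (s, u)) == 0) =
     (s * x + u * y == 0)) ->
  rank_count 2 (S a b c d e f) (S a' b' c' d' e' f') = q.
Proof. by move=> nz H; apply: (card_lineE nz) => s u; rewrite rank2_pencil_sym3 H. Qed.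

Lemma n2_axes a b c d e f a' b' c' d' e' f' :
  (forall s u, (\det (pencil (S a b c d e f) (S a' b' c' d' e' f') (s, u)) == 0) =
     (s == 0) || (u == 0)) ->
  (rank_count 2 (S a b c d e f) (S a' b' c' d' e' f') + 1 = 2 * q)%N.
Proof.
move=> H; apply: (@card_lines2 F _ 1 0 0 1); first by rewrite mulr1 mulr0 subr0 oner_neq0.
by move=> s u; rewrite rank2_pencil_sym3 H; simp.
Qed.

Lemma irr2_hom (x y : F) : x ^+ 2 + t * x * y + y ^+ 2 = 0 -> x = 0 /\ y = 0.
Proof.
move=> E; have [y0|y0] := eqVneq y 0.
  by move/eqP: E; rewrite y0 mulr0 expr0n !addr0 sqrf_eq0 => /eqP.
case/eqP: (irt (x / y)); apply: (mulIf (expf_neq0 2 y0)).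
by rewrite mul0r -[RHS]E; field.
Qed.

Lemma spec_O10 : rank_count 2 (S 0 0 0 (- t) 1 0) (S 0 0 0 (-1) 0 1) = (q ^ 2)%N /\
  base_count (S 0 0 0 (- t) 1 0) (S 0 0 0 (-1) 0 1) = q.
Proof.
split; first by apply: n2_full => s u; rewrite det_pencil_sym3 /=; ring.
apply: base_count_e0 => [|x y z]; first by baseok.
rewrite base_sym3 /sbf => /andP[/eqP E1 /eqP E2].
have E3 : z ^+ 2 = y ^+ 2.
  by apply/eqP; rewrite -subr_eq0; apply/eqP; rewrite -[RHS]E2; ring.
have E4 : y * (2%:R * z - t * y) = 0 by rewrite -[RHS]E1; ring.
have [y0|y0] := eqVneq y 0.
  by split=> //; apply/eqP; rewrite -sqrf_eq0 E3 y0 expr0n.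
move/eqP: E4; rewrite mulf_eq0 (negPf y0) subr_eq0 => /eqP E4.
(* From z^2 = y^2 and 2 z = t y, the pair (- z, y) is a zero of the irreducible form. *)
have [|/eqP] := @irr2_hom (- z) y; last by rewrite oppr_eq0 => /eqP-> y00; rewrite y00 eqxx in y0.
transitivity (z ^+ 2 - z * (t * y) + y ^+ 2); first by ring.
by rewrite -E4 -E3; ring.
Qed.

Lemma spec_G0 : rank_count 2 (S 0 1 0 0 0 0) (S 0 0 1 0 0 0) = (q ^ 2)%N /\
  ((q < base_count (S 0 1 0 0 0 0) (S 0 0 1 0 0 0)) /\
  (ev -> base_count (S 0 1 0 0 0 0) (S 0 0 1 0 0 0) = q ^ 3))%N.
Proof.
split; first by apply: n2_full => s u; rewrite det_pencil_sym3 /=; ring.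
split=> [|c2].
  apply: (@base_count_gt _ _ _ (rv3 0 1 0) (rv3 0 0 1)); rewrite ?rv3_eq0 ?oner_eq0 ?andbF //; try baseok.
  by move=> c; apply/eqP => /rowP /(_ i2); rewrite !mxE /= mulr0 => /eqP; rewrite oner_eq0.
rewrite -[3%N]/(1 * 3)%N -card_mx; apply: eq_card => l; rewrite !inE [l]rv3E base_sym3_char2 //.
by simp; rewrite eqxx.
Qed.

Lemma spec_Gcube : rank_count 2 (S 0 1 0 0 0 1) (S 0 0 1 0 0 0) = q /\
  ((od -> base_count (S 0 1 0 0 0 1) (S 0 0 1 0 0 0) + 1 = 2 * q) /\
  (ev -> base_count (S 0 1 0 0 0 1) (S 0 0 1 0 0 0) = q ^ 2))%N.
Proof.
split.
  apply: (@n2_line 1 0); rewrite ?oner_neq0 // => s u; rewrite det_pencil_sym3 /=.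
  by rewrite (_ : _ - _ = - s ^+ 3); [simp; rewrite oppr_eq0 expf_eq0|ring].
split=> c2.
  apply: (@base_count_lines2 _ _ _ (rv3 1 0 0) (rv3 0 1 0)); rewrite ?e0_neq0 //; try baseok.
    by move=> c; apply/eqP => /rowP /(_ i1); rewrite !mxE /= mulr0 => /eqP; rewrite oner_eq0.
  move=> l; rewrite [l]rv3E; move: (l 0 i0) (l 0 i1) (l 0 i2) => x y z.
  rewrite base_sym3 /sbf => /andP[/eqP E1 /eqP E2].
  have {}E1 : 2%:R * x * y + z ^+ 2 = 0 by rewrite -[RHS]E1; ring.
  have {E2} /eqP : 2%:R * (x * z) = 0 by rewrite -[RHS]E2; ring.
  rewrite !mulf_eq0 (negPf c2) /= => /orP[]/eqP.
    move=> x0; exists y; right.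
    have z0 : z = 0 by apply/eqP; move/eqP: E1; rewrite x0 mulr0 mul0r add0r sqrf_eq0.
    by rewrite x0 z0; apply/rowP; elim/ord3P; rewrite !mxE /= ?mulr0 ?mulr1.
  move=> z0; move/eqP: E1; rewrite z0 expr0n addr0 !mulf_eq0 (negPf c2) /= => /orP[]/eqP H.
    by exists y; right; rewrite H; apply/rowP; elim/ord3P; rewrite !mxE /= ?mulr0 ?mulr1.
  by exists x; left; exact: e0_axis.
apply: base_count_plane => x y z; rewrite base_sym3_char2 //.
by simp; rewrite eqxx andbT sqrf_eq0.
Qed.

Lemma spec_Gdouble : (rank_count 2 (S 0 1 0 0 0 0) (S 0 0 1 0 0 1) + 1 = 2 * q)%N /\
  (q < base_count (S 0 1 0 0 0 0) (S 0 0 1 0 0 1))%N.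
Proof.
split.
  apply: n2_axes => s u; rewrite det_pencil_sym3 /= (_ : _ - _ = - (s ^+ 2 * u)); last by ring.
  by rewrite oppr_eq0 mulf_eq0 expf_eq0.
apply: (@base_count_gt _ _ _ (rv3 1 0 0) (rv3 0 1 0)); rewrite ?e0_neq0 //; try baseok.
by move=> c; apply/eqP => /rowP /(_ i1); rewrite !mxE /= mulr0 => /eqP; rewrite oner_eq0.
Qed.

Lemma spec_Gsplit : (rank_count 2 (S 0 1 0 1 0 0) (S 0 0 1 0 0 1) + 2 = 3 * q)%N /\
  ((od -> 1 < base_count (S 0 1 0 1 0 0) (S 0 0 1 0 0 1)) /\
   (ev -> base_count (S 0 1 0 1 0 0) (S 0 0 1 0 0 1) = q))%N.
Proof.
split.
  apply: (@card_lines3 F _ 1 0 0 1 1 1); try by rewrite (_ : _ - _ = 1) ?oner_neq0 //; ring.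
    by rewrite (_ : _ - _ = -1) ?oppr_eq0 ?oner_neq0 //; ring.
  move=> s u; rewrite rank2_pencil_sym3 det_pencil_sym3 /=.
  rewrite (_ : _ - _ = - (s * (u * (s + u)))); last by ring.
  by simp; rewrite oppr_eq0 !mulf_eq0.
split=> c2; first by apply: (base_count_gt1 e0_neq0); baseok.
apply: base_count_e0 => [|x y z]; first by baseok.
by rewrite base_sym3_char2 //; simp; rewrite !sqrf_eq0 => /andP[/eqP-> /eqP->].
Qed.

Lemma spec_Gquad : rank_count 2 (S 0 1 0 1 0 1) (S 0 0 1 0 0 t) = q /\
  ((od -> base_count (S 0 1 0 1 0 1) (S 0 0 1 0 0 t) + 1 = 2 * q) /\
  (ev -> base_count (S 0 1 0 1 0 1) (S 0 0 1 0 0 t) = q))%N.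
Proof.
split.
  apply: (@n2_line 1 0); rewrite ?oner_neq0 // => s u; rewrite det_pencil_sym3 /=.
  rewrite (_ : _ - _ = - (s * (s ^+ 2 + t * s * u + u ^+ 2))); last by ring.
  simp; rewrite oppr_eq0 mulf_eq0; apply/orP/idP => [[//|/eqP/irr2_hom[-> _]]|->]; last by left.
  by rewrite eqxx.
split=> c2.
  (* For odd q the base points have z = 0, and y (2 x + y) = 0 leaves these two. *)
  apply: (@base_count_lines2 _ _ _ (rv3 1 0 0) (rv3 1 (- 2%:R) 0)); rewrite ?e0_neq0 //; try baseok.
    by move=> c; apply/eqP => /rowP /(_ i1); rewrite !mxE /= mulr0 => /eqP; rewrite oppr_eq0 (negPf c2).
  move=> l; rewrite [l]rv3E; move: (l 0 i0) (l 0 i1) (l 0 i2) => x y z.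
  rewrite base_sym3 /sbf => /andP[/eqP E1 /eqP E2].
  have {}E1 : 2%:R * x * y + y ^+ 2 + z ^+ 2 = 0 by rewrite -[RHS]E1; ring.
  have {E2} /eqP : z * (2%:R * x + t * z) = 0 by rewrite -[RHS]E2; ring.
  rewrite mulf_eq0; have [z0 _|z0 /= /eqP E2] := eqVneq z 0; last first.
    (* For z nonzero, 2 x = - t z turns the first equation into the irreducible form at (- y, z). *)
    have [|_ z00] := @irr2_hom (- y) z; last by rewrite z00 eqxx in z0.
    transitivity (2%:R * x * y + y ^+ 2 + z ^+ 2 - (2%:R * x + t * z) * y); first by ring.
    by rewrite E1 E2 mul0r subr0.
  have /eqP : y * (2%:R * x + y) = 0 by rewrite -[RHS]E1 z0; ring.
  rewrite mulf_eq0 => /orP[/eqP y0|/eqP E3]; exists x; [left; exact: e0_axis|right].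
  have -> : y = - (2%:R * x) by apply/eqP; rewrite -addr_eq0 addrC E3.
  by rewrite z0; apply/rowP; elim/ord3P; rewrite !mxE /=; ring.
apply: base_count_e0 => [|x y z]; first by baseok.
rewrite base_sym3_char2 //; simp => /andP[/eqP E1].
rewrite mulf_eq0 (negPf (irr_char2_neq0 irt c2)) sqrf_eq0 => /eqP z0.
by split=> //; apply/eqP; move/eqP: E1; rewrite z0 expr0n addr0 sqrf_eq0.
Qed.

Lemma spec_Girr g0 g1 g2 g3 : cub_anis g0 g1 g2 g3 ->
  rank_count 2 (S 0 1 0 g2 0 g0) (S 0 0 1 g3 0 g1) = 1%N.
Proof.
move=> an; apply: etrans (cards1 (0 : F * F)); apply: eq_card => -[s u].
rewrite !inE rank2_pencil_sym3 det_pencil_sym3 /= pair_eq0.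
rewrite (_ : _ - _ = - cub g0 g1 g2 g3 s u); last by rewrite /cub; ring.
rewrite oppr_eq0; apply/eqP/andP => [/an[-> ->]|[/eqP-> /eqP->]]; first by rewrite eqxx.
by rewrite /cub; ring.
Qed.

Lemma spec_B13 :
  (od -> (rank_count 2 (S 0 0 0 1 0 (- nu)) (S 0 0 1 0 0 0) + 1 = 2 * q)%N /\
         base_count (S 0 0 0 1 0 (- nu)) (S 0 0 1 0 0 0) = q) /\
  (ev -> (rank_count 2 (S 0 0 0 1 0 1) (S 0 0 1 0 0 1) + 1 = 2 * q)%N /\
         base_count (S 0 0 0 1 0 1) (S 0 0 1 0 0 1) = q).
Proof.
split=> c2; split.
- apply: n2_axes => s u; rewrite det_pencil_sym3 /= (_ : _ - _ = - (s * u ^+ 2)); last by ring.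
  by rewrite oppr_eq0 mulf_eq0 expf_eq0.
- apply: base_count_e0 => [|x y z]; first by baseok.
  rewrite base_sym3 /sbf => /andP[/eqP E _]; apply: (nonsq_aniso nnu c2).
  by rewrite -[RHS]E; ring.
- apply: n2_axes => s u; rewrite det_pencil_sym3 /= (_ : _ - _ = - (s * u ^+ 2)); last by ring.
  by rewrite oppr_eq0 mulf_eq0 expf_eq0.
- apply: base_count_e0 => [|x y z]; first by baseok.
  rewrite base_sym3_char2 //; simp => /andP[/eqP E1]; rewrite sqrf_eq0 => /eqP z0.
  by split=> //; apply/eqP; move/eqP: E1; rewrite z0 expr0n addr0 sqrf_eq0.
Qed.

Lemma spec_B16 : ev -> rank_count 2 (S 0 0 0 0 1 1) (S 0 0 1 1 0 0) = q /\
  base_count (S 0 0 0 0 1 1) (S 0 0 1 1 0 0) = q.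
Proof.
move=> c2; split.
  apply: (@n2_line 0 1); rewrite ?oner_neq0 ?orbT // => s u; rewrite det_pencil_sym3 /=.
  by rewrite (_ : _ - _ = - u ^+ 3); [simp; rewrite oppr_eq0 expf_eq0|ring].
apply: base_count_e0 => [|x y z]; first by baseok.
by rewrite base_sym3_char2 //; simp; rewrite !sqrf_eq0 => /andP[/eqP-> /eqP->].
Qed.

Lemma spec_B12 : ev -> rank_count 2 (S 0 0 0 0 1 0) (S 0 0 1 0 0 1) = (q ^ 2)%N /\
  base_count (S 0 0 0 0 1 0) (S 0 0 1 0 0 1) = (q ^ 2)%N.
Proof.
move=> c2; split; first by apply: n2_full => s u; rewrite det_pencil_sym3 /=; ring.
apply: base_count_plane => x y z; rewrite base_sym3_char2 //.
by simp; rewrite eqxx sqrf_eq0.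
Qed.

Lemma spec_twist_base a b : od -> base_count (S 0 0 0 1 0 (- nu)) (S 1 0 0 a b (nu * a)) = 1%N.
Proof.
move=> c2; apply: base_count1 => l; rewrite [l]rv3E base_sym3 /sbf => /andP[/eqP E1 /eqP E2].
have [|y0 z0] := nonsq_aniso nnu c2 (y := l 0 i1) (z := l 0 i2); first by rewrite -[RHS]E1; ring.
apply/eqP; rewrite rv3_eq0 y0 z0 eqxx !andbT -sqrf_eq0 -[X in _ == X]E2 y0 z0; apply/eqP; ring.
Qed.

(** The determinant of the member (s, u) is nu u (u + s) (u - s), with three distinct factors since
    2 is nonzero. *)
Lemma spec_O14 : od -> (rank_count 2 (S 0 0 0 1 0 (- nu)) (S 1 0 0 1 0 nu) + 2 = 3 * q)%N.
Proof.
move=> c2; have nu0 := ns0 nnu c2.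
apply: (@card_lines3 F _ 0 1 1 1 (-1) 1); try by rewrite (_ : _ - _ = -1) ?oppr_eq0 ?oner_neq0 //; ring.
- by rewrite (_ : _ - _ = 1) ?oner_neq0 //; ring.
- by rewrite (_ : _ - _ = 2%:R) //; ring.
move=> s u; rewrite rank2_pencil_sym3 det_pencil_sym3 /=.
rewrite (_ : _ - _ = nu * (u * ((s + u) * (- s + u)))); last by ring.
by simp; rewrite mulrN1 !mulf_eq0 (negPf nu0).
Qed.

(** The determinant of the member (s, u) is - nu u (s^2 - nu u^2): by [Eab] the norm of the
    parameter a0 + b0 th is nu, and the quadratic factor is anisotropic. *)
Lemma spec_O15 : od ->
  rank_count 2 (S 0 0 0 1 0 (- nu)) (S 1 0 0 a0 (nu * b0) (nu * a0)) = q.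
Proof.
move=> c2; have nu0 := ns0 nnu c2.
apply: (@n2_line 0 1); rewrite ?oner_neq0 ?orbT // => s u; rewrite det_pencil_sym3 /=.
rewrite (_ : _ - _ = - nu * (u * (s ^+ 2 - (a0 ^+ 2 - nu * b0 ^+ 2) * u ^+ 2))); last by ring.
rewrite Eab //; simp; rewrite !mulf_eq0 oppr_eq0 (negPf nu0) /=.
apply/orP/idP => [[//|/eqP E]|->]; last by left.
by have [|_ ->] := nonsq_aniso nnu c2 (y := s) (z := u); rewrite ?mulNr ?eqxx.
Qed.

End Specs.

(** * Comparison of the counts of different normal forms *)

Section TagSpec.

Variable F : finFieldType.
Variables t nu a0 b0 : F.
Hypothesis irt : irr2 t.
Hypothesis nnu : 2%:R != 0 :> F -> nonsq nu.
Hypothesis Eab : 2%:R != 0 :> F -> a0 ^+ 2 - nu * b0 ^+ 2 = nu.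
Local Notation q := #|F|.
Local Notation ev := (2%:R = 0 :> F).
Local Notation od := (2%:R != 0 :> F).

Lemma has_tag_spec tau (M N : 'M[F]_3) : has_tag t nu a0 b0 tau M N ->
  @tag_spec F tau (rank_count 1 M N) (rank_count 2 M N) (base_count M N).
Proof.
have nu0 := ns0 nnu.
have eo : ev -> od -> False by move=> -> /eqP.
case: tau => /=.
- by move=> E; rewrite (rank_count_peq 1 E) spec_O5.
- by move=> E; rewrite !(rank_count_peq _ E); exact: spec_O6.
- by move=> E; rewrite !(rank_count_peq _ E); exact: spec_O9.
- case=> -[c E]; rewrite !(rank_count_peq _ E) (base_count_peq E).
    have [|-> H] := @spec_O8 F 1 0 (-1).
      by rewrite mul1r expr0n subr0 oppr_eq0 oner_eq0.
    by split=> //; split=> [|/eo/(_ c)//]; exact: (spec_O8a_base F).1.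
  have [|-> H] := @spec_O8 F 0 1 0.
    by rewrite mul0r expr1n sub0r oppr_eq0 oner_eq0.
  by split=> //; split=> [/(eo c)//|]; exact: (spec_O8a_base F).2.
- case=> -[c E]; rewrite !(rank_count_peq _ E) (base_count_peq E).
    have [|-> H] := @spec_O8 F 1 0 (- nu).
      by rewrite mul1r expr0n subr0 oppr_eq0 nu0.
    by split=> //; split=> [|/eo/(_ c)//]; exact: (spec_O8b_base nnu).1.
  have [|-> H] := @spec_O8 F 1 0 1.
    by rewrite mul1r expr0n subr0 oner_eq0.
  by split=> //; split=> [/(eo c)//|]; exact: (spec_O8b_base nnu).2.
- case=> /no_rank1_count -> E; rewrite (rank_count_peq _ E) (base_count_peq E).
  by have [-> ->] := spec_O10 irt.
- case=> /no_rank1_count -> E; rewrite (rank_count_peq _ E) (base_count_peq E).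
  by have [-> H] := spec_G0 F.
- case=> /no_rank1_count -> E; rewrite (rank_count_peq _ E) (base_count_peq E).
  by have [-> H] := spec_Gcube F.
- case=> /no_rank1_count -> E; rewrite (rank_count_peq _ E) (base_count_peq E).
  by have [? ?] := spec_Gdouble F.
- case=> /no_rank1_count -> E; rewrite (rank_count_peq _ E) (base_count_peq E).
  by have [? ?] := spec_Gsplit F.
- case=> /no_rank1_count -> E; rewrite (rank_count_peq _ E) (base_count_peq E).
  by have [? ?] := spec_Gquad irt.
- case=> /no_rank1_count -> [g0 [g1 [g2 [g3 [E an]]]]].
  by rewrite (rank_count_peq _ E) (spec_Girr an).
- case=> /no_rank1_count ->; have [H1 H2] := spec_B13 nnu.
  case=> -[c E]; rewrite (rank_count_peq _ E) (base_count_peq E).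
    by have [? ?] := H1 c.
  by have [? ?] := H2 c.
- case=> /no_rank1_count -> [c E]; rewrite (rank_count_peq _ E) (base_count_peq E).
  by have [-> ->] := spec_B16 c.
- case=> /no_rank1_count -> [c E]; rewrite (rank_count_peq _ E) (base_count_peq E).
  by have [-> ->] := spec_B12 c.
- case=> /no_rank1_count -> [c E]; rewrite (rank_count_peq _ E) (base_count_peq E).
  by have := spec_O14 nnu c; have := spec_twist_base nnu 1 0 c; rewrite mulr1 => ->.
- case=> /no_rank1_count -> [c E]; rewrite (rank_count_peq _ E) (base_count_peq E).
  by rewrite (spec_O15 nnu Eab c) (spec_twist_base nnu _ _ c).
Qed.

(** With q^2 and q^3 replaced by unknowns bounded below by multiples of q, each pair of tags is a
    problem of linear arithmetic. The last alternative is the coincidence of [O10] and [Gsplit] over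
    F_2. *)
Lemma tag_spec_unique tau tau' n1 n2 h :
  @tag_spec F tau n1 n2 h -> @tag_spec F tau' n1 n2 h ->
  [\/ tau = tau',
      od /\ (tau = Gcube /\ tau' = Gquad \/ tau = Gquad /\ tau' = Gcube),
      ev /\ (tau = B16 /\ tau' = Gquad \/ tau = Gquad /\ tau' = B16)
    | q = 2%N /\ [/\ n1 = 1, n2 = 4 & h = 2]%N].
Proof.
clear nnu Eab.
have q2 := card_ge2 F.
have sq : (q ^ 2 = q * q)%N by rewrite mulnn.
have cu : (q ^ 3 = q * (q * q))%N by rewrite expnS mulnn.
have b1 : (2 * q <= q * q)%N by rewrite leq_mul2r q2 orbT.
have b2 : (2 * (q * q) <= q * (q * q))%N by rewrite leq_mul2r q2 orbT.
have [c|c] : ev \/ od by have [->|] := eqVneq (2%:R : F) 0; [left|right].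
  (* The bound 3 q <= q^2 fails only for q = 2, which therefore stays as a separate possibility. *)
  have b3 : (q = 2 /\ q * q = 4 \/ 3 * q <= q * q)%N.
    by have [h3|h3] := leqP 3 q; [right; rewrite leq_mul2r h3 orbT|left; have -> : q = 2%N by lia].
  have K : ~ od by rewrite c eqxx.
  rewrite /tag_spec sq cu; move: b1 b2 b3 {sq cu}.
  move: (q * (q * q))%N (q * q)%N => C Q; move: q q2 => r q2 b1 b2 b3.
  case: tau; case: tau'; intros; repeat match goal with
    | H : _ /\ _ |- _ => destruct H
    | H : and3 _ _ _ |- _ => destruct H
    | H : _ -> _ |- _ => first [specialize (H c) | clear H] end;
  try (by case: K);
  first [ by constructor 1 | by exfalso; clear c K; lia
        | by constructor 3; split=> //; auto | by constructor 4; clear c K; split; [lia|split; lia] ].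
have b3 : (3 * q <= q * q)%N by rewrite leq_mul2r (card_odd_ge3 c) orbT.
have q3 := card_odd_ge3 c.
have K : ~ ev by move=> E; rewrite E eqxx in c.
rewrite /tag_spec sq cu; move: b1 b2 b3 {sq cu}.
move: (q * (q * q))%N (q * q)%N => C Q; move: q q2 q3 => r q2 q3 b1 b2 b3.
case: tau; case: tau'; intros; repeat match goal with
  | H : _ /\ _ |- _ => destruct H
  | H : and3 _ _ _ |- _ => destruct H
  | H : _ -> _ |- _ => first [specialize (H c) | clear H] end;
try (by case: K);
first [ by constructor 1 | by exfalso; clear c K; lia
      | by constructor 2; split=> //; auto ].
Qed.

End TagSpec.

(** * Webs as annihilators of pencils *)

Definition o6 (k : nat) (h : (k < 6)%N) : 'I_6 := Ordinal h.
Notation "''o' k" := (@o6 k isT) (at level 8, k at level 2, format "''o' k").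

Lemma ord6P (P : 'I_6 -> Prop) :
  P 'o0 -> P 'o1 -> P 'o2 -> P 'o3 -> P 'o4 -> P 'o5 -> forall i, P i.
Proof.
move=> P0 P1 P2 P3 P4 P5 [k h].
case: k h => [|[|[|[|[|[|//]]]]]] h; rewrite (bool_irrelevance h isT) //.
Qed.

Lemma sum6E (V : nmodType) (E : 'I_6 -> V) :
  \sum_i E i = E 'o0 + E 'o1 + E 'o2 + E 'o3 + E 'o4 + E 'o5.
Proof.
rewrite !big_ord_recl big_ord0 addr0 !addrA.
by congr (E _ + E _ + E _ + E _ + E _ + E _); apply: val_inj.
Qed.

Section QuadraticForms.

Variable R : comNzRingType.
Implicit Types (G A X : 'M[R]_3) (l m : 'rV[R]_3) (a : 'rV[R]_6).

(* The quadratic form of a (not necessarily symmetric) bilinear form. *)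
Definition gq G : 'rV[R]_6 := \row_k nth 0
  [:: G i0 i0; G i0 i1 + G i1 i0; G i0 i2 + G i2 i0; G i1 i1; G i1 i2 + G i2 i1; G i2 i2] k.

(** In characteristic 2 a quadratic form has in general no symmetric matrix, so a triangular one
    represents it. *)
Definition upper a : 'M[R]_3 := mk3 (a 0 'o0) (a 0 'o1) (a 0 'o2) 0 (a 0 'o3) (a 0 'o4) 0 0 (a 0 'o5).

(* Incidence of a conic, seen as a hyperplane of PG(5,q), with a point. *)
Definition inc a X : R :=
  a 0 'o0 * X i0 i0 + a 0 'o1 * X i0 i1 + a 0 'o2 * X i0 i2
  + a 0 'o3 * X i1 i1 + a 0 'o4 * X i1 i2 + a 0 'o5 * X i2 i2.

Lemma upperK a : gq (upper a) = a.
Proof. by apply/rowP; elim/ord6P; rewrite !mxE /= ?addr0. Qed.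

Lemma qmonomE k : tnth qmonom k = nth 0%MM
  [:: U_(i0) + U_(i0); U_(i0) + U_(i1); U_(i0) + U_(i2);
         U_(i1) + U_(i1); U_(i1) + U_(i2); U_(i2) + U_(i2)]%MM k.
Proof. by rewrite (tnth_nth 0%MM). Qed.

Lemma qmonom_inj : injective (fun k => tnth qmonom k).
Proof.
move=> j k /= /mnmP E; have := E i0; have := E i1; have := E i2 => {E}.
rewrite !qmonomE; move: j k; elim/ord6P; elim/ord6P; by rewrite //= !mnmDE !mnm1E.
Qed.

Lemma qformK a : qcoefs (qform a) = a.
Proof.
apply/rowP => k; rewrite mxE /qform raddf_sum /= (bigD1 k) //= big1 => [|j jk].
  by rewrite mcoeffZ mcoeffX eqxx mulr1 addr0.
by rewrite mcoeffZ mcoeffX (inj_eq qmonom_inj) (negPf jk) mulr0.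
Qed.

Lemma qform_inj : injective (@qform R).
Proof. exact: can_inj qformK. Qed.

Lemma qform_gq G : qform (gq G) = \sum_i \sum_j G i j *: ('X_i * 'X_j).
Proof.
rewrite /qform sum6E !sum3E !qmonomE /= !mxE /= !mpolyXD !scalerDl.
rewrite ['X_i1 * 'X_i0]mulrC ['X_i2 * 'X_i0]mulrC ['X_i2 * 'X_i1]mulrC.
move: (_ *: _) (_ *: _) (_ *: _) (_ *: _) (_ *: _) (_ *: _) (_ *: _) (_ *: _) (_ *: _).
by move=> x1 x2 x3 x4 x5 x6 x7 x8 x9; ring.
Qed.

Lemma lformM l m : lform l * lform m = qform (gq (l^T *m m)).
Proof.
rewrite qform_gq /lform mulr_suml; apply: eq_bigr => i _.
rewrite mulr_sumr; apply: eq_bigr => j _.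
by rewrite -scalerAl -scalerAr scalerA !mxE big_ord1 !mxE.
Qed.

Lemma lin_subst_gq A G : lin_subst A (qform (gq G)) = qform (gq (A^T *m G *m A)).
Proof.
rewrite qform_gq /lin_subst raddf_sum /=.
transitivity (\sum_i \sum_j G i j *: (lform (row i A) * lform (row j A))).
  apply: eq_bigr => i _; rewrite raddf_sum; apply: eq_bigr => j _ /=.
  by rewrite linearZ /= rmorphM /= !comp_mpolyXU -!tnth_nth !tnth_mktuple.
rewrite qform_gq.
under eq_bigr => i _ do under eq_bigr => j _ do rewrite lformM qform_gq scaler_sumr.
under eq_bigr => i _ do under eq_bigr => j _ do under eq_bigr => k _ do rewrite scaler_sumr.
under eq_bigr => i _ do rewrite exchange_big.
rewrite exchange_big /=; apply: eq_bigr => k _.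
under eq_bigr => i _ do rewrite exchange_big.
rewrite exchange_big /=; apply: eq_bigr => l _.
rewrite mxE scaler_suml exchange_big /=; apply: eq_bigr => j _.
rewrite mxE mulr_suml scaler_suml; apply: eq_bigr => i _.
by rewrite scalerA !mxE big_ord1 !mxE; congr (_ *: _); ring.
Qed.

Lemma inc_gq G (a b c d e f : R) :
  inc (gq G) (sym3 a b c d e f) = \sum_i \sum_j G i j * (sym3 a b c d e f) i j.
Proof. by rewrite /inc !sum3E !mxE /=; ring. Qed.

Lemma inc_sum G X : X^T = X -> inc (gq G) X = \sum_i \sum_j G i j * X i j.
Proof. by move=> /sym3P ->; rewrite inc_gq. Qed.

Lemma inc_mul l m X : X^T = X -> inc (gq (l^T *m m)) X = bform X l m.
Proof.
move=> sX; rewrite inc_sum // bformE; apply: eq_bigr => i _; apply: eq_bigr => j _.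
by rewrite !mxE big_ord1 !mxE; ring.
Qed.

(** On symmetric matrices the incidence is the trace of G X, and the trace is invariant under cyclic
    permutation. *)
Lemma inc_congr A G X : X^T = X -> inc (gq (A^T *m G *m A)) X = inc (gq G) (A *m X *m A^T).
Proof.
move=> sX; have sX' : (A *m X *m A^T)^T = A *m X *m A^T by rewrite !trmx_mul trmxK sX mulmxA.
have tr (P Q : 'M[R]_3) : Q^T = Q -> \sum_i \sum_j P i j * Q i j = \tr (P *m Q).
  move=> sQ; rewrite /mxtrace; apply: eq_bigr => i _; rewrite mxE.
  by apply: eq_bigr => j _; rewrite -{1}sQ mxE.
rewrite !inc_sum // !tr // -!mulmxA mxtrace_mulC.
by rewrite -!mulmxA.
Qed.

End QuadraticForms.

Section Webs.

Variable F : finFieldType.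
Implicit Types (W : {vspace 'rV[F]_6}) (M N X A B G : 'M[F]_3) (a : 'rV[F]_6).

Definition web_pencil W M N : Prop :=
  [/\ M^T = M, N^T = N, indep M N
    & forall a, (a \in W) = (inc a M == 0) && (inc a N == 0)].

Definition act A a : 'rV[F]_6 := gq (A^T *m upper a *m A).

Lemma lin_substE A a : lin_subst A (qform a) = qform (act A a).
Proof. by rewrite -{1}(upperK a) lin_subst_gq. Qed.

Lemma gq_congr_upper A G : gq (A^T *m upper (gq G) *m A) = gq (A^T *m G *m A).
Proof. by apply: (@qform_inj F); rewrite -!lin_subst_gq upperK. Qed.

Lemma act_comp A B a : act B (act A a) = act (A *m B) a.
Proof. by rewrite /act gq_congr_upper trmx_mul !mulmxA. Qed.

Lemma act1 a : act 1%:M a = a.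
Proof. by rewrite /act trmx1 mul1mx mulmx1 upperK. Qed.

Lemma inc_act A a X : X^T = X -> inc (act A a) X = inc a (A *m X *m A^T).
Proof. by move=> sX; rewrite /act inc_congr // upperK. Qed.

Lemma inc_lin a s t M N : inc a (s *: M + t *: N) = s * inc a M + t * inc a N.
Proof. by rewrite /inc !mxE; ring. Qed.

(** By [inc_act] the action on forms is adjoint to congruence of symmetric matrices, so [W] is the
    annihilator of the pencil of [W'] transformed by [A]. *)
Lemma proj_equiv_pencil W W' M' N' : proj_equiv W W' -> web_pencil W' M' N' ->
  exists M N, web_pencil W M N /\ peq M N M' N'.
Proof.
case=> A Au PE [sM sN ind E].
have E' : peq M' N' (A *m M' *m A^T) (A *m N' *m A^T) := peq_congr _ _ Au.
exists (A *m M' *m A^T), (A *m N' *m A^T); split; last exact: peq_sym.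
split; try exact: sym_congr; first exact: indep_peq E' ind.
move=> a; rewrite -!inc_act // -E; apply/idP/idP => [aW|/PE[b bW]].
  by apply/PE; exists a => //; rewrite lin_substE.
rewrite lin_substE => /(@qform_inj F) /(congr1 (act (invmx A))).
by rewrite !act_comp mulmxV // !act1 => ->.
Qed.

(** With [B] the congruence between the pencils, x lies in [W'] exactly when [act B x] lies in [W];
    so it is the inverse of [B] that maps [W] to [W']. *)
Lemma peq_proj_equiv W W' M N M' N' : web_pencil W M N -> web_pencil W' M' N' ->
  peq M N M' N' -> proj_equiv W W'.
Proof.
move=> [sM sN _ E] [sM' sN' _ E'] [B Bu [[[[a b] c] d] [D H1 H2]]].
have K x : (x \in W') = (act B x \in W).
  rewrite E E' !inc_act // H1 H2 !inc_lin.
  apply/andP/andP => -[/eqP h1 /eqP h2]; first by rewrite h1 h2 !mulr0 addr0 eqxx.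
  split; apply/eqP; apply: (mulIf D); rewrite mul0r.
    by transitivity ((a * inc x M' + b * inc x N') * d - (c * inc x M' + d * inc x N') * b);
      [ring|rewrite h1 h2 !mul0r subrr].
  by transitivity ((c * inc x M' + d * inc x N') * a - (a * inc x M' + b * inc x N') * c);
      [ring|rewrite h1 h2 !mul0r subrr].
exists (invmx B); first by rewrite unitmx_inv.
move=> x; rewrite K; split=> [xW|[y yW]].
  by exists (act B x) => //; rewrite lin_substE act_comp mulmxV // act1.
by rewrite lin_substE => /(@qform_inj F) ->; rewrite act_comp mulVmx // act1.
Qed.

Definition smx (y : 'I_6 -> F) : 'M[F]_3 := sym3 (y 'o0) (y 'o1) (y 'o2) (y 'o3) (y 'o4) (y 'o5).

Lemma inc_smx (f : {linear 'rV[F]_6 -> F^o}) a :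
  inc a (smx (fun k => f (delta_mx 0 k))) = f a.
Proof.
rewrite {2}(row_sum_delta a) linear_sum sum6E /inc !mxE /= !linearZ /=.
by [].
Qed.

(** The two coordinates, on a complement of [W], of the projection along [W] are linear functionals
    with common kernel [W]; [inc_smx] realises each of them as incidence with a symmetric matrix. *)
Lemma web_pencil_exists W : web W -> exists M N, web_pencil W M N.
Proof.
move=> dW; set U := (W^C)%VS.
have dU : \dim U = 2%N by rewrite dimv_compl dW dimvf /dim /= mul1n.
have [b bU] : exists b : 2.-tuple 'rV[F]_6, basis_of U b.
  by have := vbasisP U; move: (vbasis U); rewrite dU => b bU; exists b.
have dir : (U :&: W = 0)%VS by rewrite capvC capv_compl.
have full v : v \in (U + W)%VS by rewrite addvC addv_complf memvf.
pose pi := daddv_pi U W.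
have piW a : (a \in W) = (pi a == 0).
  have S := daddv_pi_add dir (full a); apply/idP/eqP => [aW|p0].
    by apply: (addIr (daddv_pi W U a)); rewrite S add0r daddv_pi_id // capvC.
  by rewrite -S -/(pi a) p0 add0r memv_pi.
pose f i : {linear 'rV[F]_6 -> F^o} := (coord b i \o pi)%FUN.
exists (smx (fun k => f 0 (delta_mx 0 k))), (smx (fun k => f 1 (delta_mx 0 k))).
have bf := basis_free bU.
split; try exact: tr_sym3.
- apply/forallP => -[s t]; apply/implyP => /eqP P0.
  have Z a : s * f 0 a + t * f 1 a = 0.
    by rewrite -!inc_smx -inc_lin [X in inc a X]P0 /inc !mxE; ring.
  have fb (i j : 'I_2) : f i b`_j = (i == j)%:R.
    rewrite /f /= /pi daddv_pi_id //; last by apply: (basis_mem bU); rewrite mem_nth ?size_tuple.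
    by rewrite coord_free // eq_sym.
  have := Z b`_(0%R : 'I_2); rewrite !fb mulr1 mulr0 addr0 => ->.
  have := Z b`_(1%R : 'I_2); rewrite !fb mulr1 mulr0 add0r => ->.
  by [].
move=> a; rewrite !inc_smx piW; apply/eqP/andP => [p0|[/eqP h0 /eqP h1]].
  by rewrite /f /= p0 !linear0.
have piU : pi a \in U by rewrite memv_pi.
rewrite (coord_basis bU piU) !big_ord_recl big_ord0.
rewrite (_ : coord b ord0 (pi a) = 0) ?scale0r // add0r addr0.
by rewrite (_ : coord b _ (pi a) = 0) ?scale0r // -h1; congr (coord b _ _); apply: val_inj.
Qed.

End Webs.

(** * Hermitian forms over the quadratic extension *)

Lemma card_fibres (T U : finType) (f : T -> U) (A : {set T}) k :
  (forall x, x \in A -> #|[set y in A | f y == f x]| = k) ->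
  #|A| = (#|f @: A| * k)%N.
Proof.
move=> H; rewrite -[LHS]sum1_card (partition_big_imset f) /=.
rewrite -sum_nat_const; apply: eq_bigr => _ /imsetP[x xA ->].
by rewrite -(H x xA) -sum1_card; apply: eq_bigl => y; rewrite inE.
Qed.

Lemma card_poly_eq0 (K : finFieldType) (p : {poly K}) : p != 0 ->
  (#|[set x | (p.[x] == 0)%R]| < size p)%N.
Proof.
move=> p0; rewrite cardE; apply: max_poly_roots => //; last exact: enum_uniq.
by apply/allP => x; rewrite mem_enum inE.
Qed.

Section QuadraticExtension.

Variables (F L : finFieldType) (iota : {rmorphism F -> L}).
Hypothesis cL : #|L| = (#|F| ^ 2)%N.
Local Notation q := #|F|.
Implicit Types x y z : L.

Lemma frobD x y : (x + y) ^+ q = x ^+ q + y ^+ q.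
Proof.
have [p p_pr pF] := finPcharP F; apply: exprDn_pchar.
have := card_pprimeChar pF; rewrite -[#|pPrimeCharType pF|]/q => ->.
by rewrite pnatX pnatE // (rmorph_pchar iota).
Qed.

Lemma frobK x : (x ^+ q) ^+ q = x.
Proof. by rewrite -exprM mulnn -cL expf_card. Qed.

Lemma frob_iota (a : F) : iota a ^+ q = iota a.
Proof. by rewrite -rmorphXn expf_card. Qed.

Lemma frob_sum (I : finType) (f : I -> L) : (\sum_i f i) ^+ q = \sum_i f i ^+ q.
Proof.
apply: (big_morph (fun x => x ^+ q)); first exact: frobD.
by rewrite expr0n -leqn0 leqNgt (ltnW (card_ge2 F)).
Qed.

(** A left inverse of [iota], with default 0 outside its image; by [descendK] the image contains
    every element fixed by Frobenius. *)
Definition descend x : F := odflt 0 [pick a | iota a == x].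

(** A fixed element outside the image of F would be one root too many for X^q - X. *)
Lemma descendK x : x ^+ q = x -> iota (descend x) = x.
Proof.
move=> xq; rewrite /descend; case: pickP => [a /eqP //|nx].
pose p : {poly L} := 'X^q - 'X.
have sp : size p = q.+1.
  by rewrite size_polyDl size_polyXn // size_polyN size_polyX ltnS card_ge2.
have p0 : p != 0 by rewrite -size_poly_eq0 sp.
have := card_poly_eq0 p0; rewrite sp ltnNge => /negP[].
have -> : q.+1 = #|x |: [set iota a | a : F]|.
  rewrite cardsU1 card_imset; last exact: fmorph_inj.
  by case: imsetP => // -[a _ E]; have := nx a; rewrite E eqxx.
apply: subset_leq_card; apply/subsetP => y /setU1P[->|/imsetP[a _ ->]];
by rewrite inE !hornerE ?xq ?frob_iota subrr.
Qed.

Definition trace x : F := descend (x + x ^+ q).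
Definition norm x : F := descend (x * x ^+ q).

Lemma traceE x : iota (trace x) = x + x ^+ q.
Proof. by rewrite descendK // frobD frobK addrC. Qed.

Lemma normE x : iota (norm x) = x * x ^+ q.
Proof. by rewrite descendK // exprMn frobK mulrC. Qed.

Lemma traceD x y : trace (x + y) = trace x + trace y.
Proof. by apply: (fmorph_inj iota); rewrite rmorphD !traceE frobD addrACA. Qed.

Lemma traceZ a x : trace (iota a * x) = a * trace x.
Proof. by apply: (fmorph_inj iota); rewrite rmorphM !traceE exprMn frob_iota mulrDr. Qed.

(** X^q + X has at most q roots, so the trace is not identically zero, and F-linearity does the
    rest. *)
Lemma trace_surj a : exists x, trace x = a.
Proof.
have [x tx] : exists x, trace x != 0.
  apply/existsP; apply: contraT => /existsPn H.
  pose p : {poly L} := 'X^q + 'X.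
  have sp : size p = q.+1.
    by rewrite size_polyDl size_polyXn // size_polyX ltnS card_ge2.
  have p0 : p != 0 by rewrite -size_poly_eq0 sp.
  have := card_poly_eq0 p0; rewrite sp ltnNge => /negP[].
  have -> : [set x | p.[x] == 0] = setT.
    apply/setP => x; rewrite !inE !hornerE addrC -traceE.
    by have := H x; rewrite negbK => /eqP ->; rewrite rmorph0 eqxx.
  by rewrite cardsT cL expnS expn1; have := card_ge2 F; move: #|F| => r; nia.
by exists (iota (a / trace x) * x); rewrite traceZ divfK.
Qed.

Lemma normM x y : norm (x * y) = norm x * norm y.
Proof. by apply: (fmorph_inj iota); rewrite rmorphM !normE exprMn mulrACA. Qed.

Lemma norm_eq0 x : (norm x == 0) = (x == 0).
Proof.
rewrite -(fmorph_eq0 iota) normE mulf_eq0 expf_eq0.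
by rewrite (ltnW (card_ge2 F)) orbb.
Qed.

Lemma norm_fibre_le a : (#|[set x | norm x == a]| <= q.+1)%N.
Proof.
pose p : {poly L} := 'X^(q.+1) - (iota a)%:P.
have sp : size p = q.+2.
  rewrite size_polyDl size_polyXn // size_polyN.
  by apply: leq_ltn_trans (size_polyC_leq1 _) _.
have p0 : p != 0 by rewrite -size_poly_eq0 sp.
have := card_poly_eq0 p0; rewrite sp ltnS; apply: leq_trans.
apply: subset_leq_card; apply/subsetP => x; rewrite !inE !hornerE => /eqP <-.
by rewrite normE exprS subrr.
Qed.

(** Fibres of the norm have at most q + 1 elements, so the q^2 - 1 nonzero elements take at least q
    - 1 values. *)
Lemma norm_surj a : exists x, norm x = a.
Proof.
have [->|a0] := eqVneq a 0; first by exists 0; apply/eqP; rewrite norm_eq0.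
have : norm @: [set~ 0] = [set~ 0].
  apply/eqP; rewrite eqEcard; apply/andP; split.
    by apply/subsetP => _ /imsetP[x + ->]; rewrite !inE norm_eq0.
  have : (#|[set~ (0%R : L)]| <= #|norm @: [set~ 0%R]| * q.+1)%N.
    rewrite -sum1_card (partition_big_imset norm) /= -sum_nat_const.
    apply: leq_sum => b _; rewrite sum1dep_card; apply: leq_trans (norm_fibre_le b).
    by apply: subset_leq_card; apply/subsetP => x; rewrite !inE => /andP[].
  rewrite !cardsC1 cL; have := card_ge2 F; move: #|F| #|_| => r k; nia.
move/setP/(_ a); rewrite !inE a0 => /imsetP[x _ ->]; by exists x.
Qed.

(** The nonempty fibres over nonzero elements are cosets of this set, so it has (q^2 - 1) / (q - 1)
    elements. *)
Lemma card_norm1 : #|[set x | norm x == 1]| = q.+1.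
Proof.
have : (#|[set~ (0%R : L)]| = #|norm @: [set~ 0%R]| * #|[set x | norm x == 1%R]|)%N.
  apply: card_fibres => x; rewrite !inE => x0.
  rewrite -(card_imset [set y | norm y == 1] (mulfI x0)); apply: eq_card => y.
  rewrite !inE; apply/andP/imsetP => [[y0 /eqP E]|[z]].
    exists (y / x); last by rewrite mulrC divfK.
    rewrite inE -(inj_eq (mulIf (_ : norm x != 0))) ?norm_eq0 //.
    by rewrite -normM divfK // E mul1r.
  rewrite inE => /eqP z1 ->; rewrite normM z1 mulr1 eqxx; split=> //.
  by rewrite mulf_neq0 // -norm_eq0 z1 oner_eq0.
have -> : norm @: [set~ 0] = [set~ 0].
  apply/setP => a; rewrite !inE; apply/imsetP/idP => [[x + ->]|a0].
    by rewrite !inE norm_eq0.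
  by have [x E] := norm_surj a; exists x; rewrite // !inE -norm_eq0 E.
rewrite !cardsC1 cL; have := card_ge2 F; move: #|F| #|_| => r k r2 E.
have : ((r - 1) * k = (r - 1) * r.+1)%N by nia.
by move/eqP; rewrite eqn_pmul2l ?subn_gt0 // => /eqP.
Qed.

End QuadraticExtension.

Lemma card_left_kernel (K : finFieldType) m n (X : 'M[K]_(m, n)) :
  #|[set u : 'rV[K]_m | u *m X == 0]| = (#|K| ^ (m - \rank X))%N.
Proof.
rewrite -mxrank_ker -[X in (_ ^ X)%N]mul1n -card_mx.
rewrite -(card_imset predT (row_free_inj (row_base_free (kermx X)))); apply: eq_card => u.
have rb : (u <= kermx X)%MS = (u <= row_base (kermx X))%MS by rewrite eq_row_base.
rewrite !inE -sub_kermx rb; apply/idP/imsetP => [/submxP[v ->]|[v _ ->]].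
  by exists v.
exact: submxMl.
Qed.

Lemma card_additive_fibre (U : finZmodType) (F : finFieldType) (f : U -> F) c :
  (forall x y, f (x + y) = f x + f y) -> (forall a, exists x, f x = a) ->
  (#|[set x | f x == c]| * #|F| = #|U|)%N.
Proof.
move=> fD fS.
have -> : #|U| = (\sum_(a : F) #|[set x | f x == a]|)%N.
  rewrite -[LHS]sum1_card (partition_big f predT) //=; apply: eq_bigr => a _.
  by rewrite -sum1_card; apply: eq_bigl => x; rewrite !inE.
rewrite (eq_bigr (fun=> #|[set x | f x == c]|)) => [|a _]; first by rewrite sum_nat_const mulnC.
have [y fy] := fS (a - c); rewrite -[RHS](card_imset _ (addIr y)); apply: eq_card => x.
rewrite !inE; apply/eqP/imsetP => [fx|[z]].
  exists (x - y); last by rewrite subrK.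
  by rewrite inE; apply/eqP/(addIr (f y)); rewrite -fD subrK fx fy addrC subrK.
by rewrite inE => /eqP fz ->; rewrite fD fz fy addrC subrK.
Qed.

Lemma card_setX_sum (T U : finType) (P : T -> U -> bool) :
  #|[set x : T * U | P x.1 x.2]| = (\sum_(x : T) #|[set y | P x y]|)%N.
Proof.
rewrite -sum1_card (eq_bigl (fun x => P x.1 x.2)) => [|x]; last by rewrite inE.
rewrite (eq_bigr (fun x => 1%N)) // -(pair_big_dep xpredT P (fun _ _ => 1%N)) /=.
by apply: eq_bigr => x _; rewrite -sum1_card; apply: eq_bigl => y; rewrite inE.
Qed.

(** * Zeros of a bilinear form *)

Section BilinearZeros.

Variable F : finFieldType.
Local Notation q := #|F|.

Lemma card_orthogonal (v : 'rV[F]_3) : v != 0 ->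
  #|[set m : 'rV[F]_3 | (v *m m^T) 0 0 == 0]| = (q ^ 2)%N.
Proof.
move=> v0; have rv : \rank v^T = 1%N by rewrite mxrank_tr rank_rV v0.
have := card_left_kernel v^T; rewrite rv => <-; apply: eq_card => m; rewrite !inE.
rewrite -[in RHS](trmxK m) -trmx_mul -[0 in RHS]trmx0 (inj_eq trmx_inj).
by apply/eqP/eqP => [E|->]; [apply/matrixP => i j; rewrite !ord1 E mxE|rewrite mxE].
Qed.

(** The q^(3 - rank) vectors l with l X = 0 are orthogonal to every m, each of the others to a plane
    of vectors m. *)
Lemma card_bilinear_zeros (X : 'M[F]_3) :
  (#|[set x : 'rV[F]_3 * 'rV[F]_3 | bform X x.1 x.2 == 0%R]|
   = q ^ (3 - \rank X) * q ^ 3 + (q ^ 3 - q ^ (3 - \rank X)) * q ^ 2)%N.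
Proof.
rewrite (card_setX_sum (fun l m => bform X l m == 0)).
rewrite (bigID (fun l => l *m X == 0)) /=; congr addn.
  rewrite (eq_bigr (fun=> q ^ 3)%N) => [|l /eqP lX].
    by rewrite sum_nat_const -card_left_kernel cardsE.
  rewrite -[3%N]/(1 * 3)%N -card_mx; apply: eq_card => m.
  by rewrite !inE /bform lX mul0mx mxE eqxx.
rewrite (eq_bigr (fun=> q ^ 2)%N) => [|l lX]; last exact: card_orthogonal.
rewrite sum_nat_const; congr muln; rewrite -card_left_kernel cardsE.
rewrite -[X in (q ^ X)%N]/(1 * 3)%N -card_mx -[in RHS](cardC [pred u : 'rV[F]_3 | u *m X == 0]).
by rewrite addKn; apply: eq_card => l; rewrite !inE.
Qed.

End BilinearZeros.

(** * Values of a Hermitian form *)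

Section HermitianZeros.

Variables (F L : finFieldType) (iota : {rmorphism F -> L}).
Hypothesis cL : #|L| = (#|F| ^ 2)%N.
Local Notation q := #|F|.
Implicit Types (X : 'M[F]_3) (l m y : 'rV[L]_3).

Local Notation cj := (@conj_form F L).

Definition sesq X l m : L := (l *m map_mx iota X *m (cj m)^T) 0 0.
Definition herm X l : F := descend iota (sesq X l l).

Lemma frob0 : 0 ^+ q = 0 :> L.
Proof. by rewrite expr0n -leqn0 leqNgt (ltnW (card_ge2 F)). Qed.

Lemma conj_formD l m : cj (l + m) = cj l + cj m.
Proof. by apply/rowP => i; rewrite !mxE (frobD iota). Qed.

Lemma conj_formK l : cj (cj l) = l.
Proof. by apply/rowP => i; rewrite !mxE (frobK cL). Qed.

Lemma conj_formZ c l : cj (c *: l) = c ^+ q *: cj l.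
Proof. by apply/rowP => i; rewrite !mxE exprMn. Qed.

Lemma sesqE X l m : sesq X l m = \sum_i \sum_j l 0 i * iota (X i j) * m 0 j ^+ q.
Proof.
rewrite /sesq !mxE exchange_big /=; apply: eq_bigr => j _.
by rewrite !mxE mulr_suml; apply: eq_bigr => i _; rewrite !mxE.
Qed.

Lemma sesq_conj X l m : X^T = X -> sesq X l m ^+ q = sesq X m l.
Proof.
move=> sX; rewrite !sesqE (frob_sum iota) exchange_big /=; apply: eq_bigr => i _.
rewrite (frob_sum iota); apply: eq_bigr => j _.
by rewrite !exprMn frob_iota (frobK cL) -{1}sX mxE mulrC mulrA mulrAC.
Qed.

Lemma hermE X l : X^T = X -> iota (herm X l) = sesq X l l.
Proof. by move=> sX; rewrite descendK // sesq_conj. Qed.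

Lemma herm_add X l m : X^T = X ->
  herm X (l + m) = herm X l + herm X m + trace iota (sesq X l m).
Proof.
move=> sX; apply: (fmorph_inj iota); rewrite !rmorphD !hermE // (traceE iota cL) sesq_conj //.
rewrite /sesq conj_formD linearD /= !mulmxDl !mulmxDr !mxE.
by ring.
Qed.

Lemma hermZ X c l : X^T = X -> herm X (c *: l) = norm iota c * herm X l.
Proof.
move=> sX; apply: (fmorph_inj iota); rewrite rmorphM !hermE // (normE iota cL).
by rewrite /sesq conj_formZ linearZ /= -!scalemxAl -scalemxAr !mxE mulrA.
Qed.

Lemma herm0 X : X^T = X -> herm X 0 = 0.
Proof.
by move=> sX; apply: (fmorph_inj iota); rewrite hermE // rmorph0 /sesq !mul0mx mxE.
Qed.

Lemma rank_map X : \rank (map_mx iota X) = \rank X.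
Proof. exact: mxrank_map. Qed.

(** The difference of the values at m + y and m is an affine function of m, namely [herm X y] plus
    the trace of [sesq X m y]; its linear part is onto F unless y X = 0. *)
Lemma card_herm_shift X y : X^T = X ->
  #|[set m | herm X (m + y) == herm X m]| =
  if y *m map_mx iota X == 0 then (q ^ 6)%N else (q ^ 5)%N.
Proof.
move=> sX; have E m : (herm X (m + y) == herm X m) = (trace iota (sesq X m y) == - herm X y).
  by rewrite herm_add // -addrA -subr_eq0 addrC addrK addrC addr_eq0.
case: eqP => [yX|/eqP yX].
  have ym m : sesq X y m = 0 by rewrite /sesq yX mul0mx mxE.
  have my m : sesq X m y = 0.
    by rewrite -(sesq_conj _ _ sX) ym frob0.
  rewrite -[6%N]/(2 * (1 * 3))%N expnM -cL -card_mx; apply: eq_card => m; rewrite !inE E.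
  have -> : herm X y = 0 by apply: (fmorph_inj iota); rewrite hermE // ym rmorph0.
  by rewrite oppr0 my -(fmorph_eq0 iota) (traceE iota cL) frob0 addr0 eqxx.
have Xy : exists i, (map_mx iota X *m (cj y)^T) i 0 != 0.
  apply/existsP; apply: contraNT yX => /existsPn H.
  have /(congr1 trmx) Z : map_mx iota X *m (cj y)^T = 0.
    by apply/colP => i; have := H i; rewrite negbK => /eqP ->; rewrite mxE.
  have sXi : (map_mx iota X)^T = map_mx iota X.
    by apply/matrixP => i j; rewrite !mxE -[in LHS]sX mxE.
  rewrite trmx_mul trmxK trmx0 sXi in Z.
  have /(congr1 (map_mx (fun x => x ^+ q))) : cj y *m map_mx iota X = 0 := Z.
  move=> /rowP W; apply/eqP/rowP => i; have := W i; rewrite !mxE.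
  rewrite (frob_sum iota) frob0 => Wi; rewrite -[RHS]Wi.
  by apply: eq_bigr => j _; rewrite !mxE exprMn frob_iota (frobK cL).
have [i wi] := Xy; set w := map_mx iota X *m (cj y)^T in wi.
have sw m : sesq X m y = (m *m w) 0 0 by rewrite /sesq /w mulmxA.
clearbody w.
have K : (#|[set m | trace iota (sesq X m y) == - herm X y]| * q = #|{: 'rV[L]_3}|)%N.
  apply: card_additive_fibre => [l m|a].
    by rewrite !sw mulmxDl mxE (traceD iota cL).
  have [x tx] := trace_surj iota cL a; exists ((x / w i 0) *: delta_mx 0 i).
  by rewrite sw -scalemxAl -rowE !mxE divfK ?tx.
have c6 : #|{: 'rV[L]_3}| = (q ^ 5 * q)%N by rewrite card_mx cL -expnM -expnSr.
apply/eqP; rewrite -(eqn_pmul2r (ltnW (card_ge2 F))) -c6 -K; apply/eqP; congr muln.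
by apply: eq_card => m; rewrite !inE E.
Qed.

(** Scaling by an element of norm c maps the vectors of value 1 to those of value c. *)
Lemma card_herm_fibre X (c : F) : X^T = X -> c != 0 ->
  #|[set l | herm X l == c]| = #|[set l | herm X l == 1]|.
Proof.
move=> sX c0; have [x nx] := norm_surj iota cL c.
have x0 : x != 0 by rewrite -(norm_eq0 iota cL) nx.
rewrite -[RHS](card_imset _ (scalerI x0)); apply: eq_card => l; rewrite !inE.
apply/eqP/imsetP => [hl|[m]].
  exists (x^-1 *: l); last by rewrite scalerA divff ?scale1r.
  rewrite inE; apply/eqP/(mulfI c0); rewrite mulr1 -{1}nx -hermZ //.
  by rewrite scalerA divff // scale1r.
by rewrite inE => /eqP hm ->; rewrite hermZ // nx hm mulr1.
Qed.

Lemma card_herm_level X : X^T = X ->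
  (#|[set l | herm X l == 0%R]| + (q - 1) * #|[set l | herm X l == 1%R]| = q ^ 6)%N.
Proof.
move=> sX.
have -> : (q ^ 6 = \sum_(c : F) #|[set l | herm X l == c]|)%N.
  rewrite -[6%N]/(2 * (1 * 3))%N expnM -cL -card_mx -[LHS]sum1_card.
  rewrite (partition_big (herm X) predT) //=; apply: eq_bigr => c _.
  by rewrite -sum1_card; apply: eq_bigl => l; rewrite !inE.
rewrite (bigD1 (0 : F)) //=; congr addn.
rewrite (eq_bigr (fun=> #|[set l | herm X l == 1%R]|)) => [|c c0]; last exact: card_herm_fibre.
rewrite sum_nat_const; congr muln.
by rewrite subn1 -(cardC1 (0 : F)); apply: eq_card => c; rewrite !inE.
Qed.

(** Both sides count the pairs of vectors with equal values: on the left by the common value, on the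
    right by their difference, to which [card_herm_shift] applies. *)
Lemma card_herm_moment X : X^T = X ->
  (#|[set l | herm X l == 0%R]| ^ 2 + (q - 1) * #|[set l | herm X l == 1%R]| ^ 2
  = (q ^ 2) ^ (3 - \rank X) * q ^ 6 + (q ^ 6 - (q ^ 2) ^ (3 - \rank X)) * q ^ 5)%N.
Proof.
move=> sX; transitivity #|[set x : 'rV[L]_3 * 'rV[L]_3 | herm X x.1 == herm X x.2]|.
  rewrite (card_setX_sum (fun l m => herm X l == herm X m)).
  rewrite (partition_big (herm X) predT) //= (bigD1 (0 : F)) //=; congr addn.
    rewrite (eq_bigr (fun=> #|[set l | herm X l == 0%R]|)) => [|l /eqP ->].
      rewrite sum_nat_const -mulnn; congr muln.
      by apply: eq_card => l; rewrite !inE.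
    by apply: eq_card => m; rewrite !inE eq_sym.
  rewrite (eq_bigr (fun=> #|[set l | herm X l == 1%R]| ^ 2)%N) => [|c c0].
    rewrite sum_nat_const; congr muln.
    by rewrite subn1 -(cardC1 (0 : F)); apply: eq_card => c; rewrite !inE.
  rewrite (eq_bigr (fun=> #|[set l | herm X l == 1%R]|)) => [|l /eqP ->].
    rewrite sum_nat_const -mulnn; congr muln; rewrite -(card_herm_fibre sX c0).
    by apply: eq_card => l; rewrite !inE.
  rewrite -(card_herm_fibre sX c0); by apply: eq_card => m; rewrite !inE eq_sym.
pose g (x : 'rV[L]_3 * 'rV[L]_3) := (x.1 + x.2, x.2).
have gi : injective g by move=> [x y] [x' y'] [/= + E]; rewrite E => /addIr ->.
transitivity #|[set x : 'rV[L]_3 * 'rV[L]_3 | herm X (x.2 + x.1) == herm X x.2]|.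
  rewrite -[RHS](card_imset _ gi); apply: eq_card => -[l m]; rewrite !inE /=.
  apply/idP/imsetP => [E|[[y m'] + [-> ->]]]; last by rewrite inE /= addrC.
  by exists (l - m, m); rewrite ?inE /= ?[m + _]addrC /g /= subrK.
rewrite (card_setX_sum (fun y m => herm X (m + y) == herm X m)).
rewrite (bigID (fun y => y *m map_mx iota X == 0)) /=; congr addn.
  rewrite (eq_bigr (fun=> q ^ 6)%N) => [|y yX]; last by rewrite card_herm_shift // yX.
  by rewrite sum_nat_const -cL -(rank_map X) -card_left_kernel cardsE.
rewrite (eq_bigr (fun=> q ^ 5)%N) => [|y yX]; last by rewrite card_herm_shift // (negPf yX).
rewrite sum_nat_const; congr muln; rewrite -cL -(rank_map X) -card_left_kernel cardsE.
have -> : (q ^ 6 = #|{: 'rV[L]_3}|)%N by rewrite card_mx cL -expnM.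
rewrite -[in RHS](cardC [pred u : 'rV[L]_3 | u *m map_mx iota X == 0]).
by rewrite addKn; apply: eq_card => l; rewrite !inE.
Qed.

End HermitianZeros.

(* The nonzero scalars act freely. *)
Lemma card_scaled (K : finFieldType) n (A : {set 'rV[K]_n}) : 0 \notin A ->
  (forall c l, c != 0 -> l \in A -> c *: l \in A) ->
  #|A| = (#|[set [set (c *: l)%R | c : K & c != 0%R] | l in A]| * (#|K| - 1))%N.
Proof.
move=> A0 Ac; apply: card_fibres => l lA.
have l0 : l != 0 by apply: contraNneq A0 => <-.
have inj : injective (fun c : K => c *: l).
  move=> c c' /eqP; rewrite -subr_eq0 -scalerBl scaler_eq0.
  by rewrite (negPf l0) orbF subr_eq0 => /eqP.
rewrite subn1 -(cardC1 (0 : K)) -(card_imset _ inj); apply: eq_card => m.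
rewrite !inE; apply/andP/imsetP => [[mA /eqP E]|[c c0 ->]].
  have : m \in [set c *: m | c : K & c != 0].
    by apply/imsetP; exists 1; rewrite ?inE ?oner_eq0 ?scale1r.
  by rewrite E => /imsetP[c]; rewrite inE => c0 ->; exists c; rewrite ?inE.
rewrite !inE in c0; split; first exact: Ac.
apply/eqP/setP => y; apply/imsetP/imsetP => -[d]; rewrite inE => d0 ->.
  by exists (d * c); rewrite ?inE ?mulf_neq0 // scalerA.
by exists (d / c); rewrite ?inE ?mulf_neq0 ?invr_eq0 // scalerA divfK.
Qed.

Section Hermitian.

Variables (F L : finFieldType) (iota : {rmorphism F -> L}).
Hypothesis cL : #|L| = (#|F| ^ 2)%N.
Local Notation q := #|F|.
Implicit Types (X : 'M[F]_3) (l m y : 'rV[L]_3).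

(** The nonzero zeros split into orbits of q^2 - 1 vectors under the nonzero scalars of L. *)
Lemma card_herm_dvd X : X^T = X ->
  exists k, (#|[set l : 'rV[L]_3 | herm iota X l == 0%R]| = 1 + k * (q ^ 2 - 1))%N.
Proof.
move=> sX; set A := [set l | herm iota X l == 0].
have A0 : 0 \in A by rewrite inE (herm0 iota cL).
exists #|[set [set c *: l | c : L & c != 0] | l in A :\ 0]|.
rewrite (cardsD1 0 A) A0 -cL -card_scaled //; first by rewrite !inE eqxx.
move=> c l c0; rewrite !inE scaler_eq0 negb_or c0 => /andP[-> /eqP hl] /=.
by rewrite hermZ // hl mulr0.
Qed.

(** Excludes the wrong sign in [card_herm_zeros]: Z - 1 is divisible by q^2 - 1, and the last
    equation would then make q + 1 divide 2. *)
Lemma herm_sign (q0 Z N k Q e : int) : 2%:Z <= q0 ->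
  Z = 1 + k * (q0 ^+ 2 - 1) -> Z - 1 = (q0 - 1) * ((q0 + 1) * Q + 2) -> False.
Proof.
move=> q2 -> E; have {}E : (q0 - 1) * ((q0 + 1) * (k - Q)) = (q0 - 1) * 2.
  by transitivity (1 + k * (q0 ^+ 2 - 1) - 1 - (q0 - 1) * ((q0 + 1) * Q)); [ring|rewrite E; ring].
have q1 : q0 - 1 != 0 by lia.
have {q1}E := mulfI q1 E; move: (k - Q) E => m E.
have [m0|m0] : m <= 0 \/ 1 <= m by lia.
  have : (q0 + 1) * m <= 0 by rewrite pmulr_rle0 //; lia.
  by rewrite E.
have : (q0 + 1) * 1 <= (q0 + 1) * m by rewrite ler_wpM2l //; lia.
by rewrite E mulr1; lia.
Qed.

Definition herm_zeros (r : nat) : nat :=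
  (match r with 0 => q ^ 6 | 1 => q ^ 4 | 2 => q ^ 5 + (q - 1) * q ^ 3
  | _ => q ^ 5 - (q - 1) * q ^ 2 end)%N.

(** The number Z of zeros and the number N of vectors of value 1 satisfy a linear and a quadratic
    equation, which give (Z - N)^2 = q^(2 (6 - rank)). Divisibility of Z - 1 by q^2 - 1 selects the
    sign of Z - N, which is that of (-1)^rank. *)
Lemma card_herm_zeros X : X^T = X ->
  #|[set l : 'rV[L]_3 | herm iota X l == 0%R]| = herm_zeros (\rank X).
Proof.
move=> sX; have := card_herm_level iota cL sX; have := card_herm_moment iota cL sX.
have [k] := card_herm_dvd sX; have := card_ge2 F; have := rank_leq_row X.
move: #|[set l : 'rV[L]_3 | herm iota X l == 0%R]| #|[set l : 'rV[L]_3 | herm iota X l == 1%R]|.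
rewrite /herm_zeros; move: (\rank X) => r; move: #|F| => p Z N r3 p2 EZ E2 E1.
pose x : int := p%:R; pose z : int := Z%:R; pose n : int := N%:R.
have x2 : 2%:Z <= x by rewrite /x natz; lia.
have F1 : z + (x - 1) * n = x ^+ 6.
  have := congr1 (fun m : nat => m%:R : int) E1.
  by rewrite natrD natrM natrB ?(ltnW p2) // natrX.
have F0 : z = 1 + k%:R * (x ^+ 2 - 1).
  have := congr1 (fun m : nat => m%:R : int) EZ.
  by rewrite natrD natrM natrB ?expn_gt0 ?(ltnW p2) // natrX.
have cl : ((p ^ 2) ^ (3 - r) <= p ^ 6)%N.
  by rewrite -expnM leq_pexp2l ?(ltnW p2) //; lia.
have F2 : z ^+ 2 + (x - 1) * n ^+ 2 =
    x ^+ 2 ^+ (3 - r) * x ^+ 6 + (x ^+ 6 - x ^+ 2 ^+ (3 - r)) * x ^+ 5.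
  have := congr1 (fun m : nat => m%:R : int) E2.
  by rewrite !natrD !natrM !natrB ?(ltnW p2) // !natrX.
have x0 : x != 0 by apply/eqP; lia.
have x1 : x - 1 != 0 by apply/eqP; lia.
have inj (m1 m2 : nat) : (m1%:R : int) = m2%:R -> m1 = m2 by rewrite !natz => -[].
(* x times the second moment minus the square of the total is (x - 1) (z - n)^2. *)
have D2 : (z - n) ^+ 2 = x ^+ 2 ^+ (6 - r).
  apply: (mulfI x1).
  transitivity (x * (z ^+ 2 + (x - 1) * n ^+ 2) - (z + (x - 1) * n) ^+ 2); first by ring.
  rewrite F2 F1; case: r r3 {cl F2 E2} => [|[|[|[|//]]]] _ /=; ring.
have {D2} D2 : (z - n == x ^+ (6 - r)) || (z - n == - x ^+ (6 - r)).
  by rewrite -eqf_sqr D2 -!exprM mulnC.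
have xz : x * z = x ^+ 6 + (x - 1) * (z - n) by rewrite -F1; ring.
(* For the wrong sign, (z - 1) / (x - 1) leaves remainder 2 on division by x + 1; the polynomials
   given to [bad] are the quotients. *)
have bad Q : z - 1 = (x - 1) * ((x + 1) * Q + 2) -> False by apply: herm_sign x2 F0.
clear F2 cl E2 E1 EZ; case: r r3 D2 => [|[|[|[|//]]]] _ /= /orP[]/eqP D; rewrite D in xz.
- by apply: inj; rewrite natrX -/x -/z; apply: (mulfI x0); rewrite xz; ring.
- case: (bad (- x ^+ 4 + 2 * x ^+ 3 - x ^+ 2 + 2 * x - 1)).
  by apply: (mulfI x0); rewrite mulrBr xz; ring.
- case: (bad (2 * x ^+ 3 - x ^+ 2 + 2 * x - 1)).
  by apply: (mulfI x0); rewrite mulrBr xz; ring.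
- by apply: inj; rewrite natrX -/x -/z; apply: (mulfI x0); rewrite xz; ring.
- apply: inj; rewrite natrD natrM natrB ?(ltnW p2) // !natrX -/x -/z.
  by apply: (mulfI x0); rewrite xz; ring.
- case: (bad (x ^+ 3 - x ^+ 2 + 2 * x - 1)).
  by apply: (mulfI x0); rewrite mulrBr xz; ring.
- case: (bad (x ^+ 3 + 2 * x - 1)).
  by apply: (mulfI x0); rewrite mulrBr xz; ring.
- have le : ((p - 1) * p ^ 2 <= p ^ 5)%N by rewrite (expnD p 3 2) leq_mul2r expnS; nia.
  apply: inj; rewrite natrB // natrM natrB ?(ltnW p2) // !natrX -/x -/z.
  by apply: (mulfI x0); rewrite xz; ring.
Qed.

Lemma herm_lin (M N : 'M[F]_3) p l : M^T = M -> N^T = N ->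
  herm iota (pencil M N p) l = p.1 * herm iota M l + p.2 * herm iota N l.
Proof.
move=> sM sN; apply: (fmorph_inj iota); rewrite rmorphD !rmorphM !hermE //; last first.
  by rewrite /pencil linearD !linearZ /= sM sN.
by rewrite /sesq /pencil map_mxD !map_mxZ mulmxDr mulmxDl -!scalemxAr -!scalemxAl !mxE.
Qed.

End Hermitian.

(** * Sums over the members of a pencil *)

Section Equations.

Variables (F L : finFieldType) (iota : {rmorphism F -> L}).
Hypothesis cL : #|L| = (#|F| ^ 2)%N.
Variables M N : 'M[F]_3.
Hypotheses (sM : M^T = M) (sN : N^T = N) (ind : indep M N).
Local Notation q := #|F|.

Definition bil_count := #|[set x : 'rV[F]_3 * 'rV[F]_3 |
  (bform M x.1 x.2 == 0) && (bform N x.1 x.2 == 0)]|.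
Definition herm_count := #|[set l : 'rV[L]_3 | (herm iota M l == 0) && (herm iota N l == 0)]|.

Definition bil_zeros r := (q ^ (3 - r) * q ^ 3 + (q ^ 3 - q ^ (3 - r)) * q ^ 2)%N.

(** c1, c2, c3 are the numbers of members of rank 1, 2, 3; independence leaves the parameter 0 as
    the only one of rank 0. *)
Lemma rank_classes : exists c1 c2 c3,
  [/\ rank_count 1 M N = 1 + c1, rank_count 2 M N = 1 + c1 + c2, q ^ 2 = 1 + c1 + c2 + c3
    & forall g : nat -> nat, \sum_(p : F * F) g (\rank (pencil M N p)) =
        g 0 + c1 * g 1 + c2 * g 2 + c3 * g 3]%N.
Proof.
pose c r := #|[set p : F * F | \rank (pencil M N p) == r]|.
have S (P : pred nat) : #|[set p : F * F | P (\rank (pencil M N p))]| = (\sum_(r < 4 | P r) c r)%N.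
  rewrite -sum1_card (partition_big (fun p => inord (\rank (pencil M N p)) : 'I_4) (fun r : 'I_4 => P r)) /=.
    apply: eq_bigr => r Pr; rewrite /c -sum1_card; apply: eq_bigl => p; rewrite !inE.
    rewrite -(inj_eq val_inj) /= inordK ?ltnS ?rank_leq_row //.
    by case: eqP => [->|]; rewrite ?Pr ?andbF.
  by move=> p; rewrite inE inordK ?ltnS ?rank_leq_row.
have c0 : c 0%N = 1%N.
  apply: etrans (cards1 (0 : F * F)); apply: eq_card => p; rewrite !inE mxrank_eq0.
  by apply/idP/eqP => [h|->]; [apply/eqP; exact: implyP (forallP ind p) h|rewrite /pencil !scale0r addr0].
exists (c 1), (c 2), (c 3); split.
- have := S (fun r => r <= 1)%N; rewrite /rank_count => ->.
  by rewrite big_mkcond !big_ord_recl big_ord0 /= c0 !addn0.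
- have := S (fun r => r <= 2)%N; rewrite /rank_count => ->.
  by rewrite big_mkcond !big_ord_recl big_ord0 /= c0 !addn0 addnA.
- have -> : (q ^ 2 = #|[set p : F * F | xpredT (\rank (pencil M N p))]|)%N.
    by rewrite -mulnn -card_prod -[LHS]cardsT; apply: eq_card => p; rewrite !inE.
  by rewrite (S xpredT) !big_ord_recl big_ord0 /= c0 addn0 !addnA.
move=> g; rewrite (partition_big (fun p => inord (\rank (pencil M N p)) : 'I_4) xpredT) //=.
rewrite (eq_bigr (fun r : 'I_4 => c r * g r)%N) => [|r _].
  by rewrite !big_ord_recl big_ord0 /= c0 mul1n addn0 !addnA.
rewrite (eq_bigr (fun=> g r)) => [|p /eqP <-]; last by rewrite inordK ?ltnS ?rank_leq_row.
rewrite (eq_bigl (mem [set p | \rank (pencil M N p) == r])) => [|p].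
  by rewrite sum_nat_const.
rewrite !inE; apply/eqP/eqP => [<-|E]; first by rewrite inordK ?ltnS ?rank_leq_row.
by apply: val_inj; rewrite /= inordK ?ltnS ?rank_leq_row // E.
Qed.

Lemma bil_count_eq : (\sum_(p : F * F) bil_zeros (\rank (pencil M N p)) =
  q ^ 2 * bil_count + q * (q ^ 6 - bil_count))%N.
Proof.
have := double_count (fun x : 'rV[F]_3 * 'rV[F]_3 => bform M x.1 x.2) (fun x => bform N x.1 x.2).
rewrite /= card_prod !card_mx -expnD => <-; apply: eq_bigr => p _.
by rewrite /bil_zeros -card_bilinear_zeros; apply: eq_card => x; rewrite !inE bform_lin.
Qed.

Lemma herm_count_eq : (\sum_(p : F * F) herm_zeros F (\rank (pencil M N p)) =
  q ^ 2 * herm_count + q * (q ^ 6 - herm_count))%N.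
Proof.
have := double_count (fun l : 'rV[L]_3 => herm iota M l) (fun l => herm iota N l).
rewrite /= card_mx cL -expnM => <-; apply: eq_bigr => p _.
rewrite -(card_herm_zeros iota cL (pencil_tr p sM sN)).
by apply: eq_card => x; rewrite !inE herm_lin.
Qed.

Lemma bil_count_le : (bil_count <= q ^ 6)%N.
Proof. by apply: leq_trans (max_card _) _; rewrite card_prod !card_mx -expnD. Qed.

Lemma herm_count_le : (herm_count <= q ^ 6)%N.
Proof. by apply: leq_trans (max_card _) _; rewrite card_mx cL -expnM. Qed.

End Equations.

(** * Counting the conics of a web *)

Lemma qformZ (R : comNzRingType) (c : R) a : qform (c *: a) = c *: qform a.
Proof.
rewrite /qform scaler_sumr; apply: eq_bigr => k _.
by rewrite mxE scalerA.
Qed.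

Lemma gqZ (R : comNzRingType) (c : R) G : gq (c *: G) = c *: gq G.
Proof. by apply/rowP; elim/ord6P; rewrite !mxE /= ?mulrDr. Qed.

Lemma gq_tr (R : comNzRingType) (G : 'M[R]_3) : gq G^T = gq G.
Proof. by apply/rowP; elim/ord6P; rewrite !mxE //= addrC. Qed.

Lemma map_qform (R S : comNzRingType) (f : {rmorphism R -> S}) a :
  map_mpoly f (qform a) = qform (map_mx f a).
Proof.
apply/mpolyP => m; rewrite mcoeff_map_mpoly /qform !raddf_sum /=; apply: eq_bigr => k _.
by rewrite /= !mcoeffZ !mcoeffX mxE rmorphM rmorph_nat.
Qed.

Lemma free2P (K : fieldType) n (l m : 'rV[K]_n) :
  reflect (m != 0 /\ forall k, l != k *: m) (free [:: l; m]).
Proof.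
rewrite free_cons span_seq1 /= andbC free_cons span_nil memv0 nil_free andbT.
apply: (iffP andP) => -[m0 H]; split=> //.
  by move=> k; apply: contraNneq H => ->; apply/vlineP; exists k.
by apply/vlineP => -[k E]; case/eqP: (H k).
Qed.

(** Unique factorisation of products of linear forms. With l moved to e0, the coefficients of X1^2,
    X1 X2 and X2^2 in the second product vanish, so one of its factors is a multiple of X0. *)
Lemma gq_mul_unique (K : finFieldType) (l m l' m' : 'rV[K]_3) :
  l != 0 -> l' != 0 -> m' != 0 -> gq (l^T *m m) = gq (l'^T *m m') ->
  exists2 c, c != 0 & (l' = c *: l /\ m = c *: m') \/ (m' = c *: l /\ m = c *: l').
Proof.
move=> l0 l'0 m'0 E; have [A Au El] := e0_completion l0.
have lA : l *m invmx A = rv3 1 0 0 by rewrite -El mulmxK.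
pose L := l' *m invmx A; pose N := m' *m invmx A; pose n := m *m invmx A.
have back (x y : 'rV[K]_3) c : x *m invmx A = c *: (y *m invmx A) -> x = c *: y.
  by move=> /(congr1 (mulmx^~ A)); rewrite /= -scalemxAl !mulmxKV.
have nz (x : 'rV[K]_3) : x != 0 -> x *m invmx A != 0.
  move=> x0; apply: contraNneq x0 => x0; apply/eqP.
  by rewrite -[x](mulmxKV Au) x0 mul0mx.
have E1 : gq ((rv3 1 0 0)^T *m n) = gq (L^T *m N).
  have P (x y : 'rV[K]_3) : (x *m invmx A)^T *m (y *m invmx A) =
      (invmx A)^T *m (x^T *m y) *m invmx A by rewrite trmx_mul !mulmxA.
  by rewrite -lA /n /L /N !P -gq_congr_upper E gq_congr_upper.
have key (k P Q : 'rV[K]_3) : gq ((rv3 1 0 0)^T *m k) = gq (P^T *m Q) ->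
    P 0 i1 = 0 -> P 0 i2 = 0 -> P = P 0 i0 *: rv3 1 0 0 /\ k = P 0 i0 *: Q.
  move=> /rowP EQ P1 P2; split.
    by rewrite {1}[P]rv3E; exact: e0_axis.
  move: (EQ 'o0) (EQ 'o1) (EQ 'o2); rewrite !mxE /= !(big_ord1, mxE) /= P1 P2.
  rewrite !mul1r !mul0r !addr0 => e0 e1 e2.
  by apply/rowP; elim/ord3P; rewrite !mxE ?e0 ?e1 ?e2.
have fin (x y : 'rV[K]_3) : x != 0 -> (x *m invmx A) 0 i1 = 0 -> (x *m invmx A) 0 i2 = 0 ->
    gq ((rv3 1 0 0)^T *m n) = gq ((x *m invmx A)^T *m (y *m invmx A)) ->
    exists2 c, c != 0 & x = c *: l /\ m = c *: y.
  move=> x0 x1 x2 /key /(_ x1 x2) [H1 H2]; exists ((x *m invmx A) 0 i0).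
    by apply: contraNneq (nz _ x0) => c0; rewrite H1 c0 scale0r.
  by split; apply: back; rewrite ?lA.
have EL : L 0 i1 * N 0 i1 = 0 by move/rowP/(_ 'o3): E1; rewrite !mxE /= !(big_ord1, mxE) /= mul0r.
have EM : L 0 i2 * N 0 i2 = 0 by move/rowP/(_ 'o5): E1; rewrite !mxE /= !(big_ord1, mxE) /= mul0r.
have EC : L 0 i1 * N 0 i2 + L 0 i2 * N 0 i1 = 0.
  by move/rowP/(_ 'o4): E1; rewrite !mxE /= !(big_ord1, mxE) /= !mul0r addr0.
have [h|h] : (L 0 i1 = 0 /\ L 0 i2 = 0) \/ (N 0 i1 = 0 /\ N 0 i2 = 0).
  have [L1|L1] := eqVneq (L 0 i1) 0.
    have [L2|L2] := eqVneq (L 0 i2) 0; [by left|right].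
    move/eqP: EM EC; rewrite mulf_eq0 (negPf L2) => /eqP N2; rewrite L1 mul0r add0r => /eqP.
    by rewrite mulf_eq0 (negPf L2) => /eqP ->.
  right; move/eqP: EL EC; rewrite mulf_eq0 (negPf L1) => /eqP N1.
  by rewrite N1 mulr0 addr0 => /eqP; rewrite mulf_eq0 (negPf L1) => /eqP ->.
- by have [c c0 H] := fin l' m' l'0 h.1 h.2 E1; exists c => //; left.
- have [|c c0 H] := fin m' l' m'0 h.1 h.2; last by exists c => //; right.
  by rewrite E1 -gq_tr trmx_mul trmxK.
Qed.

Section Types.

Variables (F L : finFieldType) (iota : {rmorphism F -> L}).
Hypothesis cL : #|L| = (#|F| ^ 2)%N.
Local Notation q := #|F|.
Local Notation cj := (@conj_form F L).
Implicit Types a : 'rV[F]_6.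

Lemma double_lineP a :
  reflect (exists c (l : 'rV[F]_3), [/\ c != 0, l != 0 & a = c *: gq (l^T *m l)]) (double_line a).
Proof.
apply: (iffP existsP) => [[c /existsP[l /and3P[c0 l0 /eqP E]]]|[c [l [c0 l0 ->]]]].
  exists c, l; split=> //; apply: qform_inj.
  by rewrite E expr2 lformM qformZ.
exists c; apply/existsP; exists l; rewrite c0 l0 /=.
by rewrite qformZ -lformM expr2.
Qed.

Lemma real_linesP a :
  reflect (exists l m : 'rV[F]_3, free [:: l; m] /\ a = gq (l^T *m m)) (real_lines a).
Proof.
apply: (iffP existsP) => [[l /existsP[m /andP[f /eqP E]]]|[l [m [f ->]]]].
  by exists l, m; split=> //; apply: qform_inj; rewrite E lformM.
by exists l; apply/existsP; exists m; rewrite f lformM eqxx.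
Qed.

Lemma map_gq (c : F) (l : 'rV[L]_3) a :
  (map_mpoly iota (qform a) == iota c *: (lform l * lform (cj l))) =
  (map_mx iota a == iota c *: gq (l^T *m cj l)).
Proof. by rewrite map_qform lformM -qformZ (inj_eq (@qform_inj L)). Qed.

(** The scalar c is the norm of some x, so replacing l by x l absorbs it. *)
Lemma imaginary_linesP a :
  reflect (exists l : 'rV[L]_3, free [:: l; cj l] /\ map_mx iota a = gq (l^T *m cj l))
    (imaginary_lines iota a).
Proof.
apply: (iffP existsP) => [[c /existsP[l /and3P[c0 f]]]|[l [f E]]].
  rewrite map_gq => /eqP E; have [x nx] := norm_surj iota cL c.
  have x0 : x != 0 by rewrite -(norm_eq0 iota cL) nx.
  exists (x *: l); rewrite (conj_formZ F); split.
    have [m0 H] := free2P _ _ f; apply/free2P; split; first by rewrite scaler_eq0 expf_eq0 negb_or negb_and x0 m0 orbT.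
    move=> k; apply/eqP => E'; case/eqP: (H (x^-1 * k * x ^+ q)).
    by rewrite -!scalerA -E' scalerA mulVf // scale1r.
  rewrite E -nx (normE iota cL) -gqZ; congr gq.
  have -> : (x *: l)^T = x *: l^T by rewrite linearZ.
  by rewrite -scalemxAl -scalemxAr scalerA.
exists 1; apply/existsP; exists l; rewrite oner_eq0 f /= map_gq E rmorph1.
by rewrite scale1r.
Qed.

Lemma double_line_scale c a : c != 0 -> double_line a -> double_line (c *: a).
Proof.
move=> c0 /double_lineP[d [l [d0 l0 ->]]]; apply/double_lineP; exists (c * d), l.
by rewrite scalerA mulf_neq0.
Qed.

Lemma free_scale (K : fieldType) n (c : K) (l m : 'rV[K]_n) : c != 0 ->
  free [:: l; m] -> free [:: c *: l; m].
Proof.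
move=> c0 /free2P[m0 H]; apply/free2P; split=> // k; apply/eqP => E.
by case/eqP: (H (c^-1 * k)); rewrite -scalerA -E scalerA mulVf // scale1r.
Qed.

Lemma real_lines_scale c a : c != 0 -> real_lines a -> real_lines (c *: a).
Proof.
move=> c0 /real_linesP[l [m [f ->]]]; apply/real_linesP; exists (c *: l), m; split.
  exact: free_scale.
have -> : (c *: l)^T = c *: l^T by rewrite linearZ.
by rewrite -scalemxAl gqZ.
Qed.

Lemma imaginary_lines_scale c a : c != 0 -> imaginary_lines iota a -> imaginary_lines iota (c *: a).
Proof.
move=> c0 /existsP[d /existsP[l /and3P[d0 f]]]; rewrite map_gq => /eqP E.
apply/existsP; exists (c * d); apply/existsP; exists l; rewrite mulf_neq0 // f map_gq.
by rewrite map_mxZ E scalerA rmorphM eqxx.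
Qed.

Lemma scale_inv (P : pred 'rV[F]_6) : (forall c a, c != 0 -> P a -> P (c *: a)) ->
  forall c a, c != 0 -> P (c *: a) = P a.
Proof.
move=> H c a c0; apply/idP/idP; last exact: H.
by move/(H c^-1); rewrite invr_eq0 scalerA mulVf // scale1r; apply.
Qed.

Lemma nonsingular_scale c a : c != 0 -> nonsingular_conic iota a -> nonsingular_conic iota (c *: a).
Proof.
move=> c0; rewrite /nonsingular_conic scaler_eq0 negb_or c0.
have -> : double_line (c *: a) = double_line a := scale_inv double_line_scale a c0.
have -> : real_lines (c *: a) = real_lines a := scale_inv real_lines_scale a c0.
have -> : imaginary_lines iota (c *: a) = imaginary_lines iota a :=
  scale_inv imaginary_lines_scale a c0.
by [].
Qed.

Definition forms_of (W : {vspace 'rV[F]_6}) (P : pred 'rV[F]_6) : {set 'rV[F]_6} :=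
  [set a | [&& a \in W, a != 0 & P a]].

Lemma card_forms_of W (P : pred 'rV[F]_6) : (forall c a, c != 0 -> P a -> P (c *: a)) ->
  #|forms_of W P| = (nb_conics W P * (q - 1))%N.
Proof.
move=> H; rewrite card_scaled; first last.
- move=> c a c0; rewrite !inE scaler_eq0 negb_or c0 => /and3P[aW a0 Pa].
  by rewrite memvZ // a0 H.
- by rewrite inE eqxx andbF.
congr muln; rewrite /nb_conics; apply: eq_card => x; apply/imsetP/imsetP => -[a aS ->];
  by exists a; rewrite // !inE in aS *.
Qed.

Lemma gq_outer_neq0 (K : finFieldType) (l m : 'rV[K]_3) : l != 0 -> m != 0 -> gq (l^T *m m) != 0.
Proof.
move=> l0 m0; apply/eqP => E.
have E2 : gq (l^T *m 0) = gq (l^T *m m).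
  by rewrite mulmx0 E; apply/rowP; elim/ord6P; rewrite !mxE /= ?addr0.
have [c c0 [[_ /esym/eqP]|[Em /esym/eqP]]] := gq_mul_unique l0 l0 m0 E2.
  by rewrite scaler_eq0 (negPf c0) (negPf m0).
by rewrite scaler_eq0 (negPf c0) (negPf l0).
Qed.

Lemma free_neq0 (K : fieldType) n (l m : 'rV[K]_n) : free [:: l; m] -> l != 0 /\ m != 0.
Proof. by move=> /free2P[m0 H]; split=> //; have := H 0; rewrite scale0r. Qed.

Lemma double_not_real a : double_line a -> ~~ real_lines a.
Proof.
move=> /double_lineP[c [l [c0 l0 ->]]]; apply/negP => /real_linesP[l' [m' [f E]]].
have [l'0 m'0] := free_neq0 f; have [_ nf] := free2P _ _ f.
have E2 : gq (l^T *m (c *: l)) = gq (l'^T *m m') by rewrite -scalemxAr gqZ.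
have [d d0 [[E3 E4]|[E3 E4]]] := gq_mul_unique l0 l'0 m'0 E2.
  case/eqP: (nf (d * c^-1 * d)); rewrite E3 -!scalerA -E4 [X in _ = d *: X]scalerA.
  by rewrite mulVf // scale1r.
case/eqP: (nf (d^-1 * c * d^-1)); rewrite E3 -!scalerA [d^-1 *: (d *: _)]scalerA.
by rewrite mulVf // scale1r E4 scalerA mulVf // scale1r.
Qed.

End Types.

Section Distribution.

Variables (F L : finFieldType) (iota : {rmorphism F -> L}).
Hypothesis cL : #|L| = (#|F| ^ 2)%N.
Local Notation q := #|F|.
Local Notation cj := (@conj_form F L).
Local Notation im := (map_mx iota).
Implicit Types a : 'rV[F]_6.

Lemma map_gq_mx (G : 'M[F]_3) : im (gq G) = gq (im G).
Proof. by apply/rowP; elim/ord6P; rewrite !mxE /= ?rmorphD ?mxE. Qed.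

Lemma map_gq_outer (l m : 'rV[F]_3) : im (gq (l^T *m m)) = gq ((im l)^T *m im m).
Proof.
rewrite map_gq_mx map_mxM; congr (gq (_ *m _)).
by apply/matrixP => i j; rewrite !mxE.
Qed.

Lemma conj_rational d (x : 'rV[F]_3) : cj (d *: im x) = d ^+ q *: im x.
Proof. by rewrite (conj_formZ F); congr (_ *: _); apply/rowP => i; rewrite !mxE frob_iota. Qed.

Lemma rational_not_free d (x : 'rV[F]_3) l : l = d *: im x -> ~~ free [:: l; cj l].
Proof.
move=> ->; rewrite conj_rational; apply/negP => /free2P[nz H].
have d0 : d ^+ q != 0 by apply: contraNneq nz => ->; rewrite scale0r.
by case/eqP: (H (d / d ^+ q)); rewrite scalerA divfK.
Qed.

Lemma conj_rational_not_free d (x : 'rV[F]_3) l : cj l = d *: im x -> ~~ free [:: l; cj l].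
Proof.
move=> E; apply: (@rational_not_free (d ^+ q) x).
by rewrite -(conj_formK cL l) E conj_rational.
Qed.

Lemma im_neq0 (l : 'rV[F]_3) : l != 0 -> im l != 0.
Proof. by rewrite map_mx_eq0. Qed.

Lemma product_not_imaginary a (l m : 'rV[F]_3) : l != 0 -> m != 0 -> a = gq (l^T *m m) ->
  ~~ imaginary_lines iota a.
Proof.
move=> l0 m0 ->; apply/negP => /(imaginary_linesP iota cL)[n [f]]; rewrite map_gq_outer => E.
have [n0 n'0] := free_neq0 f.
have [d d0 [[E1 _]|[E1 _]]] := gq_mul_unique (im_neq0 l0) n0 n'0 E.
  by case/negP: (rational_not_free E1).
by case/negP: (conj_rational_not_free E1).
Qed.

Lemma real_not_imaginary a : real_lines a -> ~~ imaginary_lines iota a.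
Proof.
move=> /real_linesP[l [m [/free_neq0[l0 m0] E]]]; exact: product_not_imaginary E.
Qed.

Lemma double_not_imaginary a : double_line a -> ~~ imaginary_lines iota a.
Proof.
move=> /double_lineP[c [l [c0 l0 E]]]; apply: (@product_not_imaginary _ l (c *: l)) => //.
  by rewrite scaler_eq0 negb_or c0.
by rewrite -scalemxAr gqZ.
Qed.

(** The first three types exclude one another by unique factorisation and the fourth is their
    complement, so they partition the q^4 - 1 nonzero forms of [W]. *)
Lemma card_web_forms W : web W ->
  ((nb_conics W (@double_line F) + nb_conics W (@real_lines F) + nb_conics W (imaginary_lines iota)
   + nb_conics W (nonsingular_conic iota)) * (q - 1) = q ^ 4 - 1)%N.
Proof.
move=> dW; rewrite !mulnDl.
rewrite -(card_forms_of W (@double_line_scale F)) -(card_forms_of W (@real_lines_scale F)).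
rewrite -(card_forms_of W (@imaginary_lines_scale F L iota)).
rewrite -(card_forms_of W (@nonsingular_scale F L iota)).
have <- : #|W| = (q ^ 4)%N by rewrite card_vspace dW.
rewrite [in RHS](cardD1 0) mem0v add1n subn1 /=.
have cs (A : {set 'rV[F]_6}) : #|A| = (\sum_a (a \in A))%N.
  by rewrite -sum1_card big_mkcond; apply: eq_bigr => a _; case: (a \in A).
rewrite -[RHS]cardsE !cs -!big_split /=; apply: eq_bigr => a _.
rewrite !inE /nonsingular_conic; case: (a \in W); rewrite ?andbF //= andbT.
case: (a != 0) => //=.
have := @double_not_real F a; have := @double_not_imaginary a; have := @real_not_imaginary a.
move=> RI DI DR; have [d|_] := boolP (double_line a).
  by rewrite (negPf (DI d)) (negPf (DR d)).
have [r|_] := boolP (real_lines a); first by rewrite (negPf (RI r)).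
by case: (imaginary_lines iota a).
Qed.

Lemma scale_vec_inj (K : fieldType) n (v : 'rV[K]_n) c d : v != 0 -> c *: v = d *: v -> c = d.
Proof.
move=> v0 /eqP; rewrite -subr_eq0 -scalerBl scaler_eq0 (negPf v0) orbF subr_eq0.
by move/eqP.
Qed.

Section Pencil.

Variables (W : {vspace 'rV[F]_6}) (M N : 'M[F]_3).
Hypothesis WP : web_pencil W M N.

Lemma outer_in_web (l m : 'rV[F]_3) :
  (gq (l^T *m m) \in W) = (bform M l m == 0) && (bform N l m == 0).
Proof. by case: WP => sM sN _ ->; rewrite !inc_mul. Qed.

Lemma double_in_web c (l : 'rV[F]_3) : c != 0 -> (c *: gq (l^T *m l) \in W) = base M N l.
Proof. by move=> c0; rewrite rpredZeq (negPf c0) outer_in_web. Qed.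

Lemma herm_in_web a (l : 'rV[L]_3) : im a = gq (l^T *m cj l) ->
  (a \in W) = (herm iota M l == 0) && (herm iota N l == 0).
Proof.
case: WP => sM sN _ -> E.
have K X : X^T = X -> inc a X = herm iota X l.
  move=> sX; apply: (fmorph_inj iota); rewrite hermE //.
  have <- : inc (im a) (im X) = iota (inc a X).
    by rewrite /inc !mxE !rmorphD !rmorphM.
  rewrite E inc_mul //; apply/matrixP => i j; rewrite !mxE -[in LHS]sX mxE //.
by rewrite !K.
Qed.

Lemma card_nonzero_base : #|[set l | base M N l && (l != 0)]| = (base_count M N - 1)%N.
Proof.
have b0 : base M N 0 by rewrite /base !bform0 eqxx.
rewrite /base_count (cardsD1 (0 : 'rV[F]_3) [set l | base M N l]) inE b0.
by rewrite add1n subn1 /=; apply: eq_card => l; rewrite !inE andbC.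
Qed.

(** The form c l^2 comes from exactly the q - 1 pairs (c / d^2, d l), and it lies in [W] exactly
    when l is a base point. *)
Lemma card_double : #|forms_of W (@double_line F)| = (base_count M N - 1)%N.
Proof.
pose f (x : F * 'rV[F]_3) := x.1 *: gq (x.2^T *m x.2).
pose A := [set x : F * 'rV[F]_3 | (x.1 != 0) && (base M N x.2 && (x.2 != 0))].
have cA : #|A| = ((q - 1) * (base_count M N - 1))%N.
  rewrite -card_nonzero_base subn1 -(cardsC1 (0 : F)) -cardsX; apply: eq_card => -[c l].
    by rewrite !inE.
have fA : f @: A = forms_of W (@double_line F).
  apply/setP => a; rewrite !inE; apply/imsetP/and3P => [[[c l] + ->]|[aW a0 /double_lineP]].
    rewrite inE /= => /and3P[c0 bl l0]; rewrite /f /= double_in_web // bl.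
    split=> //; first by rewrite scaler_eq0 negb_or c0 gq_outer_neq0.
    by apply/double_lineP; exists c, l.
  case=> c [l [c0 l0 E]]; exists (c, l) => //.
  by rewrite inE /= c0 l0 andbT -(double_in_web l c0) -E.
have := @card_fibres _ _ f A (q - 1).
rewrite fA cA mulnC => /(_ _)/eqP; rewrite eqn_pmul2r ?subn_gt0 ?card_ge2 // => H; apply/esym/eqP/H.
move=> [c l]; rewrite inE /= => /and3P[c0 bl l0].
pose g (d : F) := (c / d ^+ 2, d *: l).
have gi : injective g by move=> d d' [_ /(scale_vec_inj l0)].
rewrite subn1 -(cardC1 (0 : F)) -(card_imset _ gi); apply: eq_card => -[c' l'].
rewrite !inE /f /=; apply/andP/imsetP => [[/and3P[c'0 bl' l'0] /eqP E]|[d]].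
  rewrite -!gqZ !scalemxAr in E.
  have cl : c *: l != 0 by rewrite scaler_eq0 negb_or c0.
  have [d d0 [[El E2]|[El E2]]] := gq_mul_unique l'0 l0 cl E.
    exists (d^-1); first by rewrite inE invr_eq0.
    rewrite /g El scalerA mulVf // scale1r; congr pair.
    by apply: (scale_vec_inj l'0); rewrite E2 El !scalerA; congr (_ *: _); field; rewrite d0 oner_eq0.
  have El' : l' = (c / d) *: l.
    by rewrite [c / d]mulrC -scalerA El scalerA mulVf // scale1r.
  exists (c / d); first by rewrite inE mulf_neq0 ?invr_eq0.
  rewrite /g -El'; congr pair; apply: (scale_vec_inj l'0); rewrite E2 El' scalerA.
  by congr (_ *: _); field; rewrite ?c0 ?d0.
rewrite inE => d0 [-> ->]; have -> : c / d ^+ 2 != 0 by rewrite mulf_neq0 ?invr_eq0 ?expf_neq0.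
rewrite scaler_eq0 negb_or d0 l0 base_scale //; split=> //; apply/eqP.
have -> : (d *: l)^T = d *: l^T by rewrite linearZ.
rewrite -scalemxAl -scalemxAr !gqZ !scalerA; congr (_ *: _); by field.
Qed.

(** An independent pair of common zeros (l, m) gives the form l m, which comes from 2 (q - 1) such
    pairs. The dependent pairs are the q^3 pairs (l, 0) and the pairs (c x, x) with x nonzero and
    either c = 0 or x a base point. *)
Lemma card_real : (bil_count M N =
  #|forms_of W (@real_lines F)| * (2 * (q - 1)) + (2 * q ^ 3 - 1)
  + (q - 1) * (base_count M N - 1))%N.
Proof.
pose f (x : 'rV[F]_3 * 'rV[F]_3) := gq (x.1^T *m x.2).
pose A := [set x : 'rV[F]_3 * 'rV[F]_3 | free [:: x.1; x.2] &&
   ((bform M x.1 x.2 == 0) && (bform N x.1 x.2 == 0))].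
have fA : f @: A = forms_of W (@real_lines F).
  apply/setP => a; rewrite !inE; apply/imsetP/and3P => [[[l m] + ->]|[aW a0 /real_linesP]].
    rewrite inE /= => /andP[fr b]; rewrite /f /= outer_in_web b.
    have [l0 m0] := free_neq0 fr; split=> //; first exact: gq_outer_neq0.
    by apply/real_linesP; exists l, m.
  case=> l [m [fr E]]; exists (l, m) => //.
  by rewrite inE /= fr -outer_in_web -E.
have cA : #|A| = (#|forms_of W (@real_lines F)| * (2 * (q - 1)))%N.
  rewrite -fA; apply: card_fibres => -[l m]; rewrite inE /= => /andP[fr b].
  have [l0 m0] := free_neq0 fr; have [_ nf] := free2P _ _ fr.
  pose g (x : bool * F) := if x.1 then (x.2 *: l, x.2^-1 *: m) else (x.2 *: m, x.2^-1 *: l).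
  have cD : #|[set x : bool * F | x.2 != 0]| = (2 * (q - 1))%N.
    rewrite subn1 -(cardsC1 (0 : F)) -card_bool -cardsT -cardsX.
    by apply: eq_card => -[x y]; rewrite !inE.
  have gi : {in [set x : bool * F | x.2 != 0] &, injective g}.
    move=> [[] c] [[] d]; rewrite !inE /g /= => c0 d0 [E _].
    - by rewrite (scale_vec_inj l0 E).
    - by case/eqP: (nf (c^-1 * d)); rewrite -scalerA -E scalerA mulVf // scale1r.
    - by case/eqP: (nf (d^-1 * c)); rewrite -scalerA E scalerA mulVf // scale1r.
    - by rewrite (scale_vec_inj m0 E).
  rewrite -cD -(card_in_imset gi); apply: eq_card => -[l' m'].
  rewrite !inE /f /=; apply/andP/imsetP => [[/andP[fr' b'] /eqP E]|[[e d]]].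
    have [l'0 m'0] := free_neq0 fr'.
    have [d d0 [[El Em]|[El Em]]] := gq_mul_unique l0 l'0 m'0 (esym E).
      by exists (true, d); rewrite ?inE // /g /= El Em scalerA mulVf // scale1r.
    by exists (false, d^-1); rewrite ?inE ?invr_eq0 // /g /= invrK El Em scalerA mulVf // scale1r.
  rewrite inE /= => d0 E; have Ef : gq (l'^T *m m') = gq (l^T *m m).
    have T c (x : 'rV[F]_3) : (c *: x)^T = c *: x^T by rewrite linearZ.
    move: E; rewrite /g; case: e => -[-> ->]; rewrite T -scalemxAl -scalemxAr scalerA divff // scale1r //.
    by rewrite -gq_tr trmx_mul trmxK.
  rewrite -outer_in_web Ef outer_in_web b andbT eqxx; split=> //; apply/free2P.
  have d1 : d^-1 != 0 by rewrite invr_eq0.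
  move: E; rewrite /g; case: e => -[-> ->]; rewrite scaler_eq0 negb_or d1 ?m0 ?l0; split=> // k.
    apply/eqP => E; case/eqP: (nf (d^-1 * k * d^-1)).
    by rewrite -!scalerA -E scalerA mulVf // scale1r.
  apply/eqP => E; have k0 : k != 0.
    by apply: contraNneq m0 => k0; move/eqP: E; rewrite k0 scale0r scaler_eq0 (negPf d0).
  case/eqP: (nf (d * k^-1 * d)); rewrite -!scalerA E [k^-1 *: _]scalerA mulVf // scale1r scalerA divff //.
  by rewrite scale1r.
have Sp : bil_count M N = (#|A| + #|[set x : 'rV[F]_3 * 'rV[F]_3 | ~~ free [:: x.1; x.2] &&
   ((bform M x.1 x.2 == 0%R) && (bform N x.1 x.2 == 0%R))]|)%N.
  rewrite -cardsUI; set B := [set x | ~~ _ & _]; have -> : A :&: B = set0.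
    by apply/setP => x; rewrite !inE; case: (free _); rewrite ?andbF.
  by rewrite cards0 addn0; apply: eq_card => x; rewrite !inE; case: (free _); rewrite /= ?orbF.
rewrite Sp cA -addnA; congr addn.
pose g (x : F * 'rV[F]_3) : 'rV[F]_3 * 'rV[F]_3 := (x.1 *: x.2, x.2).
pose B0 := [set (l, 0) | l : 'rV[F]_3] : {set 'rV[F]_3 * 'rV[F]_3}.
pose D := [set x : F * 'rV[F]_3 | (x.2 != 0) && ((x.1 == 0) || base M N x.2)].
have gi : {in D &, injective g}.
  move=> [c l] [d m]; rewrite !inE /g /= => /andP[l0 _] _ [E El].
  by rewrite -El in E *; rewrite (scale_vec_inj l0 E).
have bz (X : 'M[F]_3) (l : 'rV[F]_3) : bform X l 0 = 0.
  by rewrite /bform trmx0 mulmx0 mxE.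
have bs (X : 'M[F]_3) c (l : 'rV[F]_3) : bform X (c *: l) l = c * bform X l l.
  by rewrite /bform -!scalemxAl mxE.
have -> : [set x : 'rV[F]_3 * 'rV[F]_3 | ~~ free [:: x.1; x.2] &&
   ((bform M x.1 x.2 == 0) && (bform N x.1 x.2 == 0))] = B0 :|: g @: D.
  apply/setP => -[l m]; rewrite !inE /=; apply/andP/orP.
    case=> nf b; have [m0|m0] := eqVneq m 0.
      by left; apply/imsetP; exists l; rewrite ?m0.
    right; move: nf; rewrite free_cons span_seq1 seq1_free m0 andbT negbK => /vlineP[c El].
    apply/imsetP; exists (c, m); last by rewrite /g /= El.
    by move: b; rewrite inE /= m0 El !bs !mulf_eq0 -orb_andr.
  case=> [/imsetP[l' _ [-> ->]]|/imsetP[[c x] + [-> ->]]].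
    by rewrite !bz eqxx free_cons seq1_free eqxx andbF.
  rewrite inE /= => /andP[x0 h]; rewrite !bs !mulf_eq0 -orb_andr; split=> //.
  by rewrite free_cons span_seq1 negb_and negbK; apply/orP; left; apply/vlineP; exists c.
have disj : B0 :&: g @: D = set0.
  apply/setP => -[l m]; rewrite !inE; apply/negP => /andP[/imsetP[x _ [_ ->]] /imsetP[[c y] + [_ E]]].
  by rewrite inE /= -E eqxx.
have := cardsUI B0 (g @: D); rewrite disj cards0 addn0 => ->.
rewrite card_imset; last by move=> x y [].
rewrite card_in_imset // card_mx mul1n.
have -> : #|D| = ((q ^ 3 - 1) + (q - 1) * (base_count M N - 1))%N.
  rewrite (card_setX_sum (fun c l => (l != 0) && ((c == 0) || base M N l))).
  rewrite (bigD1 (0 : F)) //=; congr addn.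
    rewrite -[3%N]/(1 * 3)%N -card_mx subn1 -(cardC1 (0 : 'rV[F]_3)); apply: eq_card => l.
    by rewrite !inE eqxx andbT.
  rewrite (eq_bigr (fun=> base_count M N - 1)%N) => [|c c0].
    have -> : (q - 1)%N = #|predC1 (0 : F)| by rewrite cardC1 subn1.
    by rewrite sum_nat_const; congr muln; apply: eq_card => c; rewrite !inE.
  by rewrite -card_nonzero_base; apply: eq_card => l; rewrite !inE (negPf c0) andbC.
have q3 : (0 < q ^ 3)%N by rewrite expn_gt0 (ltnW (card_ge2 F)).
by rewrite addnA addnBA // mul2n -addnn.
Qed.

End Pencil.
End Distribution.

(** * Pairs of imaginary lines and common zeros of Hermitian forms *)

Section Imaginary.

Variables (F L : finFieldType) (iota : {rmorphism F -> L}).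
Hypothesis cL : #|L| = (#|F| ^ 2)%N.
Local Notation q := #|F|.
Local Notation cj := (@conj_form F L).
Local Notation im := (map_mx iota).
Variables (W : {vspace 'rV[F]_6}) (M N : 'M[F]_3).
Hypothesis WP : web_pencil W M N.

Lemma descend_conj (l : 'rV[L]_3) : cj l = l -> im (map_mx (descend iota) l) = l.
Proof.
by move=> /rowP E; apply/rowP => i; have := E i; rewrite !mxE => Ei; rewrite descendK.
Qed.

Lemma im_inj : injective (fun l : 'rV[F]_3 => im l).
Proof. exact: map_mx_inj. Qed.

Lemma im_inj6 : injective (fun l : 'rV[F]_6 => im l).
Proof. exact: map_mx_inj. Qed.

(* Coefficients of l * conj l are fixed by Frobenius. *)
Lemma descend_gq (l : 'rV[L]_3) :
  im (map_mx (descend iota) (gq (l^T *m cj l))) = gq (l^T *m cj l).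
Proof.
have fr (a b : L) : (a * b ^+ q) ^+ q = b * a ^+ q by rewrite exprMn (frobK cL) mulrC.
apply/rowP => k; rewrite [LHS]mxE [in LHS]mxE descendK //.
by move: k; elim/ord6P; rewrite !mxE /= !(big_ord1, mxE) ?(frobD iota) !fr // addrC.
Qed.

Lemma herm_rational X (l : 'rV[F]_3) c : X^T = X ->
  herm iota X (c *: im l) = norm iota c * bform X l l.
Proof.
move=> sX; rewrite hermZ //; congr (_ * _); apply: (fmorph_inj iota); rewrite hermE //.
rewrite sesqE bformE rmorph_sum; apply: eq_bigr => i _; rewrite rmorph_sum; apply: eq_bigr => j _.
by rewrite !mxE frob_iota !rmorphM.
Qed.

Lemma conj_form0 (l : 'rV[L]_3) : (cj l == 0) = (l == 0).
Proof.
apply/eqP/eqP => [E|->]; last by apply/rowP => i; rewrite !mxE (frob0 F).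
by rewrite -(conj_formK cL l) E; apply/rowP => i; rewrite !mxE (frob0 F).
Qed.

(** Dividing l by one of its nonzero coordinates makes it equal to its conjugate, hence rational. *)
Lemma not_free_rational (l : 'rV[L]_3) : l != 0 -> ~~ free [:: l; cj l] ->
  exists c x, [/\ c != 0, x != 0 & l = c *: im x].
Proof.
move=> l0; rewrite free_cons span_seq1 seq1_free conj_form0 l0 andbT negbK => /vlineP[k E].
have [i li] : exists i, l 0 i != 0.
  apply/existsP; apply: contraNT l0 => /existsPn H; apply/eqP/rowP => i.
  by have := H i; rewrite negbK mxE => /eqP.
pose m := (l 0 i)^-1 *: l.
have lm : l = l 0 i *: m by rewrite scalerA divff // scale1r.
have m1 : m 0 i = 1 by rewrite mxE mulVf.
have [k' Em] : exists k', m = k' *: cj m.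
  exists ((l 0 i)^-1 * k * (l 0 i) ^+ q).
  by rewrite /m (conj_formZ F) scalerA exprVn mulfK ?expf_neq0 // -scalerA -E.
have k1 : k' = 1.
  by move/rowP/(_ i): Em; rewrite !mxE -/(m 0 i) => Em; move: Em; rewrite mulVf // expr1n mulr1.
have cm : cj m = m by rewrite [RHS]Em k1 scale1r.
exists (l 0 i), (map_mx (descend iota) m); split=> //.
  by apply: contraNneq l0 => z; rewrite lm -(descend_conj cm) z map_mx0 scaler0.
by rewrite descend_conj.
Qed.

(** A common zero l independent of its conjugate gives the product of the two, which also comes from
    the multiples of l and of its conjugate by the q + 1 elements of norm 1. The other nonzero
    common zeros are multiples c x of nonzero base points, each with q - 1 such expressions. *)
Lemma card_imaginary : (herm_count iota M N =
  #|forms_of W (imaginary_lines iota)| * (2 * (q + 1)) + 1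
  + (q + 1) * (base_count M N - 1))%N.
Proof.
case: (WP) => sM sN _ _.
pose f (l : 'rV[L]_3) : 'rV[F]_6 := map_mx (descend iota) (gq (l^T *m cj l)).
pose A := [set l : 'rV[L]_3 | free [:: l; cj l] && ((herm iota M l == 0) && (herm iota N l == 0))].
have fA : f @: A = forms_of W (imaginary_lines iota).
  apply/setP => a; rewrite !inE; apply/imsetP/and3P => [[l + ->]|[aW a0 /(imaginary_linesP iota cL)]].
    rewrite inE => /andP[fr b]; rewrite (herm_in_web cL WP (descend_gq l)) b.
    have [l0 m0] := free_neq0 fr; split=> //.
      by apply: contraNneq (gq_outer_neq0 l0 m0) => z; rewrite -descend_gq -/(f l) z map_mx0.
    by apply/(imaginary_linesP iota cL); exists l; rewrite descend_gq.
  case=> l [fr E]; exists l; first by rewrite inE fr -(herm_in_web cL WP E).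
  by apply: im_inj6; rewrite /= descend_gq.
have cA : #|A| = (#|forms_of W (imaginary_lines iota)| * (2 * (q + 1)))%N.
  rewrite -fA; apply: card_fibres => l; rewrite inE => /andP[fr b].
  have [l0 m0] := free_neq0 fr; have [_ nf] := free2P _ _ fr.
  pose g (x : bool * L) : 'rV[L]_3 := x.2 *: (if x.1 then l else cj l).
  have cD : #|[set x : bool * L | norm iota x.2 == 1]| = (2 * (q + 1))%N.
    rewrite addn1 -(card_norm1 iota cL) -card_bool -cardsT -cardsX.
    by apply: eq_card => -[x y]; rewrite !inE.
  have n0 d : norm iota d == 1 -> d != 0.
    by move=> n1; rewrite -(norm_eq0 iota cL) (eqP n1) oner_eq0.
  have gi : {in [set x : bool * L | norm iota x.2 == 1] &, injective g}.
    move=> [[] c] [[] d]; rewrite !inE /g /= => /n0 c0 /n0 d0 E.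
    - by rewrite (scale_vec_inj l0 E).
    - by case/eqP: (nf (c^-1 * d)); rewrite -scalerA -E scalerA mulVf // scale1r.
    - by case/eqP: (nf (d^-1 * c)); rewrite -scalerA E scalerA mulVf // scale1r.
    - by rewrite (scale_vec_inj m0 E).
  have T c (x : 'rV[L]_3) : (c *: x)^T = c *: x^T by rewrite linearZ.
  have gE d e : norm iota d == 1 -> gq ((g (e, d))^T *m cj (g (e, d))) = gq (l^T *m cj l).
    move=> /eqP d1; have dd : d * d ^+ q = 1 by rewrite -(normE iota cL) d1 rmorph1.
    rewrite /g /= (conj_formZ F) T -scalemxAl -scalemxAr scalerA dd scale1r.
    by case: e; rewrite ?(conj_formK cL) // -gq_tr trmx_mul trmxK.
  rewrite -cD -(card_in_imset gi); apply: eq_card => l'.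
  rewrite !inE; apply/andP/imsetP => [[/andP[fr' b'] /eqP E]|[[e d]]].
    have [l'0 m'0] := free_neq0 fr'.
    have {}E : gq (l^T *m cj l) = gq (l'^T *m cj l') 
      by rewrite -[LHS]descend_gq -[RHS]descend_gq; exact: (congr1 (fun v : 'rV[F]_6 => im v) (esym E)).
    have [d d0 [[El Em]|[El Em]]] := gq_mul_unique l0 l'0 m'0 E.
      exists (true, d); rewrite ?inE //=; apply/eqP/(fmorph_inj iota).
      rewrite (normE iota cL) rmorph1; apply: (scale_vec_inj m0).
      by rewrite scale1r [RHS]Em El (conj_formZ F) scalerA.
    have El' : l' = d ^+ q *: cj l by rewrite -(conj_formK cL l') El (conj_formZ F).
    exists (false, d ^+ q); rewrite ?inE //=; apply/eqP/(fmorph_inj iota).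
    rewrite (normE iota cL) rmorph1 (frobK cL); apply: (scale_vec_inj m0).
    by rewrite scale1r [RHS]Em El' scalerA mulrC.
  rewrite inE => /= d1 ->; have d0 := n0 _ d1.
  have h : f (g (e, d)) = f l by rewrite /f gE.
  have fW : f (g (e, d)) \in W by rewrite h (herm_in_web cL WP (descend_gq l)) b.
  rewrite -(herm_in_web cL WP (descend_gq _)) fW andbT h eqxx; split=> //.
  rewrite /g /= (conj_formZ F); case: (e); rewrite ?(conj_formK cL).
    apply/free2P; split; first by rewrite scaler_eq0 expf_eq0 (negPf d0) andbF.
    move=> k; apply/eqP => E; case/eqP: (nf (d^-1 * k * d ^+ q)).
    by rewrite -!scalerA -E scalerA mulVf // scale1r.
  apply/free2P; split; first by rewrite scaler_eq0 expf_eq0 (negPf d0) andbF.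
  move=> k; apply/eqP => E; have k0 : k != 0.
    by apply: contraNneq m0 => k0; move/eqP: E; rewrite k0 scale0r scaler_eq0 (negPf d0).
  case/eqP: (nf ((k * d ^+ q)^-1 * d)); rewrite -scalerA E scalerA scalerA -mulrA mulVf ?scale1r //.
  by rewrite mulf_neq0 ?expf_neq0.
pose B := [set l : 'rV[L]_3 | [&& l != 0, ~~ free [:: l; cj l] & (herm iota M l == 0) && (herm iota N l == 0)]].
have Sp : herm_count iota M N = (#|A| + 1 + #|B|)%N.
  rewrite /herm_count (cardsD1 0) inE !(herm0 iota cL) // eqxx /= addnAC addnC; congr addn.
  rewrite -cardsUI; have -> : A :&: B = set0.
    by apply/setP => x; rewrite !inE; case: (free _); rewrite ?andbF.
  rewrite cards0 addn0; apply: eq_card => x; rewrite !inE.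
  have [->|x0] /= := eqVneq x 0; last by case: (free _); rewrite /= ?orbF.
  by rewrite orbF free_cons seq1_free conj_form0 eqxx andbF.
rewrite Sp cA; congr addn.
pose D := [set x : L * 'rV[F]_3 | (x.1 != 0) && (base M N x.2 && (x.2 != 0))].
pose g (x : L * 'rV[F]_3) : 'rV[L]_3 := x.1 *: im x.2.
have nb c (x : 'rV[F]_3) : c != 0 ->
    (herm iota M (c *: im x) == 0) && (herm iota N (c *: im x) == 0) = base M N x.
  by move=> c0; rewrite !herm_rational // !mulf_eq0 (norm_eq0 iota cL) (negPf c0).
have gD : g @: D = B.
  apply/setP => l; rewrite !inE; apply/imsetP/and3P => [[[c x] + ->]|[l0 nf h]].
    rewrite inE /= => /and3P[c0 bx x0]; rewrite /g /= nb // bx; split=> //.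
      by rewrite scaler_eq0 negb_or c0 im_neq0.
    exact: (rational_not_free (erefl _)).
  have [c [x [c0 x0 El]]] := not_free_rational l0 nf.
  by exists (c, x); rewrite // inE /= c0 x0 andbT -(nb c x c0) -El.
have cD : #|D| = ((q ^ 2 - 1) * (base_count M N - 1))%N.
  rewrite -card_nonzero_base -cL subn1 -(cardsC1 (0 : L)) -cardsX; apply: eq_card => -[c l].
  by rewrite !inE.
have K := @card_fibres _ _ g D (q - 1).
have {K} : #|D| = (#|B| * (q - 1))%N.
  rewrite -gD; apply: K => -[c x]; rewrite inE /= => /and3P[c0 bx x0].
  pose h (d : F) := (c / iota d, d *: x).
  have hi : injective h by move=> d d' [_ /(scale_vec_inj x0)].
  rewrite subn1 -(cardC1 (0 : F)) -(card_imset _ hi); apply: eq_card => -[c' x'].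
  rewrite !inE /g /=; apply/andP/imsetP => [[/and3P[c'0 bx' x'0] /eqP E]|[d]].
    have [i xi] : exists i, x 0 i != 0.
      apply/existsP; apply: contraNT x0 => /existsPn H; apply/eqP/rowP => i.
      by have := H i; rewrite negbK mxE => /eqP.
    pose d := x' 0 i / x 0 i.
    have Ed : c = c' * iota d.
      move/rowP/(_ i): E; rewrite !mxE => E; apply: (mulIf (_ : iota (x 0 i) != 0)).
        by rewrite fmorph_eq0.
      by rewrite -E -mulrA -rmorphM divfK.
    have d0 : d != 0 by apply: contraNneq c0 => d0; rewrite Ed d0 rmorph0 mulr0.
    exists d; rewrite ?inE // /h Ed mulfK ?fmorph_eq0 //; congr pair.
    apply: im_inj; apply: (scalerI c'0); rewrite /= map_mxZ scalerA -Ed; exact: E.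
  rewrite inE => d0 [-> ->]; have d1 : iota d != 0 by rewrite fmorph_eq0.
  rewrite mulf_neq0 ?invr_eq0 // scaler_eq0 negb_or d0 x0 base_scale //; split=> //.
  by rewrite map_mxZ scalerA divfK.
have q2 : (q ^ 2 - 1 = (q - 1) * (q + 1))%N by rewrite -subn_sqr exp1n.
rewrite cD q2 -mulnA mulnC [RHS]mulnC => /eqP.
by rewrite [X in X == _]mulnC eqn_pmul2l ?subn_gt0 ?card_ge2 // => /eqP <-.
Qed.

End Imaginary.

Lemma pred_mul_sqr_le (p : nat) : (1 < p -> (p - 1) * p ^ 2 <= p ^ 5)%N.
Proof. by move=> p2; rewrite (expnD p 3 2) leq_mul2r expnS; nia. Qed.

(** * The hyperplane-orbit distribution in terms of the three counts *)

Section Distribution.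

Variables (F L : finFieldType) (iota : {rmorphism F -> L}).
Hypothesis cL : #|L| = (#|F| ^ 2)%N.
Local Notation q := #|F|.

(** Evaluating the sums over the pencil by ranks and by common zeros expresses [bil_count] and
    [herm_count] through the rank counts; [card_real] and [card_imaginary] convert them to numbers
    of conics. *)
Lemma distribution_equations W (M N : 'M[F]_3) : web_pencil W M N ->
  let x : int := q%:Z in let h : int := (base_count M N)%:Z - 1 in
  let n1 : int := (rank_count 1 M N)%:Z in let n2 : int := (rank_count 2 M N)%:Z in
  [/\ (nb_conics W (@double_line F))%:Z * (x - 1) = h,
      (nb_conics W (@real_lines F))%:Z * (2 * (x - 1)) + h = x ^+ 3 - 1 + x * (x * (n1 - 1) + n2 - 1)
    & (nb_conics W (imaginary_lines iota))%:Z * (2 * (x - 1)) + h =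
        (x - 1) * (x ^+ 2 - x + 1) + x * (n2 - 1 - x * (n1 - 1))].
Proof.
move=> WP; case: (WP) => sM sN ind _ x h n1 n2.
have D1 := card_forms_of W (@double_line_scale F).
have D2 := card_forms_of W (@real_lines_scale F).
have D3 := card_forms_of W (@imaginary_lines_scale F L iota).
have E1 := card_double WP; have E2 := card_real WP; have E3 := card_imaginary iota cL WP.
have [c1 [c2 [c3 [C1 C2 C3 S]]]] := rank_classes ind.
have S2 := bil_count_eq M N; have S3 := herm_count_eq iota cL sM sN.
rewrite !S in S2 S3.
rewrite D1 in E1; rewrite D2 in E2; rewrite D3 in E3.
have b1 := bil_count_le M N; have b2 := herm_count_le iota cL M N.
have q2 := card_ge2 F.
have H1 : (0 < base_count M N)%N.
  apply/card_gt0P; exists 0; rewrite inE /base /bform trmx0 !mulmx0 mxE eqxx //.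
move: S2 S3; rewrite /bil_zeros /herm_zeros /= !subSS !subn0.
have le2 := pred_mul_sqr_le q2.
have le3 : (q ^ 2 <= q ^ 3)%N by rewrite leq_pexp2l // ltnW.
have le4 : (q ^ 1 <= q ^ 3)%N by rewrite leq_pexp2l // ltnW.
have le5 : (q ^ 0 <= q ^ 3)%N by rewrite leq_pexp2l // ltnW.
move: b1 b2 E1 E2 E3 C1 C2 C3; rewrite /h /n1 /n2 => {h n1 n2 D1 D2 D3 S}.
have le6 : (1 <= 2 * q ^ 3)%N by rewrite muln_gt0 expn_gt0 (ltnW q2).
move: (base_count M N) H1 (nb_conics W (@double_line F)) (nb_conics W (@real_lines F)) (nb_conics W (imaginary_lines iota)) (bil_count M N)
  (herm_count iota M N) (rank_count 1 M N) (rank_count 2 M N).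
move=> h h1 d r i B T n1 n2 b1 b2 E1 E2 E3 C1 C2 C3 S2 S3.
(* The equations move to the integers; the inequalities collected above make every subtraction of
   naturals exact. *)
pose z (m : nat) : int := m%:R.
have Z m : m%:Z = z m by rewrite /z natz.
have xE : x = z q := Z q.
have F1 : z d * (x - 1) = z h - 1.
  by move/(congr1 z): E1; rewrite xE /z natrM (natrB _ h1) (natrB _ (ltnW q2)).
have F2 : z B = z r * (x - 1) * (2 * (x - 1)) + (2 * x ^+ 3 - 1) + (x - 1) * (z h - 1).
  by move/(congr1 z): E2; rewrite xE /z !(natrD, natrM, natrX, natrB _ h1, natrB _ le6, natrB _ (ltnW q2)).
have F3 : z T = z i * (x - 1) * (2 * (x + 1)) + 1 + (x + 1) * (z h - 1).
  by move/(congr1 z): E3; rewrite xE /z !(natrD, natrM, natrX, natrB _ h1, natrB _ (ltnW q2)).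
have G1 : z n1 - 1 = z c1 by rewrite C1 /z natrD addrC addKr.
have G2 : z n2 = 1 + z c1 + z c2 by rewrite C2 /z !natrD.
have G3 : z c3 = x ^+ 2 - 1 - z c1 - z c2.
  by move/(congr1 z): C3; rewrite xE /z natrX !natrD => ->; ring.
have G4 : x ^+ 6 + z c1 * (2 * x ^+ 5 - x ^+ 4) + z c2 * (x ^+ 5 + x ^+ 4 - x ^+ 3)
    + z c3 * (x ^+ 5 + x ^+ 3 - x ^+ 2) = x ^+ 2 * z B + x * (x ^+ 6 - z B).
  move/(congr1 z): S2; rewrite xE /z subnn.
  rewrite !(natrD, natrM, natrX, natrB _ b1, natrB _ le3, natrB _ le4, natrB _ le5) => S2.
  by rewrite -[RHS]S2; ring.
have G5 : x ^+ 6 + z c1 * x ^+ 4 + z c2 * (x ^+ 5 + x ^+ 4 - x ^+ 3)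
    + z c3 * (x ^+ 5 - x ^+ 3 + x ^+ 2) = x ^+ 2 * z T + x * (x ^+ 6 - z T).
  move/(congr1 z): S3; rewrite xE /z.
  rewrite !(natrD, natrM, natrX, natrB _ b2, natrB _ le2, natrB _ (ltnW q2)) => S3.
  by rewrite -[RHS]S3; ring.
rewrite !Z F1 G1 G2.
have x0 : x != 0 by apply/eqP; rewrite /x; lia.
have x1 : x - 1 != 0 by apply/eqP; rewrite /x; lia.
have x2 : x + 1 != 0 by apply/eqP; rewrite /x; lia.
rewrite G3 in G4 G5.
have {}G4 : z B = x * (x ^+ 3 + x ^+ 2 - 1) + x * (x - 1) * ((x + 1) * z c1 + z c2).
  apply: (mulfI (mulf_neq0 x0 x1)); apply: (addIr (x ^+ 7)).
  transitivity (x ^+ 2 * z B + x * (x ^+ 6 - z B)); first by ring.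
  by rewrite -G4; ring.
have {}G5 : z T = x * (x ^+ 3 - x ^+ 2 + 1) + x * (x + 1) * (z c2 - (x - 1) * z c1).
  apply: (mulfI (mulf_neq0 x0 x1)); apply: (addIr (x ^+ 7)).
  transitivity (x ^+ 2 * z T + x * (x ^+ 6 - z T)); first by ring.
  by rewrite -G5; ring.
split=> //.
  apply: (mulfI x1); transitivity (z B - (2 * x ^+ 3 - 1)); first by rewrite F2; ring.
  by rewrite G4; ring.
apply: (mulfI x2); transitivity (z T - 1); first by rewrite F3; ring.
by rewrite G5; ring.
Qed.

(** The double lines give [base_count]; the real and imaginary pairs then give q (n1 - 1) + n2 and
    n2 - q (n1 - 1), hence n1 and n2. Conversely, the nonsingular conics follow from the total in
    [card_web_forms]. *)
Lemma distributionP W W' (M N M' N' : 'M[F]_3) : web W -> web W' ->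
  web_pencil W M N -> web_pencil W' M' N' ->
  hyperplane_orbit_distribution iota W = hyperplane_orbit_distribution iota W' <->
  [/\ rank_count 1 M N = rank_count 1 M' N', rank_count 2 M N = rank_count 2 M' N'
    & base_count M N = base_count M' N'].
Proof.
move=> dW dW' /distribution_equations [] + + + /distribution_equations [].
have := card_web_forms iota cL dW; have := card_web_forms iota cL dW'.
rewrite /hyperplane_orbit_distribution; have q2 := card_ge2 F.
move: (nb_conics W (@double_line F)) (nb_conics W (@real_lines F)) (nb_conics W (imaginary_lines iota)) (nb_conics W (nonsingular_conic iota))
  (nb_conics W' (@double_line F)) (nb_conics W' (@real_lines F)) (nb_conics W' (imaginary_lines iota)) (nb_conics W' (nonsingular_conic iota)) => d r i s d' r' i' s'.
move: (rank_count 1 M N) (rank_count 2 M N) (rank_count 1 M' N') (rank_count 2 M' N')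
  (base_count M N) (base_count M' N') => n1 n2 n1' n2' h h' <- /eqP.
rewrite eqn_pmul2r ?subn_gt0 // => /eqP ES E1 E2 E3 E1' E2' E3'.
have x0 : (2 * q)%:Z != 0 :> int by apply/eqP; lia.
have x1 : q%:Z - 1 != 0 :> int by apply/eqP; lia.
have x2 : 2 * (q%:Z - 1) != 0 :> int by apply/eqP; lia.
split=> [[ed er ei _]|[en1 en2 eh]].
  rewrite ed er ei in E1 E2 E3.
  have eh : h = h' by move: E1; rewrite E1' => ?; lia.
  rewrite eh in E2 E3.
  have {}E2 := etrans (esym E2) E2'; have {}E3 := etrans (esym E3) E3'.
  have y0 : q%:Z != 0 :> int by apply/eqP; lia.
  have K2 : q%:Z * (n1%:Z - 1) + n2%:Z - 1 = q%:Z * (n1'%:Z - 1) + n2'%:Z - 1.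
    by apply: (mulfI y0); exact: addrI E2.
  have K3 : n2%:Z - 1 - q%:Z * (n1%:Z - 1) = n2'%:Z - 1 - q%:Z * (n1'%:Z - 1).
    by apply: (mulfI y0); exact: addrI E3.
  have K1 : n1%:Z - 1 = n1'%:Z - 1 :> int by apply: (mulfI y0); lia.
  rewrite K1 in K2; split=> //; lia.
subst n1' n2' h'.
have ed : d = d' by apply/eqP; rewrite -(eqr_nat int) !natz; apply/eqP/(mulIf x1); rewrite E1.
have er : r = r'.
  by apply/eqP; rewrite -(eqr_nat int) !natz; apply/eqP/(mulIf x2)/(addIr (h%:Z - 1)); exact: etrans E2 (esym E2').
have ei : i = i'.
  by apply/eqP; rewrite -(eqr_nat int) !natz; apply/eqP/(mulIf x2)/(addIr (h%:Z - 1)); exact: etrans E3 (esym E3').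
by subst; congr (_, _, _, _); lia.
Qed.

(** Translates the last alternative of [tag_spec_unique] into the distribution excluded by the
    theorem. *)
Lemma distribution_F2 W (M N : 'M[F]_3) : web W -> web_pencil W M N -> q = 2%N ->
  rank_count 1 M N = 1%N -> rank_count 2 M N = 4%N -> base_count M N = 2%N ->
  hyperplane_orbit_distribution iota W = (1, 6, 4, 4)%N.
Proof.
move=> dW /distribution_equations [+ + +] E e1 e2 eh; rewrite e1 e2 eh E.
have := card_web_forms iota cL dW; rewrite /hyperplane_orbit_distribution E.
move: (nb_conics W (@double_line F)) (nb_conics W (@real_lines F)) (nb_conics W (imaginary_lines iota)) (nb_conics W (nonsingular_conic iota)) => d r i s.
by move=> ES E1 E2 E3; congr (_, _, _, _); lia.
Qed.

End Distribution.

(** * The exceptional webs *)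

Section NamedWebs.

Variable F : finFieldType.
Implicit Types (W : {vspace 'rV[F]_6}) (M N X : 'M[F]_3) (k l : 'rV[F]_3).

Definition rv6 (a b c d e f : F) : 'rV[F]_6 := \row_j nth 0 [:: a; b; c; d; e; f] j.

Lemma rv6E (a : 'rV[F]_6) : a = rv6 (a 0 'o0) (a 0 'o1) (a 0 'o2) (a 0 'o3) (a 0 'o4) (a 0 'o5).
Proof. by apply/rowP; elim/ord6P; rewrite !mxE. Qed.

Lemma qform_rv6 a b c d e f : qform (rv6 a b c d e f) =
  a *: ('X_i0 * 'X_i0) + b *: ('X_i0 * 'X_i1) + c *: ('X_i0 * 'X_i2)
  + d *: ('X_i1 * 'X_i1) + e *: ('X_i1 * 'X_i2) + f *: ('X_i2 * 'X_i2).
Proof. by rewrite /qform sum6E !qmonomE /= !mxE /= !mpolyXD. Qed.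

Lemma inc_sym3 (a : 'rV[F]_6) b c d e f g : inc a (sym3 b c d e f g) =
  a 0 'o0 * b + a 0 'o1 * c + a 0 'o2 * d + a 0 'o3 * e + a 0 'o4 * f + a 0 'o5 * g.
Proof. by rewrite /inc !mxE. Qed.

Lemma span4_pencil f1 f2 f3 f4 M N : M^T = M -> N^T = N -> indep M N ->
  (forall f, f \in [:: f1; f2; f3; f4] -> (inc f M == 0) && (inc f N == 0)) ->
  (forall a, inc a M = 0 -> inc a N = 0 -> exists c1 c2 c3 c4,
     a = c1 *: f1 + c2 *: f2 + c3 *: f3 + c4 *: f4) ->
  web_pencil <<[:: f1; f2; f3; f4]>>%VS M N.
Proof.
move=> sM sN ind Z S; split=> // a; apply/idP/andP => [aW|[/eqP aM /eqP aN]].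
  have D X x y : inc (x + y) X = inc x X + inc y X by rewrite /inc !mxE; ring.
  have Sc c X x : inc (c *: x) X = c * inc x X by rewrite /inc !mxE; ring.
  rewrite (coord_span (aW : a \in <<[tuple f1; f2; f3; f4]>>%VS)); apply/andP.
  apply: (big_ind (fun v => (inc v M == 0) && (inc v N == 0))) => [|x y|i _].
  - by rewrite /inc !mxE !mul0r !addr0 eqxx.
  - by rewrite !D => /andP[/eqP-> /eqP->] /andP[/eqP-> /eqP->]; rewrite addr0 eqxx.
  rewrite !Sc.
  by have /andP[/eqP-> /eqP->] := Z _ (mem_nth (s := [:: f1; f2; f3; f4]) 0 (ltn_ord i)); rewrite mulr0 eqxx.
have [c1 [c2 [c3 [c4 ->]]]] := S a aM aN.
by rewrite !memvD // memvZ // memv_span // !inE eqxx ?orbT.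
Qed.

Lemma no_rank1_indep M N : no_rank1 M N -> indep M N.
Proof.
move=> /forallP nr; apply/forallP => p; apply/implyP => /eqP p0.
by apply: (implyP (nr p)); rewrite p0 mxrank0.
Qed.

Local Notation X0 := ('X_i0 : {mpoly F[3]}).
Local Notation X1 := ('X_i1 : {mpoly F[3]}).
Local Notation X2 := ('X_i2 : {mpoly F[3]}).

Let qformE := (@qformK, scale0r, scale1r, scaleN1r, add0r, addr0).

Lemma qcoefs_rv6 (p : {mpoly F[3]}) a b c d e f : p = qform (rv6 a b c d e f) ->
  qcoefs p = rv6 a b c d e f.
Proof. by move=> ->; rewrite qformK. Qed.

Lemma no_rank1_W15_1 (v1 u : F) : v1 != 0 ->
  no_rank1 (sym3 1 0 0 v1^-1 0 0) (sym3 0 1 0 u 0 1).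
Proof.
move=> v0; apply/forallP => -[s t]; apply/implyP; rewrite /pencil sym3_lin.
case/rank_sym3_le1P => [[E1 E2 _] _]; rewrite pair_eq0.
rewrite ?(mulr0, mulr1, mul0r, addr0, add0r) in E1 E2.
have [s0|s0] := eqVneq s 0; first by rewrite -sqrf_eq0 -E1 s0 mul0r eqxx.
have t0 : t = 0 by apply: (mulfI s0); rewrite E2 expr0n mulr0.
by move/eqP: E1; rewrite t0 mul0r addr0 expr0n !mulf_eq0 (negPf s0) invr_eq0 (negPf v0).
Qed.

(** The pencil is read off from the equations dual to the generators: Y2 = Y4 = 0, Y1 = Y5 and Y3 =
    v1^-1 Y0 + u Y1. *)
Lemma web_pencil_W15_1 (u v1 : F) : W15_1_params u v1 ->
  web_pencil (W15_1 u v1) (sym3 1 0 0 v1^-1 0 0) (sym3 0 1 0 u 0 1).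
Proof.
move=> [v0 irr _]; rewrite /W15_1 /web_of.
rewrite (@qcoefs_rv6 (X0 * X2) 0 0 1 0 0 0) ?qform_rv6 ?qformE //.
rewrite (@qcoefs_rv6 (X1 * X2) 0 0 0 0 1 0) ?qform_rv6 ?qformE //.
rewrite (@qcoefs_rv6 (_ - _) 0 1 0 0 0 (-1)) ?qform_rv6 ?qformE //.
rewrite (@qcoefs_rv6 _ v1^-1 u 0 (-1) 0 0) ?qform_rv6 ?qformE //.
apply: span4_pencil; rewrite ?tr_sym3 //; first exact/no_rank1_indep/no_rank1_W15_1.
  move=> f; rewrite !inE => /or4P[] /eqP->; rewrite !inc_sym3 !mxE /=;
  by apply/andP; split; apply/eqP; ring.
move=> a; rewrite !inc_sym3 => E1 E2.
exists (a 0 'o2), (a 0 'o4), (- a 0 'o5), (- a 0 'o3); rewrite [LHS]rv6E.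
apply/rowP; elim/ord6P; rewrite !mxE /=; try ring.
  by apply/eqP; rewrite -subr_eq0 -[X in _ == X]E1; apply/eqP; ring.
by apply/eqP; rewrite -subr_eq0 -[X in _ == X]E2; apply/eqP; ring.
Qed.

Lemma no_rank1_W16_1 : no_rank1 (sym3 0 0 1 1 0 0) (sym3 0 0 0 0 1 0 : 'M[F]_3).
Proof.
apply/forallP => -[s t]; apply/implyP; rewrite /pencil sym3_lin.
case/rank_sym3_le1P => [[_ E2 E3] _]; rewrite pair_eq0.
rewrite ?(mulr0, mulr1, mul0r, addr0, add0r) in E2 E3.
by rewrite -[s == 0]sqrf_eq0 -E2 -[t == 0]sqrf_eq0 -E3 eqxx.
Qed.

Lemma web_pencil_W16_1 : web_pencil (@W16_1 F) (sym3 0 0 1 1 0 0) (sym3 0 0 0 0 1 0).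
Proof.
rewrite /W16_1 /web_of.
rewrite (@qcoefs_rv6 (X0 ^+ 2) 1 0 0 0 0 0) ?qform_rv6 ?qformE //.
rewrite (@qcoefs_rv6 (X0 * X1) 0 1 0 0 0 0) ?qform_rv6 ?qformE //.
rewrite (@qcoefs_rv6 (_ - _) 0 0 1 (-1) 0 0) ?qform_rv6 ?qformE //.
rewrite (@qcoefs_rv6 (X2 ^+ 2) 0 0 0 0 0 1) ?qform_rv6 ?qformE //.
apply: span4_pencil; rewrite ?tr_sym3 //; first exact/no_rank1_indep/no_rank1_W16_1.
  move=> f; rewrite !inE => /or4P[] /eqP->; rewrite !inc_sym3 !mxE /=;
  by apply/andP; split; apply/eqP; ring.
move=> a; rewrite !inc_sym3 => E1 E2.
exists (a 0 'o0), (a 0 'o1), (a 0 'o2), (a 0 'o5); rewrite [LHS]rv6E.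
apply/rowP; elim/ord6P; rewrite !mxE /=; try ring.
  by apply/eqP; rewrite -subr_eq0 -[X in _ == X]E1; apply/eqP; ring.
by apply/eqP; rewrite -subr_eq0 -[X in _ == X]E2; apply/eqP; ring.
Qed.

Lemma no_rank1_W16_3 : no_rank1 (sym3 0 0 0 0 1 1) (sym3 0 0 1 1 0 0 : 'M[F]_3).
Proof.
apply/forallP => -[s t]; apply/implyP; rewrite /pencil sym3_lin.
case/rank_sym3_le1P => [[_ E2 E3] _]; rewrite pair_eq0.
rewrite ?(mulr0, mulr1, mul0r, addr0, add0r) in E2 E3.
have t0 : t = 0 by apply/eqP; rewrite -sqrf_eq0 -E2.
by rewrite t0 eqxx andbT -sqrf_eq0 -E3 t0 mul0r.
Qed.

Lemma web_pencil_W16_3 : 2%:R = 0 :> F ->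
  web_pencil (@W16_3 F) (sym3 0 0 0 0 1 1) (sym3 0 0 1 1 0 0).
Proof.
move=> c2; have c2' : 1 + 1 = 0 :> F by rewrite -[RHS]c2; ring.
rewrite /W16_3 /web_of.
rewrite (@qcoefs_rv6 (X0 ^+ 2) 1 0 0 0 0 0) ?qform_rv6 ?qformE //.
rewrite (@qcoefs_rv6 (X0 * X1) 0 1 0 0 0 0) ?qform_rv6 ?qformE //.
rewrite (@qcoefs_rv6 (X0 * X2 + _) 0 0 1 1 0 0) ?qform_rv6 ?qformE //.
rewrite (@qcoefs_rv6 (_ + _) 0 0 0 0 1 1) ?qform_rv6 ?qformE //.
apply: span4_pencil; rewrite ?tr_sym3 //; first exact/no_rank1_indep/no_rank1_W16_3.
  move=> f; rewrite !inE => /or4P[] /eqP->; rewrite !inc_sym3 !mxE /=;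
  by rewrite ?(mulr0, mulr1, mul0r, addr0, add0r) ?c2' eqxx.
have eqc (x y : F) : x + y = 0 -> x = y.
  move=> E; transitivity (x + y - y * (1 + 1) + y); first by ring.
  by rewrite E c2' mulr0 subr0 add0r.
move=> a; rewrite !inc_sym3 => E1 E2.
exists (a 0 'o0), (a 0 'o1), (a 0 'o3), (a 0 'o5); rewrite [LHS]rv6E.
apply/rowP; elim/ord6P; rewrite !mxE /=; try ring.
  by rewrite (eqc (a 0 'o2) (a 0 'o3)) -?[RHS]E2; ring.
by rewrite (eqc (a 0 'o4) (a 0 'o5)) -?[RHS]E1; ring.
Qed.

(* Separates the webs of an exceptional pair, whose counts all agree. *)
Definition kernel_in_web W : Prop := exists X k,
  [/\ X^T = X, X != 0, forall a, a \in W -> inc a X = 0, k != 0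
    & k *m X = 0 /\ gq (k^T *m k) \in W].

Lemma kernel_in_web_peq W M N M' N' p k : web_pencil W M N -> peq M N M' N' ->
  p != 0 -> k != 0 -> k *m pencil M' N' p = 0 -> base M' N' k -> kernel_in_web W.
Proof.
move=> [sM sN ind EW] E p0 k0 kp /andP[/eqP bM /eqP bN].
have ind' := indep_peq E ind.
case: (peq_sym E) => B Bu [[[[a b] c] d] [D E1 E2]].
have XE : B *m pencil M' N' p *m B^T = pencil M N (p.1 * a + p.2 * c, p.1 * b + p.2 * d).
  by rewrite /pencil congr_lin E1 E2 !scalerDr !scalerA !scalerDl addrACA.
exists (B *m pencil M' N' p *m B^T), (k *m invmx B); split.
- by rewrite XE pencil_tr.
- rewrite congr_eq0 //; apply: contra p0; exact: (implyP (forallP ind' p)).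
- move=> w; rewrite EW XE => /andP[/eqP wM /eqP wN].
  by rewrite /pencil inc_lin wM wN !mulr0 addr0.
- by apply: contra k0 => /eqP h; rewrite -(mulmxKV Bu k) h mul0mx.
split; first by rewrite !mulmxA mulmxKV // kp mul0mx.
have K X : bform (B *m X *m B^T) (k *m invmx B) (k *m invmx B) = bform X k k.
  by rewrite bform_congr mulmxKV.
have := K M'; have := K N'; rewrite E1 E2 bM bN.
have L s t := bform_lin M N (s, t) (k *m invmx B) (k *m invmx B).
rewrite /pencil /= in L; rewrite !L => K2 K1.
rewrite EW !inc_mul //; apply/andP; split; apply/eqP; apply: (mulIf D); rewrite mul0r.
  transitivity ((a * bform M (k *m invmx B) (k *m invmx B) + b * bform N (k *m invmx B) (k *m invmx B)) * d
    - (c * bform M (k *m invmx B) (k *m invmx B) + d * bform N (k *m invmx B) (k *m invmx B)) * b).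
    by ring.
  by rewrite K1 K2 !mul0r subrr.
transitivity ((c * bform M (k *m invmx B) (k *m invmx B) + d * bform N (k *m invmx B) (k *m invmx B)) * a
    - (a * bform M (k *m invmx B) (k *m invmx B) + b * bform N (k *m invmx B) (k *m invmx B)) * c).
  by ring.
by rewrite K1 K2 !mul0r subrr.
Qed.

(** A matrix orthogonal to the web is [sym3 a b 0 d 0 b] with d = v1^-1 a + u b. For b nonzero its
    determinant b (v1^-1 a^2 + u a b - b^2) is nonzero by the condition on u and v1; for b = 0 its
    kernel consists of the multiples of e2, which is not a base point. *)
Lemma no_kernel_in_W15_1 (u v1 : F) : W15_1_params u v1 -> ~ kernel_in_web (W15_1 u v1).
Proof.
move=> huv; case: (huv) => v0 irr _ [X [k [sX X0 XW k0 [kX]]]].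
have [_ _ _ EW] := web_pencil_W15_1 huv; rewrite EW !inc_mul ?tr_sym3 //.
have G a b c d e f : a + v1^-1 * d = 0 -> b + u * d + f = 0 -> inc (rv6 a b c d e f) X = 0.
  move=> h1 h2; apply: XW; rewrite EW !inc_sym3 !mxE /=.
  by apply/andP; split; apply/eqP; [rewrite -[RHS]h1|rewrite -[RHS]h2]; ring.
have := G 0 0 1 0 0 0; have := G 0 0 0 0 1 0; have := G 0 1 0 0 0 (-1); have := G v1^-1 u 0 (-1) 0 0.
rewrite (sym3P sX) in X0 kX *; rewrite !inc_sym3 !mxE /= {G XW EW}.
move: (X i0 i0) (X i0 i1) (X i0 i2) (X i1 i1) (X i1 i2) (X i2 i2) X0 kX => a b c d e f.
rewrite [k]rv3E !bform_sym3 mul_rv3_sym3 rv3_eq0 in k0 *.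
move: (k 0 i0) (k 0 i1) (k 0 i2) k0 => x y z k0 X0 /eqP.
rewrite rv3_eq0 => /and3P[/eqP K1 /eqP K2 /eqP K3] H1 H2 H3 H4.
have c0 : c = 0 by rewrite -[RHS]H4; ring.
have e0 : e = 0 by rewrite -[RHS]H3; ring.
have bf : b = f by apply/eqP; rewrite -subr_eq0 -H2; [apply/eqP| |]; ring.
have dE : v1^-1 * a + u * b = d by apply/eqP; rewrite -subr_eq0 -H1; [apply/eqP| |]; ring.
rewrite {H1 H2 H3 H4}c0 e0 -{}bf -{}dE in X0 K1 K2 K3 *.
have [b0|b0] := eqVneq b 0; last first.
  have z0 : z = 0 by apply: (mulIf b0); rewrite mul0r -[RHS]K3; ring.
  have [D|D] := eqVneq (v1^-1 * a ^+ 2 + u * a * b - b ^+ 2) 0.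
    move=> _; case/eqP: (irr (a / (v1 * b))); apply: (mulfI (expf_neq0 2 b0)).
    rewrite mulr0 -[RHS]D; field; by rewrite ?v0 ?b0.
  case/negP: k0; apply/and3P; split; rewrite ?z0 //; apply/eqP; apply: (mulfI D); rewrite mulr0.
    transitivity ((v1^-1 * a + u * b) * (x * a + y * b + z * 0)
      - b * (x * b + y * (v1^-1 * a + u * b) + z * 0)); first by ring.
    by rewrite K1 K2; ring.
  transitivity (a * (x * b + y * (v1^-1 * a + u * b) + z * 0)
      - b * (x * a + y * b + z * 0)); first by ring.
  by rewrite K1 K2; ring.
have a0 : a != 0.
  by apply: contra X0 => /eqP->; rewrite b0 !mulr0 addr0 sym3_0.
have x0 : x = 0 by apply: (mulIf a0); rewrite mul0r -[RHS]K1 b0; ring.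
have y0 : y = 0.
  by apply: (mulIf a0); apply: (mulfI (invr_neq0 v0)); rewrite mul0r mulr0 -[RHS]K2 b0; ring.
rewrite x0 y0 => /andP[_]; rewrite (_ : sbf _ _ _ _ _ _ _ _ _ _ _ _ = z ^+ 2); last by rewrite /sbf; ring.
by rewrite sqrf_eq0 => z0; case/negP: k0; rewrite x0 y0 z0 eqxx.
Qed.

Lemma act_proj_equivP W W' A : A \in unitmx ->
  (forall a : 'rV[F]_6, a \in W' <-> exists2 b, b \in W & qform a = lin_subst A (qform b)) <->
  (forall a : 'rV[F]_6, (act A a \in W') = (a \in W)).
Proof.
move=> Au; split=> [E a|E a].
  apply/idP/idP => [/E[b bW]|aW]; last by apply/E; exists a; rewrite ?lin_substE.
  rewrite lin_substE => /(@qform_inj F) /(congr1 (act (invmx A))).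
  by rewrite !act_comp mulmxV // !act1 => ->.
split=> [aW|[b bW]]; last by rewrite lin_substE => /(@qform_inj F) ->; rewrite E.
exists (act (invmx A) a); last by rewrite lin_substE act_comp mulVmx // act1.
by rewrite -E act_comp mulVmx // act1.
Qed.

Lemma proj_equiv_sym W W' : proj_equiv W W' -> proj_equiv W' W.
Proof.
case=> A Au /(act_proj_equivP _ _ Au) E; have Iu : invmx A \in unitmx by rewrite unitmx_inv.
exists (invmx A) => //; apply/(act_proj_equivP _ _ Iu) => a.
by rewrite -E act_comp mulVmx // act1.
Qed.

Lemma pencil_W16_1 :
  Gpeq (sym3 0 0 1 1 0 0 : 'M[F]_3) (sym3 0 0 0 0 1 0) 1 0 0 0.
Proof.
apply: (@peq_sym3 _ 0 0 1 1 0 0 0 1 0 1 0 0 1).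
- by rewrite (_ : _ + _ = 1) ?oner_eq0 //; ring.
- by rewrite (_ : _ - _ = 1) ?oner_eq0 //; ring.
- by rewrite /= /sbf; do 2!split; ring.
- by rewrite /= /sbf; do 2!split; ring.
Qed.

(** * The tag of [W15_1] *)

Section Tagged.

Variables (t nu a0 b0 : F).
Hypothesis irt : irr2 t.
Hypothesis nnu : 2%:R != 0 :> F -> nonsq nu.
Hypothesis Eab : 2%:R != 0 :> F -> a0 ^+ 2 - nu * b0 ^+ 2 = nu.
Local Notation tagged := (has_tag t nu a0 b0).

Lemma has_tag_peq_trans tau M N M' N' : peq M' N' M N -> tagged tau M N -> tagged tau M' N'.
Proof.
move=> E; have nr := no_rank1_peq (peq_sym E); have T X Y := peq_trans (M2 := X) (N2 := Y) E.
case: tau => /=; try exact: T.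
all: try by case=> /nr h H; split; [|exact: T H].
all: try by case=> /nr h [c H]; split; [|split; [|exact: T H]].
all: try by case=> -[c H]; [left|right]; split; [|exact: T H| |exact: T H].
  by case=> /nr h [g0 [g1 [g2 [g3 [H an]]]]]; split=> //; exists g0, g1, g2, g3; split=> //; exact: T H.
by case=> /nr h [[c H]|[c H]]; split=> //; [left|right]; split=> //; exact: T H.
Qed.

Lemma kernel_in_web_cube W M N : web_pencil W M N -> tagged Gcube M N -> kernel_in_web W.
Proof.
move=> WP [_ E]; apply: (kernel_in_web_peq WP E (p := (0, 1)) (k := rv3 0 1 0)).
- by rewrite pair_eq0 oner_eq0 andbF.
- by rewrite rv3_eq0 oner_eq0 andbF.
- by rewrite pencil01 mul_rv3_sym3; apply/eqP; rewrite rv3_eq0; apply/and3P; split; apply/eqP; ring.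
by rewrite base_sym3 /sbf; apply/andP; split; apply/eqP; ring.
Qed.

Lemma kernel_in_web_B16 W M N : web_pencil W M N -> tagged B16 M N -> kernel_in_web W.
Proof.
move=> WP [_ [c2 E]]; apply: (kernel_in_web_peq WP E (p := (1, 0)) (k := rv3 1 0 0)).
- by rewrite pair_eq0 oner_eq0.
- by rewrite rv3_eq0 oner_eq0.
- by rewrite pencil10 mul_rv3_sym3; apply/eqP; rewrite rv3_eq0; apply/and3P; split; apply/eqP; ring.
by rewrite base_sym3 /sbf; apply/andP; split; apply/eqP; ring.
Qed.

(** For odd q put w^2 = - v1. A base point (e / w, 1, z) with e = 1 or e = -1 exists if - u - 2 e /
    w is a square. If both were nonsquares, their product u^2 - 4 / w^2 would be a square, and with
    it the discriminant of v1 x^2 + u v1 x - 1, which has no root. *)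
Lemma spec_W15_1 (u v1 : F) : W15_1_params u v1 ->
  let M := sym3 1 0 0 v1^-1 0 0 in let N := sym3 0 1 0 u 0 1 in
  [/\ rank_count 1 M N = 1%N, rank_count 2 M N = #|F|
    & 2%:R != 0 :> F -> (1 < base_count M N)%N].
Proof.
move=> [v0 irr sq] /=; split.
- exact/no_rank1_count/no_rank1_W15_1.
- apply: (@card_lineE F _ 0 1) => [|s r]; first by rewrite oner_eq0 orbT.
  rewrite (_ : s * 0 + r * 1 = r) ?rank2_pencil_sym3 ?det_pencil_sym3 /=; last by ring.
  rewrite (_ : _ - _ = r * (s ^+ 2 / v1 + u * s * r - r ^+ 2)); last by ring.
  rewrite mulf_eq0; case: eqVneq => //= r0; apply/eqP => E.
  case/eqP: (irr (s / (v1 * r))); apply: (mulfI (expf_neq0 2 r0)).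
  by rewrite mulr0 -[RHS]E; field; rewrite ?v0 ?r0.
move=> c2; have [w wE] : exists w, w ^+ 2 = - v1 by apply: sq; rewrite odd_cardF.
have w0 : w != 0 by apply: contraNneq v0 => w0; rewrite -oppr_eq0 -wE w0 expr0n.
have v1E : v1 = - w ^+ 2 by rewrite wE opprK.
have H e z : e ^+ 2 = 1 -> - u - 2%:R * e / w = z ^+ 2 ->
  (1 < base_count (sym3 1 0 0 v1^-1 0 0) (sym3 0 1 0 u 0 1))%N.
  move=> e1 zE; apply: (@base_count_gt1 _ _ _ (rv3 (e / w) 1 z)).
    by rewrite rv3_eq0 oner_eq0 andbF.
  rewrite base_sym3 /sbf; apply/andP; split; apply/eqP.
    rewrite v1E; transitivity ((e ^+ 2 - 1) / w ^+ 2); last by rewrite e1 subrr mul0r.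
    by field; rewrite ?oppr_eq0 ?sqrf_eq0 ?w0.
  transitivity (u + 2%:R * e / w + z ^+ 2); last by rewrite -zE; ring.
  by ring.
have [[z E]|n1] := nonsqP (- u - 2%:R * 1 / w); first by apply: (H 1 z _ E); rewrite expr1n.
have [[z E]|n2] := nonsqP (- u - 2%:R * (-1) / w); first by apply: (H (-1) z _ E); rewrite sqrrN expr1n.
have [s s0 E] := nonsq_ratio c2 n1 n2.
pose r := s * (- u - 2%:R * 1 / w).
have rE : r ^+ 2 = u ^+ 2 - 4%:R / w ^+ 2.
  transitivity ((- u - 2%:R * 1 / w) * ((- u - 2%:R * 1 / w) * s ^+ 2)); first by rewrite /r; ring.
  by rewrite -E; field.
have c4 : 4%:R != 0 :> F by rewrite (natrM F 2 2) mulf_neq0.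
case/eqP: (irr ((r - u) / 2%:R)).
transitivity ((v1 * (r ^+ 2 - u ^+ 2) - 4%:R) / 4%:R); last first.
  by rewrite rE v1E; field; rewrite ?oppr_eq0 ?sqrf_eq0 ?w0 ?c4.
by field; rewrite ?c2 ?c4.
Qed.

(** The rank counts leave [Gquad], [Gcube], [B16] and, for odd q, [O15]. The last has no base point,
    and [Gcube] and [B16] are excluded by [no_kernel_in_W15_1]. *)
Lemma tag_W15_1 (u v1 : F) : W15_1_params u v1 ->
  tagged Gquad (sym3 1 0 0 v1^-1 0 0) (sym3 0 1 0 u 0 1).
Proof.
move=> huv; have WP := web_pencil_W15_1 huv; have [sM sN ind _] := WP.
have nK := no_kernel_in_W15_1 huv.
have [tau T] := tag_exists irt nnu Eab sM sN ind.
have [n1 n2 h] := spec_W15_1 huv.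
have := has_tag_spec irt nnu Eab T; rewrite n1 n2 {n1 n2}.
have q2 := card_ge2 F.
have sq : (#|F| ^ 2 = #|F| * #|F|)%N by rewrite mulnn.
have b1 : (2 * #|F| <= #|F| * #|F|)%N by rewrite leq_mul2r q2 orbT.
have K1 := @kernel_in_web_cube _ _ _ WP; have K2 := @kernel_in_web_B16 _ _ _ WP.
rewrite /tag_spec sq; move: (base_count _ _) h b1 {sq}; move: (#|F| * #|F|)%N => Q.
move: #|F| q2 => r q2 h hh b1 S.
suff: [\/ tau = Gquad, tau = Gcube | tau = B16].
  by case=> E; rewrite E in T; [|case: (nK (K1 T))|case: (nK (K2 T))].
move: S hh q2 b1; clear; case: tau; intros; repeat match goal with
  | H : _ /\ _ |- _ => destruct H
  | H : and3 _ _ _ |- _ => destruct H end;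
first [ by constructor 1 | by constructor 2 | by constructor 3 | exfalso ].
all: try (clear hh; lia).
by move: (hh H); lia.
Qed.

End Tagged.

End NamedWebs.

(** For odd q, nu is the discriminant of the irreducible X^2 + t X + 1, hence a nonsquare. The pair
    a0, b0 solves a norm equation: a0 + b0 sqrt(nu) has nonsquare norm nu, so it is a nonsquare of
    the quadratic extension. *)
Lemma parameters_exist (F : finFieldType) : exists t nu a0 b0 : F,
  [/\ irr2 t, 2%:R != 0 :> F -> nonsq nu & 2%:R != 0 :> F -> a0 ^+ 2 - nu * b0 ^+ 2 = nu].
Proof.
have [t irt] := exists_irred_param F; exists t, (t ^+ 2 - 4%:R).
have [c2|c2] := eqVneq (2%:R : F) 0; first by exists 0, 0.
have ns : nonsq (t ^+ 2 - 4%:R).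
  move=> w; apply/eqP => E; case/eqP: (irt ((w - t) / 2%:R)).
  have c4 : 4%:R != 0 :> F by rewrite (natrM F 2 2) mulf_neq0.
  transitivity ((w ^+ 2 - (t ^+ 2 - 4%:R)) / 4%:R); first by field; rewrite ?c2 ?c4.
  by rewrite E subrr mul0r.
have nu0 : t ^+ 2 - 4%:R != 0 by have := ns 0; rewrite expr0n /= eq_sym.
have [||x [y E]] := @sum_squares F 1 (- (t ^+ 2 - 4%:R)) (t ^+ 2 - 4%:R) c2.
- exact: oner_neq0.
- by rewrite oppr_eq0.
by exists x, y; split=> // _; rewrite -[RHS]E mul1r mulNr.
Qed.

(** * Tags of webs and the comparison of distributions *)

Section TaggedWebs.

Variable F : finFieldType.
Variables (t nu a0 b0 : F).
Hypothesis irt : irr2 t.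
Hypothesis nnu : 2%:R != 0 :> F -> nonsq nu.
Hypothesis Eab : 2%:R != 0 :> F -> a0 ^+ 2 - nu * b0 ^+ 2 = nu.
Implicit Types (W : {vspace 'rV[F]_6}).

Definition web_tag tau W : Prop :=
  exists M N, web_pencil W M N /\ has_tag t nu a0 b0 tau M N.

Lemma web_tag_exists W : web W -> exists tau, web_tag tau W.
Proof.
move=> /web_pencil_exists[M [N WP]]; have [sM sN ind _] := WP.
by have [tau T] := tag_exists irt nnu Eab sM sN ind; exists tau, M, N.
Qed.

Lemma web_tag_equiv W W' tau : proj_equiv W W' -> web_tag tau W' -> web_tag tau W.
Proof.
move=> E [M' [N' [WP T]]]; have [M [N [WP' EM]]] := proj_equiv_pencil E WP.
by exists M, N; split=> //; exact: has_tag_peq_trans EM T.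
Qed.

Lemma web_tag_proj_equiv W W' tau : web_tag tau W -> web_tag tau W' -> proj_equiv W W'.
Proof.
by move=> [M [N [WP T]]] [M' [N' [WP' T']]]; exact: peq_proj_equiv WP WP' (has_tag_peq T T').
Qed.

Lemma web_tag_W15_1 u v1 : W15_1_params u v1 -> web_tag Gquad (W15_1 u v1).
Proof.
move=> huv; exists (sym3 1 0 0 v1^-1 0 0), (sym3 0 1 0 u 0 1); split.
  exact: web_pencil_W15_1.
exact: tag_W15_1.
Qed.

Lemma web_tag_W16_1 : web_tag Gcube (@W16_1 F).
Proof.
exists (sym3 0 0 1 1 0 0), (sym3 0 0 0 0 1 0); split; first exact: web_pencil_W16_1.
by split; [exact: no_rank1_W16_1|exact: pencil_W16_1].
Qed.

Lemma web_tag_W16_3 : 2%:R = 0 :> F -> web_tag B16 (@W16_3 F).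
Proof.
move=> c2; exists (sym3 0 0 0 0 1 1), (sym3 0 0 1 1 0 0); split; first exact: web_pencil_W16_3.
by split; [exact: no_rank1_W16_3|split=> //; exact: peq_refl].
Qed.

(** A web with the tag [Gcube] or [B16] satisfies [kernel_in_web], and [W15_1] does not. *)
Lemma not_equiv_W15_1 u v1 W W' tau : W15_1_params u v1 -> tau = Gcube \/ tau = B16 ->
  web_tag tau W -> proj_equiv W' (W15_1 u v1) -> ~ proj_equiv W W' /\ ~ proj_equiv W' W.
Proof.
move=> huv tauE T /proj_equiv_sym E.
have H : ~ proj_equiv W' W.
  move=> /web_tag_equiv/(_ T)/(web_tag_equiv E)[M [N [WP TM]]].
  apply: (no_kernel_in_W15_1 huv).
  by case: tauE => tauE; rewrite tauE in TM; [exact: kernel_in_web_cube WP TM|exact: kernel_in_web_B16 WP TM].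
by split=> // /proj_equiv_sym.
Qed.

Section Counts.

Variables (L : finFieldType) (iota : {rmorphism F -> L}).
Hypothesis cL : #|L| = (#|F| ^ 2)%N.

Lemma distribution_tags W W' tau tau' : web W -> web W' ->
  web_tag tau W -> web_tag tau' W' ->
  (forall n1 n2 h n1' n2' h', @tag_spec F tau n1 n2 h -> @tag_spec F tau' n1' n2' h' ->
     [/\ n1 = n1', n2 = n2' & h = h']) ->
  hyperplane_orbit_distribution iota W = hyperplane_orbit_distribution iota W'.
Proof.
move=> dW dW' [M [N [WP T]]] [M' [N' [WP' T']]] H.
apply/(distributionP iota cL dW dW' WP WP').
exact: H (has_tag_spec irt nnu Eab T) (has_tag_spec irt nnu Eab T').
Qed.

Lemma distribution_complete W W' : web W -> web W' ->
  hyperplane_orbit_distribution iota W = hyperplane_orbit_distribution iota W' ->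
  ~ (#|F| = 2%N /\ hyperplane_orbit_distribution iota W = (1, 6, 4, 4)%N) ->
  exists tau tau', [/\ web_tag tau W, web_tag tau' W' &
    [\/ tau = tau',
        2%:R != 0 :> F /\ (tau = Gcube /\ tau' = Gquad \/ tau = Gquad /\ tau' = Gcube)
      | 2%:R = 0 :> F /\ (tau = B16 /\ tau' = Gquad \/ tau = Gquad /\ tau' = B16)]].
Proof.
move=> dW dW' E nE; have [tau [M [N [WP T]]]] := web_tag_exists dW.
have [tau' [M' [N' [WP' T']]]] := web_tag_exists dW'.
exists tau, tau'; split; [by exists M, N|by exists M', N'|].
have [e1 e2 eh] := (distributionP iota cL dW dW' WP WP').1 E.
have S := has_tag_spec irt nnu Eab T; have := has_tag_spec irt nnu Eab T'.
rewrite -e1 -e2 -eh => S'.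
have [H|H|H|[q2 [H1 H2 Hh]]] := tag_spec_unique S S'.
- by constructor 1.
- by constructor 2.
- by constructor 3.
by case: nE; split=> //; exact: (distribution_F2 iota cL dW WP q2 H1 H2 Hh).
Qed.

End Counts.

End TaggedWebs.

(* The hyperplane-orbit distribution [1, 6, 4, 4] over F_2, shared by two
   inequivalent webs, is left out of the completeness part. *)
Theorem theorem4p30 (F L : finFieldType) (iota : {rmorphism F -> L})
    (cardL : #|L| = (#|F| ^ 2)%N)
    (u v1 : F) (huv : W15_1_params u v1)
    (W W' : {vspace 'rV[F]_6}) (webW : web W) (webW' : web W') :
  (hyperplane_orbit_distribution iota W =
     hyperplane_orbit_distribution iota W' ->
   ~ (#|F| = 2%N /\ hyperplane_orbit_distribution iota W = (1, 6, 4, 4)%N) ->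
   proj_equiv W W' \/ exceptional_pair u v1 W W') /\
  (exceptional_pair u v1 W W' ->
   ~ proj_equiv W W' /\
   hyperplane_orbit_distribution iota W =
     hyperplane_orbit_distribution iota W').
Proof.
have [t [nu [a0 [b0 [irt nnu Eab]]]]] := parameters_exist F.
have T15 := web_tag_W15_1 irt nnu Eab huv; have T161 := web_tag_W16_1 t nu a0 b0.
have T163 := @web_tag_W16_3 F t nu a0 b0.
have E := @web_tag_proj_equiv F t nu a0 b0.
have EQ := @web_tag_equiv F t nu a0 b0.
split=> [dE nE|].
  have [tau [tau' [T T' H]]] := distribution_complete irt nnu Eab cardL webW webW' dE nE.
  case: H => [eT|[c [] [eT eT']]|[c [] [eT eT']]]; subst; [by left; exact: E T T'|..]; right.
  - by left; rewrite odd_cardF; split=> //; right; split; [exact: E T T161|exact: E T' T15].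
  - by left; rewrite odd_cardF; split=> //; left; split; [exact: E T T15|exact: E T' T161].
  - by right; rewrite odd_cardF c eqxx; split=> //; right; split; [exact: E T (T163 c)|exact: E T' T15].
  - by right; rewrite odd_cardF c eqxx; split=> //; left; split; [exact: E T T15|exact: E T' (T163 c)].
have D := distribution_tags irt nnu Eab iota cardL.
have N := @not_equiv_W15_1 F t nu a0 b0 u v1.
rewrite /exceptional_pair odd_cardF.
(* In both normal forms one member up to scalars is singular, and for odd q there are two base
   points up to scalars. *)
have od_spec n1 n2 h n1' n2' h' : 2%:R != 0 :> F ->
    @tag_spec F Gcube n1 n2 h -> @tag_spec F Gquad n1' n2' h' -> [/\ n1 = n1', n2 = n2' & h = h'].
  move=> c /= [-> -> [/(_ c) k _]] [-> -> [/(_ c) k' _]]; split=> //.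
  by apply: (@addIn 1); rewrite k k'.
have ev_spec n1 n2 h n1' n2' h' :
    @tag_spec F B16 n1 n2 h -> @tag_spec F Gquad n1' n2' h' -> [/\ n1 = n1', n2 = n2' & h = h'].
  by move=> /= [c [-> -> ->]] [-> -> [_ /(_ c) ->]].
case=> -[c]; last move/negPn/eqP: c => c; case=> -[H H'].
- have T := EQ _ _ _ H T15; have T' := EQ _ _ _ H' T161.
  split; first exact: (N _ _ Gcube huv (or_introl erefl) T' H).2.
  apply: esym; apply: (D _ _ _ _ webW' webW T' T) => *; exact: od_spec.
- have T := EQ _ _ _ H T161; have T' := EQ _ _ _ H' T15.
  split; first exact: (N _ _ Gcube huv (or_introl erefl) T H').1.
  apply: (D _ _ _ _ webW webW' T T') => *; exact: od_spec.
- have T := EQ _ _ _ H T15; have T' := EQ _ _ _ H' (T163 c).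
  split; first exact: (N _ _ B16 huv (or_intror erefl) T' H).2.
  apply: esym; apply: (D _ _ _ _ webW' webW T' T) => *; exact: ev_spec.
have T := EQ _ _ _ H (T163 c); have T' := EQ _ _ _ H' T15.
split; first exact: (N _ _ B16 huv (or_intror erefl) T H').1.
apply: (D _ _ _ _ webW webW' T T') => *; exact: ev_spec.
Qed.
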